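(* Let $G=(X,w,\kappa,\mu)$ be a graph and let $T>0$. Then the following are equivalent: (a) $G$ satisfies stochastic completeness at infinity; (b) for some $\phi\in\mathcal I$ and some $u_0\in\ell^\infty(X)$, any two bounded pointwise solutions of (GPME) on $[0,T]\times X$ with initial datum $u_0$ coincide; (c) for all $\phi\in\mathcal I$ and all $u_0\in\ell^\infty(X)$, any two bounded pointwise solutions of (GPME) on $[0,T]\times X$ with initial datum $u_0$ coincide.
   Context: Graph: $G=(X,w,\kappa,\mu)$ where $X$ is a countable set, $\mu\colon X\to(0,\infty)$, $w\colon X\times X\to[0,\infty)$ is symmetric with $w(x,x)=0$ and $\sum_{y\in X}w(x,y)<\infty$ for every $x\in X$, and $\kappa\colon X\to[0,\infty)$ (killing term). Graphs are always assumed connected: any $x,y\in X$ are joined by a finite path $x=x_0,\dots,x_N=y$ with $w(x_i,x_{i+1})>0$ for all $i$. No local finiteness is assumed. $\ell^\infty(X)$ denotes the bounded functions $X\to\mathbb R$. Laplacian: $\mathcal F$ is the set of $f\colon X\to\mathbb R$ with $\sum_{y}w(x,y)|f(y)|<\infty$ for every $x$; for $f\in\mathcal F$, $\Delta f(x)=\frac1{\mu(x)}\sum_{y\in X}w(x,y)(f(x)-f(y))+\frac{\kappa(x)}{\mu(x)}f(x)$. Stochastic completeness at infinity: let $L$ be the positive self-adjoint operator on $\ell^2(X,\mu)$ associated with the closure of the form $Q(f,g)=\frac12\sum_{x,y}w(x,y)(f(x)-f(y))(g(x)-g(y))+\sum_x\kappa(x)f(x)g(x)$ defined on finitely supported functions.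 The semigroup $e^{-tL}$ is positivity preserving and is extended to functions $f\ge0$ by $e^{-tL}f=\lim_n e^{-tL}f_n\in[0,\infty]$ for finitely supported $0\le f_n\uparrow f$. $G$ satisfies stochastic completeness at infinity if for some (and hence all) $t>0$, $e^{-tL}1+\int_0^te^{-sL}(\kappa/\mu)\,ds=1$ pointwise on $X$. Nonlinearities: $\mathcal I$ is the set of continuous, increasing (in the weak sense: $s_1<s_2$ implies $\phi(s_1)\le\phi(s_2)$), nonconstant $\phi\colon\mathbb R\to\mathbb R$ with $\phi(0)=0$. Pointwise solutions: (GPME) is the Cauchy problem $\partial_tu+\Delta(\phi\circ u)=0$, $u|_{t=0}=u_0$. A pointwise solution on $[0,T]\times X$ with initial datum $u_0\colon X\to\mathbb R$ is a function $u\colon[0,T]\times X\to\mathbb R$ such that $\phi\circ u(t,\cdot)\in\mathcal F$ for every $t\in(0,T)$; $u(\cdot,x)\in C([0,T])\cap C^1((0,T))$ for every $x$; $\partial_tu(t,x)+\Delta(\phi\circ u(t,\cdot))(x)=0$ for all $(t,x)\in(0,T)\times X$; and $u(0,x)=u_0(x)$ for all $x$. It is bounded if $u$ is a bounded function. *)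

(* Defs.v *)
From HB Require Import structures.
From mathcomp Require Import all_boot all_order all_algebra.
From mathcomp Require Import all_classical all_reals all_analysis.
Set Implicit Arguments.
Unset Strict Implicit.
Unset Printing Implicit Defensive.
Import Order.TTheory GRing.Theory Num.Theory.
Import numFieldNormedType.Exports.
Local Open Scope classical_set_scope.
Local Open Scope ring_scope.

(* A weighted graph with killing term. A countType is finite or countably
   infinite; the list s below is x_1, ..., x_N in a path from x = x_0. *)
Record graph (R : realType) (X : countType) := Graph {
  weight : X -> X -> R ;
  killing : X -> R ;
  vmeas : X -> R ;
  weight_ge0 : forall x y, 0 <= weight x y ;
  weight_sym : forall x y, weight x y = weight y x ;
  weight_diag : forall x, weight x x = 0 ;
  weight_summable : forall x, (\esum_(y in [set: X]) (weight x y)%:E < +oo)%E ;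
  killing_ge0 : forall x, 0 <= killing x ;
  vmeas_gt0 : forall x, 0 < vmeas x ;
  graph_connected : forall x y,
    exists s : seq X, path [rel a b | 0 < weight a b] x s /\ last x s = y
}.

(* Unordered sum of a real family; it is only meaningful for absolutely
   summable families, which is the case wherever it is used. *)
Definition rsum (R : realType) (I : choiceType) (a : I -> R) : R :=
  fine (\esum_(i in [set: I]) (a^\+ i)%:E) -
  fine (\esum_(i in [set: I]) (a^\- i)%:E).

Section graph_defs.
Variables (R : realType) (X : countType) (G : graph R X).
Implicit Types (f g h : X -> R).

Definition dom_laplacian f : Prop :=
  forall x, (\esum_(y in [set: X]) (weight G x y * `|f y|)%:E < +oo)%E.

Definition laplacian f (x : X) : R :=
  (vmeas G x)^-1 * rsum (fun y => weight G x y * (f x - f y)) +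
  killing G x / vmeas G x * f x.

Definition ell2 f : Prop :=
  (\esum_(x in [set: X]) (vmeas G x * f x ^+ 2)%:E < +oo)%E.

Definition ell2_dot f g : R := rsum (fun x => vmeas G x * (f x * g x)).

Definition ell2_norm f : R := Num.sqrt (ell2_dot f f).

Definition finsupp f : Prop := finite_set [set x | f x != 0].

Definition energy f g : R :=
  2^-1 * rsum (fun p : X * X =>
    weight G p.1 p.2 * ((f p.1 - f p.2) * (g p.1 - g p.2))) +
  rsum (fun x => killing G x * (f x * g x)).

Definition form_approx f (fn : nat -> X -> R) : Prop :=
  [/\ ell2 f,
      forall n, finsupp (fn n),
      ell2_norm (fn n \- f) @[n --> \oo] --> (0 : R) &
      forall e : R, 0 < e -> exists N : nat, forall m n : nat,
        (N <= m)%N -> (N <= n)%N ->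
        energy (fn m \- fn n) (fn m \- fn n) < e].

Definition dom_closure f : Prop := exists fn, form_approx f fn.

(* The closure of the form: limits of energy along approximating sequences.
   Since the form is closable the limit does not depend on the sequences. *)
Definition energy_closure f g : R :=
  get [set v : R | exists fn gn, [/\ form_approx f fn, form_approx g gn &
    energy (fn n) (gn n) @[n --> \oo] --> v]].

(* Graph of the operator L associated with the closed form: f is in the domain
   of L and L f = g. *)
Definition form_operator f g : Prop :=
  [/\ dom_closure f, ell2 g &
      forall h, dom_closure h -> energy_closure f h = ell2_dot g h].

(* P is a strongly continuous semigroup of bounded operators on l^2; nothing is
   required of P t f for t < 0 or f outside l^2. *)
Definition C0_semigroup (P : R -> (X -> R) -> X -> R) : Prop :=
  [/\ forall t, 0 <= t ->
        [/\ forall f, ell2 f -> ell2 (P t f),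
            forall (a : R) f g, ell2 f -> ell2 g ->
              P t (fun x => a * f x + g x) =
              (fun x => a * P t f x + P t g x) &
            exists C : R, forall f, ell2 f ->
              ell2_norm (P t f) <= C * ell2_norm f],
      forall f, ell2 f -> P 0 f = f,
      forall s t f, 0 <= s -> 0 <= t -> ell2 f -> P (s + t) f = P s (P t f) &
      forall f, ell2 f -> ell2_norm (P t f \- f) @[t --> 0^'+] --> (0 : R)].

(* Graph of the infinitesimal generator of P. *)
Definition generator (P : R -> (X -> R) -> X -> R) f g : Prop :=
  [/\ ell2 f, ell2 g &
      ell2_norm (fun x => t^-1 * (P t f x - f x) - g x) @[t --> 0^'+]
        --> (0 : R)].

(* exp(- t L), as the (unique on l^2) C0-semigroup with generator - L. *)
Definition heat : R -> (X -> R) -> X -> R :=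
  get [set P | C0_semigroup P /\
    forall f g, generator P f (\- g) <-> form_operator f g].

Definition restrict_first f (n : nat) : X -> R :=
  fun x => if (pickle x < n)%N then f x else 0.

(* Extension of the semigroup to f >= 0. The functions
   restrict_first f n are finitely supported and increase to f; by positivity preservation the limit exists in [0, +oo]
   and is the same for every such sequence. *)
Definition heat_ext (t : R) f (x : X) : \bar R :=
  limn (fun n => (heat t (restrict_first f n) x)%:E).

Definition stochastically_complete_at_infinity : Prop :=
  exists2 t : R, 0 < t & forall x : X,
    (heat_ext t (fun=> 1%R) x +
     \int[lebesgue_measure]_(s in `[0%R, t])
       heat_ext s (fun y => (killing G y / vmeas G y)%R) x = 1)%E.

Definition nonlinearity (phi : R -> R) : Prop :=
  [/\ continuous phi,
      forall s1 s2, s1 < s2 -> phi s1 <= phi s2,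
      exists s1 s2, phi s1 <> phi s2 &
      phi 0 = 0].

(* Pointwise solution on [0, T] x X; the values of u at times outside [0, T] are
   irrelevant. *)
Definition pointwise_solution (T : R) (phi : R -> R) (u0 : X -> R)
    (u : R -> X -> R) : Prop :=
  [/\ forall t, 0 < t < T -> dom_laplacian (phi \o u t),
      forall x, [/\ {within `[0, T], continuous (u ^~ x)},
                    forall t, 0 < t < T -> derivable (u ^~ x) t 1 &
                    {within `]0, T[, continuous (derive1 (u ^~ x))}],
      forall t x, 0 < t < T ->
        derive1 (u ^~ x) t + laplacian (phi \o u t) x = 0 &
      forall x, u 0 x = u0 x].

Definition bounded_pointwise_solution (T : R) (phi : R -> R) (u0 : X -> R)
    (u : R -> X -> R) : Prop :=
  pointwise_solution T phi u0 u /\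
  exists M : R, forall t x, 0 <= t <= T -> `|u t x| <= M.

Definition unique_bounded_solution (T : R) (phi : R -> R) (u0 : X -> R) : Prop :=
  forall u v : R -> X -> R,
    bounded_pointwise_solution T phi u0 u ->
    bounded_pointwise_solution T phi u0 v ->
    forall t x, 0 <= t <= T -> u t x = v t x.

Definition ell_infty (f : X -> R) : Prop := exists M : R, forall x, `|f x| <= M.

End graph_defs.

(* Main.v *)
(* Let D be the Laplacian, and for h > 0 let e_h be the largest function
   0 <= e <= 1 with (1 + h D) e = 0. A balance of mass for the heat semigroup
   shows that stochastic completeness at infinity amounts to e_h = 0, and that
   otherwise sup e_h = 1. Equivalently, completeness is the Liouville property
   that a bounded s >= 0 with (1 + h D) s <= 0 vanishes.

   Uniqueness. For two bounded solutions u, v put z = u - v and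
   Phi = |phi(u) - phi(v)|. By monotonicity of phi, |z| grows at most at the
   rate - D Phi, so integrating twice in time bounds the integral of |z| by
   - D g, where g is the integral of (T - t) Phi. Uniform continuity gives
   Phi <= eps + C |z|; hence s = (g - eps T^2)^+ satisfies (1 + C T D) s <= 0,
   so s = 0, and eps -> 0 yields Phi = 0 and then z = 0.

   Nonuniqueness. Solve the equation by a monotone explicit Euler scheme on an
   exhausting sequence of finite sets, with phi replaced by Lipschitz
   approximations and with constant values M, resp. - M, outside the finite
   set. Limits along an ultrafilter are bounded solutions. The time integral U
   of the difference of the two fluxes satisfies D U >= - 2 M inside and equals
   the full gap c outside, so the minimum principle gives U >= c (2 e_h - 1) for
   small h. As sup e_h = 1, U stays away from 0 at some vertex, and the two
   limits differ. *)

Require Import Defs.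
From mathcomp Require Import all_boot all_order all_algebra.
From mathcomp Require Import all_classical all_reals all_analysis.
From mathcomp Require Import measurable_realfun ring lra.
Set Implicit Arguments.
Unset Strict Implicit.
Unset Printing Implicit Defensive.
Import Order.TTheory GRing.Theory Num.Theory.
Import numFieldNormedType.Exports.
Local Open Scope classical_set_scope.
Local Open Scope ring_scope.

(** * Absolutely summable families *)

(** Two obstacles shape the proof. First, [heat] is only specified as some C0-semigroup with
    generator [- L]; neither contractivity nor positivity is part of the specification. So exp(- t
    L) is built explicitly from resolvents, where positivity and mass bounds are visible, and is
    then shown to be the only candidate. Second, vertices may have infinitely many neighbours: a
    finitely supported function can lie outside the domain of [L], and infinite neighbour sums are
    awkward to differentiate in time. Arguments therefore run through the form, or through finite
    sets of neighbours with uniform tails. That sup e_h = 1 unless e_h = 0 is a scaling effect: e_h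
    / sup e_h is again admissible, hence at most e_h. In the uniqueness part the weight T - t
    vanishes at T, so no information on z(T) enters, while its derivative yields the term - |z| that
    absorbs the flux. *)

Definition asum (R : realType) (I : choiceType) (a : I -> R) : Prop :=
  (\esum_(i in [set: I]) (`|a i|)%:E < +oo)%E.

Section rsum_theory.
Variables (R : realType) (I : choiceType).
Implicit Types (a b : I -> R) (s : seq I) (C e : R).

Lemma esum_leP a C : (forall i, 0 <= a i) ->
  (\esum_(i in [set: I]) (a i)%:E <= C%:E)%E <->
  (forall s, uniq s -> \sum_(i <- s) a i <= C).
Proof.
move=> a0; split=> [aC s us|aC].
  rewrite -lee_fin; apply: le_trans aC.
  apply: esum_ge; exists [set` s]; first by split=> //; exact: finite_seq.
  by rewrite -fsbig_seq// sumEFin.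
apply: ge_ereal_sup => _ [A [Afin _] <-].
by rewrite fsbig_finite//= sumEFin lee_fin; apply: aC; exact: finmap.fset_uniq.
Qed.

Lemma esum_ltyP a : (forall i, 0 <= a i) ->
  (\esum_(i in [set: I]) (a i)%:E < +oo)%E <->
  exists C, forall s, uniq s -> \sum_(i <- s) a i <= C.
Proof.
move=> a0; split=> [ay|[C /(esum_leP _ a0) aC]].
  exists (fine (\esum_(i in [set: I]) (a i)%:E)); apply/esum_leP => //.
  rewrite fineK// ge0_fin_numE//; apply: esum_ge0 => i _.
  by rewrite lee_fin.
by apply: le_lt_trans aC _; rewrite ltry.
Qed.

Lemma asumP a : asum a <->
  exists C, forall s, uniq s -> \sum_(i <- s) `|a i| <= C.
Proof. exact: (@esum_ltyP (fun i => `|a i|)). Qed.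

Lemma asum_le a b : (forall i, `|a i| <= `|b i|) -> asum b -> asum a.
Proof.
move=> ab /asumP[C bC]; apply/asumP; exists C => s us.
by apply: le_trans (bC s us); apply: ler_sum.
Qed.

Lemma asumD a b : asum a -> asum b -> asum (fun i => a i + b i).
Proof.
move=> /asumP[C aC] /asumP[D bD]; apply/asumP; exists (C + D) => s us.
apply: le_trans (lerD (aC s us) (bD s us)).
by rewrite -big_split; apply: ler_sum => i _; exact: ler_normD.
Qed.

Lemma asumZ c a : asum a -> asum (fun i => c * a i).
Proof.
move=> /asumP[C aC]; apply/asumP; exists (`|c| * C) => s us.
under eq_bigr do rewrite normrM.
by rewrite -mulr_sumr ler_wpM2l// aC.
Qed.

Lemma asumN a : asum a -> asum (fun i => - a i).
Proof. by apply: asum_le => i; rewrite normrN. Qed.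

Lemma asumB a b : asum a -> asum b -> asum (fun i => a i - b i).
Proof. by move=> sa sb; apply: asumD => //; exact: asumN. Qed.

Lemma asum_finsupp a s : (forall i, i \notin s -> a i = 0) -> asum a.
Proof.
move=> a0; apply/asumP; exists (\sum_(i <- undup s) `|a i|) => r ur.
rewrite (bigID (mem s)) /= [X in _ + X]big1 ?addr0; last first.
  by move=> i /a0 ->; rewrite normr0.
rewrite -big_filter; set r' := seq.filter _ r.
apply: (@le_trans _ _ (\sum_(i <- undup s | i \in r') `|a i|)).
  rewrite -[X in _ <= X]big_filter; rewrite le_eqVlt; apply/orP; left.
    apply/eqP; apply: perm_big.
  apply: uniq_perm; rewrite ?filter_uniq ?undup_uniq// => i.
  rewrite !mem_filter mem_undup.
  by case: (i \in s); case: (i \in r); rewrite ?andbF.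
by rewrite [leRHS](bigID (mem r')) /= lerDl sumr_ge0.
Qed.

Lemma rsum_ge0E a : (forall i, 0 <= a i) ->
  rsum a = fine (\esum_(i in [set: I]) (a i)%:E).
Proof.
move=> a0; rewrite /rsum [X in _ - X](_ : _ = 0) ?subr0.
  congr fine; apply: eq_esum => i _; congr EFin.
  by rewrite /funrpos max_l.
rewrite esum1// => i _; congr EFin.
by rewrite /funrneg max_r// oppr_le0.
Qed.

Lemma rsum_ge0 a : (forall i, 0 <= a i) -> 0 <= rsum a.
Proof.
move=> a0; rewrite rsum_ge0E//; apply: fine_ge0; apply: esum_ge0 => i _.
by rewrite lee_fin.
Qed.

Lemma asum_fin_num a : asum a -> (forall i, 0 <= a i) ->
  (\esum_(i in [set: I]) (a i)%:E \is a fin_num)%E.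
Proof.
move=> sa a0; rewrite ge0_fin_numE; last first.
  by apply: esum_ge0 => i _; rewrite lee_fin.
move: sa; rewrite /asum; under eq_esum do rewrite ger0_norm//.
by [].
Qed.

Lemma partial_le_rsum a s : asum a -> (forall i, 0 <= a i) -> uniq s ->
  \sum_(i <- s) a i <= rsum a.
Proof.
move=> sa a0 us; rewrite rsum_ge0E//.
apply: (proj1 (@esum_leP a _ a0)) => //.
by rewrite fineK// asum_fin_num.
Qed.

Lemma rsum_le_bound a C : (forall i, 0 <= a i) ->
  (forall s, uniq s -> \sum_(i <- s) a i <= C) -> rsum a <= C.
Proof.
move=> a0 aC; have sa : asum a.
  apply/asumP; exists C => s us; apply: le_trans (aC s us).
  by apply: ler_sum => i _; rewrite ger0_norm.
rewrite rsum_ge0E// -lee_fin fineK ?asum_fin_num//.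
by apply/esum_leP.
Qed.

Lemma asum_pos a : asum a -> asum (a^\+).
Proof.
apply: asum_le => i; rewrite /funrpos.
by case: (leP (a i) 0) => h; rewrite ?normr0.
Qed.

Lemma asum_neg a : asum a -> asum (a^\-).
Proof.
apply: asum_le => i; rewrite /funrneg.
by case: (leP (- a i) 0) => h; rewrite ?normr0// normrN.
Qed.

Lemma funrposneg_ge0 a i : 0 <= a^\+ i /\ 0 <= a^\- i.
Proof. by rewrite /funrpos /funrneg !le_max !lexx !orbT. Qed.

Lemma funrposnegE a i : a i = a^\+ i - a^\- i.
Proof.
rewrite /funrpos /funrneg.
by case: (leP (a i) 0) => h1; case: (leP (- a i) 0) => h2; lra.
Qed.

Lemma rsum_posneg a : rsum a = rsum (a^\+) - rsum (a^\-).
Proof.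
rewrite [in RHS]rsum_ge0E ?[X in _ - X]rsum_ge0E//= => i;
  by have [] := funrposneg_ge0 a i.
Qed.

Lemma rsumD_ge0 a b : asum a -> asum b -> (forall i, 0 <= a i) ->
  (forall i, 0 <= b i) -> rsum (fun i => a i + b i) = rsum a + rsum b.
Proof.
move=> sa sb a0 b0; rewrite !rsum_ge0E//; last by move=> i; rewrite addr_ge0.
rewrite -fineD ?asum_fin_num// -esumD//; first by move=> i _; rewrite lee_fin.
by move=> i _; rewrite lee_fin.
Qed.

Lemma rsumD a b : asum a -> asum b ->
  rsum (fun i => a i + b i) = rsum a + rsum b.
Proof.
move=> sa sb; set c := fun i => a i + b i.
have sc : asum c by exact: asumD.
(* Moving the negative parts to the other side turns additivity into an identity between sums of
   nonnegative families, where [rsumD_ge0] applies. *)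
have E : rsum (fun i => (c^\+ i + a^\- i) + b^\- i) =
         rsum (fun i => (a^\+ i + b^\+ i) + c^\- i).
  congr rsum; apply/funext => i.
  have := funrposnegE a i; have := funrposnegE b i; have := funrposnegE c i.
  rewrite {1}/c; lra.
have P f i := (funrposneg_ge0 f i).
have ge0 f g : (forall i, 0 <= f i) -> (forall i, 0 <= g i) ->
  forall i : I, 0 <= f i + g i :> R by move=> f0 g0 i; exact: addr_ge0.
have [pa pb pc] : [/\ (forall i, 0 <= a^\+ i), (forall i, 0 <= b^\+ i) &
  (forall i, 0 <= c^\+ i)] by split=> i; [have [] := P a i|have [] := P b i|have [] := P c i].
have [na nb nc] : [/\ (forall i, 0 <= a^\- i), (forall i, 0 <= b^\- i) &
  (forall i, 0 <= c^\- i)].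
  by split=> i; [have [] := P a i|have [] := P b i|have [] := P c i].
have [[spa spb] spc] := (asum_pos sa, asum_pos sb, asum_pos sc).
have [[sna snb] snc] := (asum_neg sa, asum_neg sb, asum_neg sc).
rewrite !rsumD_ge0 ?rsumD_ge0 in E => //; try exact: asumD; try exact: ge0.
rewrite (rsum_posneg c) (rsum_posneg a) (rsum_posneg b); lra.
Qed.

Lemma rsum0 : rsum (fun _ : I => 0 : R) = 0.
Proof. by rewrite rsum_ge0E// esum1. Qed.

Lemma rsumN a : rsum (fun i => - a i) = - rsum a.
Proof.
rewrite /rsum opprB; congr (fine _ - fine _); apply: eq_esum => i _ //.
by rewrite /funrpos /funrneg opprK.
Qed.

Lemma rsumB a b : asum a -> asum b ->
  rsum (fun i => a i - b i) = rsum a - rsum b.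
Proof. by move=> sa sb; rewrite rsumD ?rsumN//; exact: asumN. Qed.

Lemma ler_rsum a b : asum a -> asum b -> (forall i, a i <= b i) ->
  rsum a <= rsum b.
Proof.
move=> sa sb ab; rewrite -subr_ge0 -rsumB//; apply: rsum_ge0 => i.
by rewrite subr_ge0.
Qed.

Lemma ler_norm_rsum a : asum a -> `|rsum a| <= rsum (fun i => `|a i|).
Proof.
move=> sa; have sn : asum (fun i => `|a i|).
  by apply: asum_le sa => i; rewrite normr_id.
rewrite ler_norml -rsumN; apply/andP; split; apply: ler_rsum => //.
- exact: asumN.
- by move=> i; rewrite lerNl -normrN ler_norm.
- by move=> i; rewrite ler_norm.
Qed.

Lemma rsum_finsupp a s : uniq s -> (forall i, i \notin s -> a i = 0) ->
  rsum a = \sum_(i <- s) a i.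
Proof.
move=> us; have key b : (forall i, 0 <= b i) ->
    (forall i, i \notin s -> b i = 0) -> rsum b = \sum_(i <- s) b i.
  move=> b0 bs; apply/eqP; rewrite eq_le; apply/andP; split; last first.
    by apply: partial_le_rsum => //; exact: (asum_finsupp (s := s)).
  apply: rsum_le_bound => // r ur.
  rewrite (bigID (mem s)) /= [X in _ + X]big1 ?addr0; last by move=> i /bs.
  rewrite -big_filter; set r' := seq.filter _ r.
  apply: (@le_trans _ _ (\sum_(i <- s | i \in r') b i)).
    rewrite -[X in _ <= X]big_filter; rewrite le_eqVlt; apply/orP; left.
    apply/eqP; apply: perm_big.
    apply: uniq_perm; rewrite ?filter_uniq// => i.
    rewrite !mem_filter.
    by case: (i \in s); case: (i \in r); rewrite ?andbF.
  by rewrite [leRHS](bigID (mem r')) /= lerDl sumr_ge0.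
move=> a0; rewrite rsum_posneg !key.
- rewrite -sumrB; apply: eq_bigr => i _; exact/esym/funrposnegE.
- by move=> i; have [] := funrposneg_ge0 a i.
- by move=> i /a0 ai; rewrite /funrneg ai oppr0 maxxx.
- by move=> i; have [] := funrposneg_ge0 a i.
- by move=> i /a0 ai; rewrite /funrpos ai maxxx.
Qed.

Lemma rsumZ c a : asum a -> rsum (fun i => c * a i) = c * rsum a.
Proof.
move=> sa.
have pos d b : 0 <= d -> asum b -> (forall i, 0 <= b i) ->
    rsum (fun i => d * b i) <= d * rsum b.
  move=> d0 sb b0; apply: rsum_le_bound => [i|s us]; first exact: mulr_ge0.
  by rewrite -mulr_sumr ler_wpM2l// partial_le_rsum.
(* The reverse inequality is [pos] for [d^-1] and the family [d * b]. *)
have key d b : 0 <= d -> asum b -> (forall i, 0 <= b i) ->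
    rsum (fun i => d * b i) = d * rsum b.
  move=> d0 sb b0; apply/eqP; rewrite eq_le pos//=.
  have [->|dn0] := eqVneq d 0.
    by rewrite mul0r; apply: rsum_ge0 => i; rewrite mul0r.
  have dp : 0 < d by rewrite lt_def dn0.
  rewrite -ler_pdivlMl//; apply: le_trans (pos _ _ _ _ _).
  - apply: ler_rsum => //; first by do 2 apply: asumZ.
    by move=> i; rewrite mulKf.
  - by rewrite invr_ge0.
  - exact: asumZ.
  - by move=> i; rewrite mulr_ge0.
have key2 d : 0 <= d -> rsum (fun i => d * a i) = d * rsum a.
  have pp i : 0 <= a^\+ i by have [] := funrposneg_ge0 a i.
  have np i : 0 <= a^\- i by have [] := funrposneg_ge0 a i.
  move=> d0; rewrite (rsum_posneg a) mulrBr -(key _ _ d0 (asum_pos sa) pp).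
  rewrite -(key _ _ d0 (asum_neg sa) np).
  rewrite -rsumB; [|exact/asumZ/asum_pos|exact/asumZ/asum_neg].
  by congr rsum; apply/funext => i; rewrite [in LHS](funrposnegE a) mulrBr.
have [c0|c0] := leP 0 c; first exact: key2.
have := key2 (- c); rewrite oppr_ge0 => /(_ (ltW c0)) E.
apply: oppr_inj; rewrite -rsumN -mulNr -E.
by congr rsum; apply/funext => i; rewrite mulNr.
Qed.

(** The set [s] is one whose partial sum of |a| is within [e] of the total. The bound is uniform
    over all families dominated by [a]; dominated convergence and the finite cut of neighbour sums
    rely on this uniformity. *)
Lemma rsum_tail a e : asum a -> 0 < e -> exists2 s, uniq s &
  forall b, (forall i, `|b i| <= `|a i|) -> (forall i, i \in s -> b i = 0) ->
    `|rsum b| <= e.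
Proof.
move=> sa e0; pose c i := `|a i|.
have sc : asum c by apply: asum_le sa => i; rewrite normr_id.
have [s us sP] : exists2 s, uniq s & rsum c - e < \sum_(i <- s) c i.
  apply: contrapT => H.
  suff : rsum c <= rsum c - e by rewrite leNgt ltrBlDr ltrDl e0.
  apply: rsum_le_bound => [i|s us]; first exact: normr_ge0.
  rewrite leNgt; apply/negP => h.
  by apply: H; exists s.
exists s => // b ba bs.
have sb : asum b by exact: asum_le sa.
apply: le_trans (ler_norm_rsum sb) _.
pose d i := if i \in s then c i else 0.
have dE : rsum d = \sum_(i <- s) c i.
  rewrite (rsum_finsupp us); last by move=> i /negbTE; rewrite /d => ->.
  by apply: eq_big_seq => i; rewrite /d => ->.
have sd : asum d.
  by apply: asum_le sa => i; rewrite /d /c; case: ifP; rewrite ?normr_id// normr0.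
apply: (@le_trans _ _ (rsum c - rsum d)); last by rewrite dE; lra.
rewrite -rsumB//; apply: ler_rsum; first by apply: asum_le sb => i; rewrite normr_id.
  exact: asumB.
move=> i; rewrite /d; case: ifP => [/bs ->|_]; first by rewrite normr0 subrr.
by rewrite subr0 /c.
Qed.

Lemma cvg_sum_seq (T : Type) (F : set_system T) {FF : Filter F}
    (a : T -> I -> R) (a0 : I -> R) s :
  (forall i, a t i @[t --> F] --> a0 i) ->
  \sum_(i <- s) a t i @[t --> F] --> \sum_(i <- s) a0 i.
Proof.
move=> aa0; elim: s => [|i s ih].
  by under eq_fun do rewrite big_nil; rewrite big_nil; exact: cvg_cst.
by under eq_fun do rewrite big_cons; rewrite big_cons; exact: cvgD.
Qed.

Lemma rsum_dominated (T : Type) (F : set_system T) {FF : Filter F}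
    (a : T -> I -> R) (a0 b : I -> R) : asum b ->
  (\forall t \near F, forall i, `|a t i| <= b i) ->
  (forall i, a t i @[t --> F] --> a0 i) -> (forall i, `|a0 i| <= b i) ->
  rsum (a t) @[t --> F] --> rsum a0.
Proof.
move=> sb ab aa0 a0b.
have bb i : b i <= `|b i| by exact: ler_norm.
apply/cvgrPdist_le => e e0.
have e30 : 0 < e / 3 by rewrite divr_gt0.
have [s us sP] := rsum_tail sb e30.
have fin : (fun t => \sum_(i <- s) a t i) @ F --> \sum_(i <- s) a0 i.
  exact: cvg_sum_seq.
move/cvgrPdist_le : fin => /(_ _ e30) fin.
near=> t.
have abt : forall i, `|a t i| <= b i by near: t.
have split_sum (c : I -> R) : (forall i, `|c i| <= b i) ->
    `|rsum c - \sum_(i <- s) c i| <= e / 3.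
  move=> cb; have sc : asum c by apply: asum_le sb => i; apply: le_trans (bb i).
  pose d i := if i \in s then c i else 0.
  have dE : rsum d = \sum_(i <- s) c i.
    rewrite (rsum_finsupp us); last by move=> i /negbTE; rewrite /d => ->.
    by apply: eq_big_seq => i; rewrite /d => ->.
  have sd : asum d by apply: asum_le sc => i; rewrite /d; case: ifP; rewrite ?normr0.
  rewrite -dE -rsumB//; apply: sP => i.
    rewrite /d; case: ifP; first by rewrite subrr normr0.
    by rewrite subr0 => _; apply: le_trans (bb i).
  by rewrite /d => ->; rewrite subrr.
have h1 := split_sum _ a0b; have h2 := split_sum _ abt.
have h3 : `|\sum_(i <- s) a0 i - \sum_(i <- s) a t i| <= e / 3 by near: t.
move: h1 h2 h3; rewrite !ler_distl; lra.
Unshelve. all: by end_near.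
Qed.

Lemma rsum_fatou (T : Type) (F : set_system T) {FF : ProperFilter F}
    (a : T -> I -> R) (a0 : I -> R) C :
  (forall i, 0 <= a0 i) ->
  (forall i, a t i @[t --> F] --> a0 i) ->
  (\forall t \near F, [/\ asum (a t), (forall i, 0 <= a t i) & rsum (a t) <= C]) ->
  asum a0 /\ rsum a0 <= C.
Proof.
move=> a00 aa0 aC.
have key s : uniq s -> \sum_(i <- s) a0 i <= C.
  move=> us.
  have fin : (fun t => \sum_(i <- s) a t i) @ F --> \sum_(i <- s) a0 i.
    exact: cvg_sum_seq.
  apply: cvgr_to_le fin _.
  near=> t; have [sa at0 atC] : [/\ asum (a t), (forall i, 0 <= a t i) & rsum (a t) <= C].
    by near: t.
  by apply: le_trans atC; exact: partial_le_rsum.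
split; last exact: rsum_le_bound.
apply/asumP; exists C => s us; apply: le_trans (key s us).
by apply: ler_sum => i _; rewrite ger0_norm.
Unshelve. all: by end_near.
Qed.

End rsum_theory.

(** Transfers sums over the edge set to sums over a smaller index when only the edges at one vertex,
    or one of the two summands of the index type, contribute. *)
Lemma rsum_slice (R : realType) (I J : choiceType) (h : J -> I) (a : I -> R) :
  injective h -> (forall i, (forall j, h j != i) -> a i = 0) ->
  asum (a \o h) -> asum a /\ rsum a = rsum (a \o h).
Proof.
move=> hinj a0.
have key b : (forall i, 0 <= b i) -> (forall i, (forall j, h j != i) -> b i = 0) ->
    \esum_(i in [set: I]) (b i)%:E = \esum_(j in [set: J]) (b (h j))%:E :> \bar R.
  move=> b0 bz.
  rewrite -(@reindex_esum R J I setT (range h) h (fun i => (b i)%:E)); last first.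
    split; [by move=> x _; exists x|by move=> x y _ _; exact: hinj|].
    by move=> _ [x _ <-]; exists x.
  rewrite [RHS]esum_mkcond; apply: eq_esum => i _.
  case: ifPn => // /negP ih; rewrite bz// => j; apply/eqP => hj; apply: ih.
  by rewrite inE; exists j.
move=> sa; split.
  rewrite /asum key//= => i hi; by rewrite a0// normr0.
have [pp np] : (forall i, 0 <= a^\+ i) /\ (forall i, 0 <= a^\- i).
  by split=> i; have [] := funrposneg_ge0 a i.
rewrite /rsum; congr (fine _ - fine _); rewrite key// => i /a0 ai.
  by rewrite /funrpos ai maxxx.
by rewrite /funrneg ai oppr0 maxxx.
Qed.

(** * Weighted l^2 spaces and the closed energy form *)

(** One theory serves both l^2(X, mu) and the space of gradients over edges and killing sites. In
    the latter the weights may vanish, so [wnorm] is in general only a seminorm. *)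
Definition wl2 (R : realType) (I : choiceType) (m a : I -> R) : Prop :=
  asum (fun i => m i * a i ^+ 2).

Definition wdot (R : realType) (I : choiceType) (m a b : I -> R) : R :=
  rsum (fun i => m i * (a i * b i)).

Definition wnorm (R : realType) (I : choiceType) (m a : I -> R) : R :=
  Num.sqrt (wdot m a a).

Lemma discriminant_le (R : realType) (a b c : R) :
  (forall t, 0 <= a + 2 * t * b + t ^+ 2 * c) -> b ^+ 2 <= a * c.
Proof.
move=> h; have c0 : 0 <= c.
  rewrite leNgt; apply/negP => c0.
  have a0 : 0 <= a by have := h 0; rewrite mulr0 mul0r expr0n /= mul0r !addr0.
  (* Chosen so that [t >= 1] and [t * - c] exceeds [a + 1 + 2 |b|]; the quadratic is then negative
     at [t], against the hypothesis. *)
  pose t := (a + 1 + 2 * `|b|) / - c + 1.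
  have t1 : 1 <= t.
    rewrite lerDr divr_ge0 ?oppr_ge0 ?(ltW c0)//.
    by rewrite !addr_ge0// mulr_ge0.
  have tc : t * - c = a + 1 + 2 * `|b| - c.
    by rewrite mulrDl divfK ?mul1r// oppr_eq0 lt_eqF.
  have := h t; rewrite (_ : t ^+ 2 * c = - (t * (t * - c))); last by ring.
  rewrite tc; have := ler_norm b; have := normr_ge0 b; nra.
have [c1|c1] := ltP 0 c; last first.
  have cz : c = 0 by apply/eqP; rewrite eq_le c1 c0.
  rewrite cz mulr0.
  have [->|bn0] := eqVneq b 0; first by rewrite expr0n.
  have := h (- (a + 1) / (2 * b)); rewrite cz mulr0 addr0.
  rewrite (_ : a + _ = -1) ?ler0N1 ?oppr_ge0 ?ler10//.
  by field.
have := h (- b / c).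
rewrite [leRHS](_ : _ = a - b ^+ 2 / c); last by field; rewrite gt_eqF.
by rewrite subr_ge0 ler_pdivrMr.
Qed.

Section weighted_l2.
Variables (R : realType) (I : choiceType) (m : I -> R).
Hypothesis m0 : forall i, 0 <= m i.
Implicit Types (a b : I -> R) (c C : R).

Lemma msq_ge0 a i : 0 <= m i * a i ^+ 2.
Proof. by rewrite mulr_ge0// sqr_ge0. Qed.

Lemma wl2_mul a b : wl2 m a -> wl2 m b -> asum (fun i => m i * (a i * b i)).
Proof.
move=> sa sb; apply: asum_le (asumD sa sb) => i.
rewrite [leRHS]ger0_norm; last by rewrite addr_ge0// msq_ge0.
rewrite -mulrDr normrM (ger0_norm (m0 i)) ler_wpM2l// ler_norml.
apply/andP; split; nra.
Qed.

Lemma wl2D a b : wl2 m a -> wl2 m b -> wl2 m (fun i => a i + b i).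
Proof.
move=> sa sb; apply: asum_le (asumZ 2 (asumD sa sb)) => i.
rewrite [leLHS]ger0_norm; last by rewrite mulr_ge0// sqr_ge0.
rewrite [leRHS]ger0_norm; last first.
  by rewrite mulr_ge0// addr_ge0// msq_ge0.
rewrite -mulrDr [leRHS]mulrCA ler_wpM2l//.
have := sqr_ge0 (a i - b i); nra.
Qed.

Lemma wl2Z c a : wl2 m a -> wl2 m (fun i => c * a i).
Proof.
move=> sa; apply: asum_le (asumZ (c ^+ 2) sa) => i.
by rewrite exprMn mulrCA.
Qed.

Lemma wl2N a : wl2 m a -> wl2 m (fun i => - a i).
Proof. by apply: asum_le => i; rewrite sqrrN. Qed.

Lemma wl2B a b : wl2 m a -> wl2 m b -> wl2 m (fun i => a i - b i).
Proof. by move=> sa sb; apply: wl2D => //; exact: wl2N. Qed.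

Lemma wl2_le a b : (forall i, `|a i| <= `|b i|) -> wl2 m b -> wl2 m a.
Proof.
move=> ab; apply: asum_le => i.
rewrite ger0_norm ?msq_ge0// ger0_norm ?msq_ge0// ler_wpM2l//.
rewrite -(real_normK (num_real (a i))) -(real_normK (num_real (b i))).
by rewrite lerXn2r ?nnegrE.
Qed.

Lemma wl2_finsupp a (s : seq I) : (forall i, i \notin s -> a i = 0) -> wl2 m a.
Proof.
move=> a0; apply: (asum_finsupp (s := s)) => i /a0 ->.
by rewrite expr0n mulr0.
Qed.

Lemma wl20 : wl2 m (fun=> 0).
Proof. by apply: (@wl2_finsupp _ [::]). Qed.

Lemma wdotC a b : wdot m a b = wdot m b a.
Proof. by congr rsum; apply/funext => i; rewrite (mulrC (a i)). Qed.

Lemma wdotDl a b d : wl2 m a -> wl2 m b -> wl2 m d ->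
  wdot m (fun i => a i + b i) d = wdot m a d + wdot m b d.
Proof.
move=> sa sb sd; rewrite /wdot -rsumD; [|exact: wl2_mul|exact: wl2_mul].
by congr rsum; apply/funext => i; rewrite mulrDl mulrDr.
Qed.

Lemma wdotDr a b d : wl2 m a -> wl2 m b -> wl2 m d ->
  wdot m d (fun i => a i + b i) = wdot m d a + wdot m d b.
Proof. by move=> sa sb sd; rewrite wdotC wdotDl// !(wdotC d). Qed.

Lemma wdotZl c a b : wl2 m a -> wl2 m b ->
  wdot m (fun i => c * a i) b = c * wdot m a b.
Proof.
move=> sa sb; rewrite /wdot -rsumZ; last exact: wl2_mul.
by congr rsum; apply/funext => i; rewrite -mulrA mulrCA.
Qed.

Lemma wdotZr c a b : wl2 m a -> wl2 m b ->
  wdot m b (fun i => c * a i) = c * wdot m b a.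
Proof. by move=> sa sb; rewrite wdotC wdotZl// wdotC. Qed.

Lemma wdotNl a b : wdot m (fun i => - a i) b = - wdot m a b.
Proof.
by rewrite /wdot -rsumN; congr rsum; apply/funext => i; rewrite mulNr mulrN.
Qed.

Lemma wdotNr a b : wdot m b (fun i => - a i) = - wdot m b a.
Proof. by rewrite wdotC wdotNl wdotC. Qed.

Lemma wdotBl a b d : wl2 m a -> wl2 m b -> wl2 m d ->
  wdot m (fun i => a i - b i) d = wdot m a d - wdot m b d.
Proof. by move=> sa sb sd; rewrite wdotDl ?wdotNl//; exact: wl2N. Qed.

Lemma wdotBr a b d : wl2 m a -> wl2 m b -> wl2 m d ->
  wdot m d (fun i => a i - b i) = wdot m d a - wdot m d b.
Proof. by move=> sa sb sd; rewrite wdotC wdotBl// !(wdotC d). Qed.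

Lemma wdot_ge0 a : 0 <= wdot m a a.
Proof. by apply: rsum_ge0 => i; rewrite mulr_ge0// -expr2 sqr_ge0. Qed.

Lemma wdot0l b : wdot m (fun=> 0) b = 0.
Proof.
rewrite -[RHS](rsum0 R I); congr rsum; apply/funext => i.
by rewrite mul0r mulr0.
Qed.

Lemma wdot_sqrD c a b : wl2 m a -> wl2 m b ->
  wdot m (fun i => a i + c * b i) (fun i => a i + c * b i) =
  wdot m a a + 2 * c * wdot m a b + c ^+ 2 * wdot m b b.
Proof.
move=> sa sb; have sc := wl2Z c sb; have sd := wl2D sa sc.
rewrite wdotDl// !wdotDr// !wdotZl// ?wdotZr// (wdotC b a); ring.
Qed.

Lemma wdot_CS a b : wl2 m a -> wl2 m b ->
  wdot m a b ^+ 2 <= wdot m a a * wdot m b b.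
Proof.
move=> sa sb; apply: discriminant_le => t.
by rewrite -wdot_sqrD// wdot_ge0.
Qed.

Lemma wnorm_ge0 a : 0 <= wnorm m a.
Proof. exact: sqrtr_ge0. Qed.

Lemma wnorm_sqr a : wnorm m a ^+ 2 = wdot m a a.
Proof. by rewrite sqr_sqrtr// wdot_ge0. Qed.

Lemma wnorm_CS a b : wl2 m a -> wl2 m b ->
  `|wdot m a b| <= wnorm m a * wnorm m b.
Proof.
move=> sa sb; rewrite -sqrtrM ?wdot_ge0// -sqrtr_sqr.
by rewrite ler_sqrt ?wdot_CS// mulr_ge0 ?wdot_ge0.
Qed.

Lemma wnorm_le a C : 0 <= C -> wdot m a a <= C ^+ 2 -> wnorm m a <= C.
Proof.
move=> C0 h; rewrite -(ger0_norm C0) -sqrtr_sqr ler_sqrt//.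
exact: sqr_ge0.
Qed.

Lemma wnormD a b : wl2 m a -> wl2 m b ->
  wnorm m (fun i => a i + b i) <= wnorm m a + wnorm m b.
Proof.
move=> sa sb; apply: wnorm_le; first by rewrite addr_ge0 ?wnorm_ge0.
have := wdot_sqrD 1 sa sb.
rewrite (_ : (fun i => a i + 1 * b i) = (fun i => a i + b i)); last first.
  by apply/funext => i; rewrite mul1r.
move=> ->; rewrite sqrrD !wnorm_sqr expr1n mul1r.
have := wnorm_CS sa sb; rewrite ler_norml => /andP[_]; nra.
Qed.

Lemma wnormZ c a : wl2 m a -> wnorm m (fun i => c * a i) = `|c| * wnorm m a.
Proof.
move=> sa; rewrite /wnorm wdotZl ?wdotZr//; last exact: wl2Z.
by rewrite mulrA -expr2 sqrtrM ?sqr_ge0// sqrtr_sqr.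
Qed.

Lemma wnormN a : wnorm m (fun i => - a i) = wnorm m a.
Proof. by rewrite /wnorm wdotNl wdotNr opprK. Qed.

Lemma wnormBC a b : wnorm m (fun i => a i - b i) = wnorm m (fun i => b i - a i).
Proof. by rewrite -wnormN; congr wnorm; apply/funext => i; rewrite opprB. Qed.

Lemma wnormB a b : wl2 m a -> wl2 m b ->
  wnorm m (fun i => a i - b i) <= wnorm m a + wnorm m b.
Proof.
by move=> sa sb; rewrite -(wnormN b); apply: wnormD => //; exact: wl2N.
Qed.

Lemma wnorm_triangle d a b : wl2 m a -> wl2 m b -> wl2 m d ->
  wnorm m (fun i => a i - b i) <=
  wnorm m (fun i => a i - d i) + wnorm m (fun i => d i - b i).
Proof.
move=> sa sb sd; apply: le_trans (wnormD _ _); [|exact: wl2B|exact: wl2B].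
rewrite le_eqVlt; apply/orP; left; apply/eqP; congr wnorm; apply/funext => i.
by rewrite addrA subrK.
Qed.

Lemma wnorm0 : wnorm m (fun=> 0) = 0.
Proof. by rewrite /wnorm wdot0l sqrtr0. Qed.

Lemma wl2_pt a i : wl2 m a -> m i * a i ^+ 2 <= wdot m a a.
Proof.
move=> sa.
rewrite /wdot [X in rsum X](_ : _ = fun i => m i * a i ^+ 2) //.
rewrite -[leLHS](big_seq1 +%R i (fun i => m i * a i ^+ 2)).
by apply: partial_le_rsum => // j; rewrite mulr_ge0// sqr_ge0.
Qed.

Lemma wnorm_pt a i : 0 < m i -> wl2 m a ->
  `|a i| <= wnorm m a / Num.sqrt (m i).
Proof.
move=> mi sa; rewrite ler_pdivlMr ?sqrtr_gt0// -sqrtr_sqr mulrC.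
rewrite -sqrtrM ?m0// ler_sqrt ?wdot_ge0//.
exact: wl2_pt.
Qed.

Lemma wl2_fatou (T : Type) (F : set_system T) {FF : ProperFilter F}
    (a : T -> I -> R) (a0 : I -> R) C :
  (forall i, a t i @[t --> F] --> a0 i) ->
  (\forall t \near F, wl2 m (a t) /\ wdot m (a t) (a t) <= C) ->
  wl2 m a0 /\ wdot m a0 a0 <= C.
Proof.
move=> aa0 aC; apply: (@rsum_fatou _ _ _ F _ (fun t i => m i * (a t i * a t i))).
- by move=> i; exact: msq_ge0.
- by move=> i; apply: cvgM; [exact: cvg_cst|exact: cvgM].
- apply: filterS aC => t [sa aC]; split => // i.
  exact: msq_ge0.
Qed.

Lemma wnorm_fatou (T : Type) (F : set_system T) {FF : ProperFilter F}
    (a : T -> I -> R) (a0 : I -> R) C : 0 <= C ->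
  (forall i, a t i @[t --> F] --> a0 i) ->
  (\forall t \near F, wl2 m (a t) /\ wnorm m (a t) <= C) ->
  wl2 m a0 /\ wnorm m a0 <= C.
Proof.
move=> C0 aa0 aC; have [||sa h] := @wl2_fatou T F FF a a0 (C ^+ 2) => //.
  apply: filterS aC => t [sa aC]; split => //.
  by rewrite -wnorm_sqr lerXn2r ?nnegrE ?wnorm_ge0.
by split => //; apply: wnorm_le.
Qed.

(** Fatou in the second index turns the Cauchy bound into a bound against the pointwise limit.
    Vanishing weights are allowed, so this applies to gradients. *)
Lemma wnorm_cauchy_cvg (a : nat -> I -> R) (a0 : I -> R) :
  (forall n, wl2 m (a n)) -> (forall i, a n i @[n --> \oo] --> a0 i) ->
  (forall e : R, 0 < e -> exists N : nat, forall p q, (N <= p)%N -> (N <= q)%N ->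
     wnorm m (fun i => a p i - a q i) <= e) ->
  wl2 m a0 /\ wnorm m (fun i => a n i - a0 i) @[n --> \oo] --> (0 : R).
Proof.
move=> sa aa0 ca.
have key (e : R) : 0 < e -> exists N : nat, forall p, (N <= p)%N ->
    wl2 m (fun i => a p i - a0 i) /\ wnorm m (fun i => a p i - a0 i) <= e.
  move=> e0; have [N hN] := ca _ e0; exists N => p Np.
  apply: (@wnorm_fatou _ \oo _ (fun q i => a p i - a q i)) => //.
  - exact: ltW.
  - by move=> i; apply: cvgB; [exact: cvg_cst|].
  - by exists N => // q Nq; split; [exact: wl2B|exact: hN].
split.
  have [N /(_ N (leqnn N)) [h _]] := key _ ltr01.
  have -> : a0 = (fun i => a N i - (a N i - a0 i)).
    by apply/funext => i; rewrite opprB addrC subrK.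
  exact: wl2B.
apply/cvgrPdist_le => e e0; have [N hN] := key _ e0.
exists N => // p Np; rewrite sub0r normrN ger0_norm ?wnorm_ge0//.
by have [] := hN p Np.
Qed.

End weighted_l2.

Lemma wnorm_complete (R : realType) (I : choiceType) (m : I -> R)
    (a : nat -> I -> R) : (forall i, 0 < m i) ->
  (forall n, wl2 m (a n)) ->
  (forall e : R, 0 < e -> exists N : nat, forall p q, (N <= p)%N -> (N <= q)%N ->
     wnorm m (fun i => a p i - a q i) <= e) ->
  exists a0, [/\ wl2 m a0, forall i, a n i @[n --> \oo] --> a0 i &
    wnorm m (fun i => a n i - a0 i) @[n --> \oo] --> (0 : R)].
Proof.
move=> mp sa ca; have m0 i : 0 <= m i by exact: ltW.
have cv i : cvgn (fun n => a n i).
  apply/cauchy_cvgP/cauchy_exP => e e0.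
  have s0 : 0 < Num.sqrt (m i) by rewrite sqrtr_gt0.
  have e1 : 0 < e / 2 * Num.sqrt (m i) by rewrite mulr_gt0// divr_gt0.
  have [N hN] := ca _ e1; exists (a N i); exists N => // p Np.
  have := hN N p (leqnn N) Np => h; rewrite /ball /= /ball_.
  have := wnorm_pt m0 (mp i) (wl2B m0 (sa N) (sa p)).
  move=> /le_lt_trans; apply; rewrite ltr_pdivrMr//.
  apply: le_lt_trans h _; rewrite ltr_pM2r//; lra.
exists (fun i => limn (fun n => a n i)).
by have [] // := @wnorm_cauchy_cvg R I m m0 a (fun i => limn (fun n => a n i)) sa _ ca.
Qed.

Lemma cvg_dist_le0 (R : realType) (T : Type) (F : set_system T) {FF : Filter F}
    (f g : T -> R) (l : R) : (\forall t \near F, `|l - f t| <= g t) ->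
  g t @[t --> F] --> (0 : R) -> f t @[t --> F] --> l.
Proof.
move=> fg /cvgr0Pnorm_le g0; apply/cvgrPdist_le => e e0.
apply: filterS2 fg (g0 e e0) => t h1 h2.
by apply: le_trans h1 (le_trans (ler_norm _) h2).
Qed.

Lemma wdot_cvg (R : realType) (I : choiceType) (m : I -> R)
    (a b : nat -> I -> R) (a0 b0 : I -> R) : (forall i, 0 <= m i) ->
  (forall n, wl2 m (a n)) -> (forall n, wl2 m (b n)) -> wl2 m a0 -> wl2 m b0 ->
  wnorm m (fun i => a n i - a0 i) @[n --> \oo] --> (0 : R) ->
  wnorm m (fun i => b n i - b0 i) @[n --> \oo] --> (0 : R) ->
  wdot m (a n) (b n) @[n --> \oo] --> wdot m a0 b0.
Proof.
move=> m0 sa sb sa0 sb0 ca cb.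
have E n : wdot m (a n) (b n) = wdot m a0 b0 +
    wdot m (fun i => a n i - a0 i) (fun i => b n i - b0 i) +
    wdot m (fun i => a n i - a0 i) b0 + wdot m a0 (fun i => b n i - b0 i).
  rewrite !wdotBl// ?wdotBr//; try exact: wl2B.
  ring.
have bound n : `|wdot m a0 b0 - wdot m (a n) (b n)| <=
    wnorm m (fun i => a n i - a0 i) * wnorm m (fun i => b n i - b0 i) +
    wnorm m (fun i => a n i - a0 i) * wnorm m b0 +
    wnorm m a0 * wnorm m (fun i => b n i - b0 i).
  rewrite distrC E.
  have -> (x y z t : R) : x + y + z + t - x = y + z + t by ring.
  apply: le_trans (ler_normD _ _) _; rewrite lerD ?wnorm_CS//; last exact: wl2B.
  apply: le_trans (ler_normD _ _) _.
  by rewrite lerD ?wnorm_CS//; exact: wl2B.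
apply: cvg_dist_le0; first exact: nearW bound.
rewrite -[X in _ --> X](_ : 0 * 0 + 0 * wnorm m b0 + wnorm m a0 * 0 = 0); last by ring.
apply: cvgD; last by apply: cvgM => //; exact: cvg_cst.
by apply: cvgD; apply: cvgM => //; exact: cvg_cst.
Qed.

(** * The energy as a squared norm of gradients, and the operator [L] *)

Section graph_form.
Variables (R : realType) (X : countType) (G : graph R X).
Local Notation w := (weight G).
Local Notation mu := (vmeas G).
Local Notation ka := (killing G).
Implicit Types (f g h : X -> R).

Definition bounded_fun f := exists M : R, forall x, `|f x| <= M.

Definition wsum x f : R := rsum (fun y => w x y * f y).

Definition wdeg x : R := rsum (w x).

(* The form is the l^2 product of gradients over the oriented edges (inl) and the
   killing sites (inr). *)
Definition edge_weight (i : (X * X) + X) : R :=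
  match i with inl p => w p.1 p.2 / 2 | inr x => ka x end.

Definition gradient f (i : (X * X) + X) : R :=
  match i with inl p => f p.1 - f p.2 | inr x => f x end.

Definition finite_energy f := wl2 edge_weight (gradient f).

Definition form f g := wdot edge_weight (gradient f) (gradient g).

Definition delta x : X -> R := fun y => (y == x)%:R.

Lemma mu_ge0 x : 0 <= mu x. Proof. exact/ltW/vmeas_gt0. Qed.

Lemma edge_weight_ge0 i : 0 <= edge_weight i.
Proof.
case: i => [p|x] /=; last exact: killing_ge0.
by rewrite divr_ge0// weight_ge0.
Qed.

Lemma ell2E f : ell2 G f <-> wl2 mu f.
Proof.
rewrite /ell2 /wl2 /asum; under [X in _ <-> (X < _)%E]eq_esum => i _.
  by rewrite ger0_norm; last rewrite mulr_ge0 ?sqr_ge0 ?mu_ge0//; over.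
by [].
Qed.

Lemma asum_weight x : asum (w x).
Proof.
have := weight_summable G x; rewrite /asum.
by under [X in _ -> (X < _)%E]eq_esum => y _ do rewrite ger0_norm ?weight_ge0//.
Qed.

Lemma asum_weightM x f : bounded_fun f -> asum (fun y => w x y * f y).
Proof.
move=> [M fM]; apply: asum_le (asumZ M (asum_weight x)) => y.
rewrite !normrM mulrC ler_wpM2r//.
by apply: le_trans (fM y) _; exact: ler_norm.
Qed.

Lemma laplacianE f x : bounded_fun f ->
  laplacian G f x = (mu x)^-1 * (wdeg x * f x - wsum x f + ka x * f x).
Proof.
move=> bf; rewrite /laplacian.
rewrite (_ : rsum _ = wdeg x * f x - wsum x f); first by ring.
rewrite /wdeg /wsum mulrC -rsumZ; last exact: asum_weight.
rewrite -rsumB; [|exact/asumZ/asum_weight|exact: asum_weightM].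
by congr rsum; apply/funext => y; rewrite mulrBr [f x * _]mulrC.
Qed.

Lemma gradientD f g : gradient (fun x => f x + g x) =
  (fun i => gradient f i + gradient g i).
Proof. by apply/funext => -[[x y]|x] //=; rewrite opprD addrACA. Qed.

Lemma gradientZ c f : gradient (fun x => c * f x) =
  (fun i => c * gradient f i).
Proof. by apply/funext => -[[x y]|x] //=; rewrite mulrBr. Qed.

Lemma gradientN f : gradient (fun x => - f x) = (fun i => - gradient f i).
Proof. by apply/funext => -[[x y]|x] //=; rewrite opprB opprK addrC. Qed.

Lemma gradientB f g : gradient (fun x => f x - g x) =
  (fun i => gradient f i - gradient g i).
Proof. by rewrite gradientD gradientN. Qed.

Lemma pairl_inj x : injective (fun y => inl (x, y) : (X * X) + X).
Proof. by move=> y z []. Qed.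

Lemma pairr_inj x : injective (fun y => inl (y, x) : (X * X) + X).
Proof. by move=> y z []. Qed.

(** Only edges at [x] see the Dirac mass: [F1] collects those leaving [x], [F2] those entering it,
    [F3] the killing at [x]. By symmetry [F1] and [F2] each contribute half of the weighted
    difference. The value is [mu x] times the Laplacian. *)
Lemma green_delta g x : asum (fun y => w x y * g y) ->
  asum (fun i => edge_weight i * (gradient g i * gradient (delta x) i)) /\
  form g (delta x) = wdeg x * g x - wsum x g + ka x * g x.
Proof.
move=> sg.
pose c y := w x y / 2 * (g x - g y).
have cE : c = (fun y => g x / 2 * w x y - 2^-1 * (w x y * g y)).
  by apply/funext => y; rewrite /c; field.
have s1 : asum (fun y => g x / 2 * w x y) by exact/asumZ/asum_weight.
have s2 : asum (fun y => 2^-1 * (w x y * g y)) by exact: asumZ.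
have sc : asum c by rewrite cE; exact: asumB.
have rc : rsum c = (wdeg x * g x - wsum x g) / 2.
  rewrite cE rsumB// rsumZ ?rsumZ//; last exact: asum_weight.
  by rewrite /wdeg /wsum; field.
pose F1 (i : (X * X) + X) := if i is inl p then (if p.1 == x then c p.2 else 0) else 0.
pose F2 (i : (X * X) + X) := if i is inl p then (if p.2 == x then c p.1 else 0) else 0.
pose F3 (i : (X * X) + X) := if i is inr y then (if y == x then ka x * g x else 0) else 0.
have [sF1 rF1] : asum F1 /\ rsum F1 = rsum c.
  have -> : c = F1 \o (fun y => inl (x, y)) by apply/funext => y /=; rewrite eqxx.
  apply: rsum_slice; first exact: pairl_inj.
    move=> [[a b]|a] //= H; case: eqP => // ax.
    by have := H b; rewrite ax eqxx.
  by rewrite (_ : _ \o _ = c)//; apply/funext => y /=; rewrite eqxx.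
have [sF2 rF2] : asum F2 /\ rsum F2 = rsum c.
  have -> : c = F2 \o (fun y => inl (y, x)) by apply/funext => y /=; rewrite eqxx.
  apply: rsum_slice; first exact: pairr_inj.
    move=> [[a b]|a] //= H; case: eqP => // bx.
    by have := H a; rewrite bx eqxx.
  by rewrite (_ : _ \o _ = c)//; apply/funext => y /=; rewrite eqxx.
have F3s i : i \notin [:: inr x] -> F3 i = 0.
  by case: i => //= y; rewrite inE; case: (eqVneq y x) => // ->; rewrite eqxx.
have sF3 : asum F3 by exact: asum_finsupp F3s.
have rF3 : rsum F3 = ka x * g x.
  by rewrite (rsum_finsupp _ F3s)// big_seq1 /F3 eqxx.
have E : (fun i => edge_weight i * (gradient g i * gradient (delta x) i)) =
    (fun i => F1 i + F2 i + F3 i).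
  apply/funext => -[[a b]|a] /=; rewrite /delta /F1 /F2 /F3 /=; last first.
    by case: eqP => [->|_]; rewrite ?mulr1 ?mulr0 !add0r.
  case: (eqVneq a x) => [->|ax]; case: (eqVneq b x) => [->|bx].
  - by rewrite /c weight_diag; ring.
  - by rewrite /c /=; ring.
  - by rewrite /c /= (weight_sym G x a); ring.
  - by rewrite subrr !mulr0 !addr0.
rewrite /form /wdot E; split; first by apply: asumD => //; exact: asumD.
by rewrite rsumD ?rsumD ?rF1 ?rF2 ?rF3 ?rc//; [field|exact: asumD].
Qed.

Lemma finite_energyD f g : finite_energy f -> finite_energy g ->
  finite_energy (fun x => f x + g x).
Proof. by rewrite /finite_energy gradientD; apply/wl2D/edge_weight_ge0. Qed.

Lemma finite_energyZ c f : finite_energy f -> finite_energy (fun x => c * f x).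
Proof. by rewrite /finite_energy gradientZ; apply/wl2Z. Qed.

Lemma finite_energyN f : finite_energy f -> finite_energy (fun x => - f x).
Proof. by rewrite /finite_energy gradientN; apply/wl2N. Qed.

Lemma finite_energyB f g : finite_energy f -> finite_energy g ->
  finite_energy (fun x => f x - g x).
Proof.
by move=> ef eg; apply: finite_energyD => //; exact: finite_energyN.
Qed.

Lemma finite_energy_delta x : finite_energy (delta x).
Proof.
have [] := @green_delta (delta x) x _.
  apply: (asum_finsupp (s := [:: x])) => y; rewrite inE /delta => /negbTE ->.
  by rewrite mulr0.
by move=> + _; apply: asum_le => i; rewrite expr2.
Qed.

Lemma finsupp_ind (P : (X -> R) -> Prop) : P (fun=> 0) ->
  (forall f x c, P f -> P (fun y => f y + c * delta x y)) ->
  forall (s : seq X) f, (forall x, x \notin s -> f x = 0) -> P f.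
Proof.
move=> P0 PD; elim=> [f f0|x s ih f f0].
  by rewrite (_ : f = fun=> 0)//; apply/funext => x; exact: f0.
pose g y := if y == x then 0 else f y.
rewrite (_ : f = fun y => g y + f x * delta x y); last first.
  apply/funext => y; rewrite /g /delta; case: eqP => [->|_].
    by rewrite add0r mulr1.
  by rewrite mulr0 addr0.
apply/PD/ih => y ys; rewrite /g; case: eqVneq => // yx.
by apply: f0; rewrite inE negb_or yx.
Qed.

Lemma finsuppP f : finsupp f <->
  exists2 s : seq X, uniq s & forall x, x \notin s -> f x = 0.
Proof.
split=> [ff|[s us fs]].
  exists (finmap.enum_fset (fset_set [set x | f x != 0])).
    exact: finmap.fset_uniq.
  move=> x; rewrite in_fset_set// => /negP h; apply/eqP/negPn/negP => fx.
  by apply: h; rewrite inE.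
apply: (@sub_finite_set _ _ [set` s]); last exact: finite_seq.
by move=> x /= fx; apply: contraNT fx => /fs ->.
Qed.

Lemma finite_energy0 : finite_energy (fun=> 0).
Proof.
rewrite /finite_energy (_ : gradient _ = fun=> 0); first exact: wl20.
by apply/funext => -[[x y]|x] //=; rewrite subrr.
Qed.

Lemma finsupp_finite_energy f : finsupp f -> finite_energy f.
Proof.
move=> /finsuppP[s _ fs]; apply: finsupp_ind fs => [|g x c ef].
  exact: finite_energy0.
by apply: finite_energyD => //; exact/finite_energyZ/finite_energy_delta.
Qed.

Lemma finsupp_ell2 f : finsupp f -> wl2 mu f.
Proof. by move=> /finsuppP[s _ fs]; exact: wl2_finsupp fs. Qed.

Lemma finsuppD f g : finsupp f -> finsupp g -> finsupp (fun x => f x + g x).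
Proof.
move=> /finsuppP[s us fs] /finsuppP[r ur gr]; apply/finsuppP.
exists (undup (s ++ r)); first exact: undup_uniq.
move=> x; rewrite mem_undup mem_cat negb_or => /andP[xs xr].
by rewrite fs// gr// addr0.
Qed.

Lemma finsuppZ c f : finsupp f -> finsupp (fun x => c * f x).
Proof.
move=> /finsuppP[s us fs]; apply/finsuppP; exists s => // x /fs ->.
by rewrite mulr0.
Qed.

Lemma finsupp0 : finsupp (fun _ : X => 0 : R).
Proof. by apply/finsuppP; exists [::]. Qed.

Lemma finsupp_delta x : finsupp (delta x).
Proof.
apply/finsuppP; exists [:: x] => // y; rewrite inE /delta.
by move/negbTE => ->.
Qed.

Lemma energyE f g : finite_energy f -> finite_energy g -> energy G f g = form f g.
Proof.
move=> ef eg; pose a i := edge_weight i * (gradient f i * gradient g i).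
have sa : asum a by exact: (wl2_mul edge_weight_ge0).
pose F1 (i : (X * X) + X) := if i is inl p then a (inl p) else 0.
pose F2 (i : (X * X) + X) := if i is inr y then a (inr y) else 0.
have sF1 : asum F1.
  by apply: asum_le sa => -[p|x] //=; rewrite normr0.
have sF2 : asum F2.
  by apply: asum_le sa => -[p|x] //=; rewrite normr0.
have E : a = fun i => F1 i + F2 i.
  by apply/funext => -[p|x]; rewrite /= ?addr0 ?add0r.
have inlJ : injective (inl : X * X -> (X * X) + X) by move=> p q [].
have inrJ : injective (inr : X -> (X * X) + X) by move=> p q [].
have s1 : asum (F1 \o inl).
  move: sF1 => /asumP[C h]; apply/asumP; exists C => s us.
  by have := h (map inl s); rewrite map_inj_uniq// big_map; apply.
have s2 : asum (F2 \o inr).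
  move: sF2 => /asumP[C h]; apply/asumP; exists C => s us.
  by have := h (map inr s); rewrite map_inj_uniq// big_map; apply.
rewrite /form /wdot -/a E rsumD//.
have [] := rsum_slice inlJ _ s1.
  by move=> [p|x] // /(_ p); rewrite eqxx.
have [] := rsum_slice inrJ _ s2.
  by move=> [p|x] // /(_ x); rewrite eqxx.
move=> _ -> _ ->; rewrite /energy -rsumZ.
  congr (_ + _); congr rsum; apply/funext => p /=; rewrite /a /=; ring.
have := asumZ 2 s1; rewrite (_ : (fun i => _) = fun p : X * X =>
  weight G p.1 p.2 * ((f p.1 - f p.2) * (g p.1 - g p.2)))//.
by apply/funext => p /=; rewrite /a /=; field.
Qed.

Lemma formDl f g h : finite_energy f -> finite_energy g -> finite_energy h ->
  form (fun x => f x + g x) h = form f h + form g h.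
Proof. by move=> *; rewrite /form gradientD wdotDl//; exact: edge_weight_ge0. Qed.

Lemma formC f g : form f g = form g f.
Proof. exact: wdotC. Qed.

Lemma formDr f g h : finite_energy f -> finite_energy g -> finite_energy h ->
  form h (fun x => f x + g x) = form h f + form h g.
Proof. by move=> *; rewrite formC formDl// !(formC h). Qed.

Lemma formZl c f h : finite_energy f -> finite_energy h ->
  form (fun x => c * f x) h = c * form f h.
Proof. by move=> *; rewrite /form gradientZ wdotZl//; exact: edge_weight_ge0. Qed.

Lemma formZr c f h : finite_energy f -> finite_energy h ->
  form h (fun x => c * f x) = c * form h f.
Proof. by move=> *; rewrite formC formZl// formC. Qed.

Lemma form_ge0 f : 0 <= form f f.
Proof. exact/wdot_ge0/edge_weight_ge0. Qed.

Lemma form_sqrD_le a f g : finite_energy f -> finite_energy g ->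
  form (fun x => a * f x + g x) (fun x => a * f x + g x) <=
  2 * (a ^+ 2 * form f f + form g g).
Proof.
move=> ef eg.
have E (c : R) : form (fun x => c * f x + g x) (fun x => c * f x + g x) =
    form g g + 2 * c * form g f + c ^+ 2 * form f f.
  have ec := finite_energyZ c ef.
  rewrite formDl ?formDr//; try exact: finite_energyD.
  by rewrite !formZl// ?formZr// (formC f g); ring.
have := form_ge0 (fun x => - a * f x + g x); rewrite !E sqrrN; lra.
Qed.

Lemma dot_delta f x : wdot mu f (delta x) = mu x * f x.
Proof.
rewrite /wdot (rsum_finsupp (s := [:: x]))//.
  by rewrite big_seq1 /delta eqxx mulr1.
by move=> y; rewrite inE /delta => /negbTE ->; rewrite !mulr0.
Qed.

Lemma form_approx_ell2 f fn : form_approx G f fn -> wl2 mu f.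
Proof. by case=> /ell2E. Qed.

(** Closability of the form. Convergence in l^2 forces pointwise convergence of the functions and
    hence of their gradients; an energy-Cauchy sequence then converges in energy to the gradient of
    the same [f]. *)
Lemma form_approx_cvg f fn : form_approx G f fn ->
  [/\ finite_energy f,
    wnorm mu (fun x => fn n x - f x) @[n --> \oo] --> (0 : R) &
    wnorm edge_weight (fun i => gradient (fn n) i - gradient f i)
      @[n --> \oo] --> (0 : R)].
Proof.
move=> [/ell2E sf ffn fnf ca].
have pt x : fn n x @[n --> \oo] --> f x.
  have sq : 0 < Num.sqrt (mu x) by rewrite sqrtr_gt0 vmeas_gt0.
  apply: (@cvg_dist_le0 _ _ _ _ _ (fun n => ell2_norm G (fn n \- f) / Num.sqrt (mu x))).
    apply: nearW => n; rewrite distrC.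
    have sn := wl2B mu_ge0 (finsupp_ell2 (ffn n)) sf.
    by have := wnorm_pt mu_ge0 (vmeas_gt0 G x) sn.
  by rewrite -[X in _ --> X](mul0r (Num.sqrt (mu x))^-1); apply: cvgM => //; exact: cvg_cst.
have [] := @wnorm_cauchy_cvg R _ _ edge_weight_ge0 (fun n => gradient (fn n)) (gradient f).
- by move=> n; exact: finsupp_finite_energy.
- move=> [[x y]|x] /=; last exact: pt.
  by apply: cvgB; exact: pt.
- move=> e e0; have [N hN] := ca (e ^+ 2) (exprn_gt0 2 e0); exists N => p q Np Nq.
  have ep := finsupp_finite_energy (ffn p).
  have eq := finsupp_finite_energy (ffn q).
  have := hN p q Np Nq; rewrite energyE; [|exact: finite_energyB|exact: finite_energyB].
  rewrite /form gradientB => /ltW h.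
  exact: wnorm_le (ltW e0) _.
by move=> ef cv; split.
Qed.

Lemma dom_closure_finite_energy f : dom_closure G f -> finite_energy f.
Proof. by move=> [fn /form_approx_cvg[]]. Qed.

Lemma dom_closure_ell2 f : dom_closure G f -> wl2 mu f.
Proof. by move=> [fn /form_approx_ell2]. Qed.

(** The set under [get] contains [form f g] and nothing else, since the energies converge to it
    along every pair of approximating sequences. *)
Lemma energy_closureE f g : dom_closure G f -> dom_closure G g ->
  energy_closure G f g = form f g.
Proof.
move=> [fn af] [gn ag].
have key fn' gn' : form_approx G f fn' -> form_approx G g gn' ->
    energy G (fn' n) (gn' n) @[n --> \oo] --> form f g.
  move=> af' ag'; have [ef _ cf] := form_approx_cvg af'.
  have [eg _ cg] := form_approx_cvg ag'.
  have ff' n : finite_energy (fn' n) by case: af' => _ h _ _; exact: finsupp_finite_energy.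
  have gf' n : finite_energy (gn' n) by case: ag' => _ h _ _; exact: finsupp_finite_energy.
  under eq_fun do rewrite energyE//.
  by apply: wdot_cvg => //; exact: edge_weight_ge0.
rewrite /energy_closure; set S := [set v | _].
have Sf : S (form f g) by exists fn, gn; split => //; exact: key.
have [fn' [gn' [af' ag' h]]] : S (get S) by exact: getI Sf.
by apply: (cvg_unique _ h (key _ _ af' ag')).
Qed.

Lemma finsupp_dom_closure f : finsupp f -> dom_closure G f.
Proof.
move=> ff; exists (fun=> f); split => //.
- exact/ell2E/finsupp_ell2.
- rewrite (_ : (fun _ => _) = fun=> 0); first exact: cvg_cst.
  apply/funext => n; rewrite /ell2_norm /ell2_dot -[RHS](@sqrtr0 R) -(rsum0 R X).
  by congr (Num.sqrt (rsum _)); apply/funext => x /=; rewrite subrr mul0r mulr0.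
- move=> e e0; exists 0%N => m n _ _.
  rewrite energyE; last 2 first.
  + by apply: finite_energyB; exact: finsupp_finite_energy.
  + by apply: finite_energyB; exact: finsupp_finite_energy.
  rewrite /form (_ : gradient _ = fun=> 0) ?wdot0l//.
  by apply/funext => -[[x y]|x] /=; rewrite !subrr.
Qed.

Lemma dom_closureD a f g : dom_closure G f -> dom_closure G g ->
  dom_closure G (fun x => a * f x + g x).
Proof.
move=> [fn af] [gn ag]; exists (fun n x => a * fn n x + gn n x).
have [ef cf cef] := form_approx_cvg af.
have [eg cg ceg] := form_approx_cvg ag.
have [/ell2E sf ff _ cauf] := af; have [/ell2E sg fg _ caug] := ag.
have sfn n := finsupp_ell2 (ff n); have sgn n := finsupp_ell2 (fg n).
have efn n := finsupp_finite_energy (ff n); have egn n := finsupp_finite_energy (fg n).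
split.
- by apply/ell2E/wl2D => //; [exact: mu_ge0|exact: wl2Z].
- by move=> n; apply: finsuppD => //; exact: finsuppZ.
- apply: (@cvg_dist_le0 _ _ _ _ _ (fun n => `|a| * wnorm mu (fun x => fn n x - f x) +
    wnorm mu (fun x => gn n x - g x))); last first.
    rewrite -[X in _ --> X](_ : `|a| * 0 + 0 = 0); last by rewrite mulr0 addr0.
    by apply: cvgD => //; apply: cvgM => //; exact: cvg_cst.
  apply: nearW => n; rewrite sub0r normrN ger0_norm ?sqrtr_ge0//.
  have s1 : wl2 mu (fun x => fn n x - f x) by apply: wl2B => //; exact: mu_ge0.
  have s2 : wl2 mu (fun x => gn n x - g x) by apply: wl2B => //; exact: mu_ge0.
  rewrite -wnormZ//; last exact: mu_ge0.
  apply: le_trans (wnormD mu_ge0 (wl2Z _ s1) s2).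
  rewrite le_eqVlt; apply/orP; left; apply/eqP; congr wnorm.
  by apply/funext => x /=; ring.
- move=> e e0.
  (* With these constants [form_sqrD_le] bounds the energy by
     [2 (a^2 e / (4 (1 + a^2)) + e / 4) <= e]. *)
  have e1 : 0 < e / (4 * (1 + a ^+ 2)).
    by rewrite divr_gt0// mulr_gt0// ltr_wpDr ?sqr_ge0.
  have e2 : 0 < e / 4 by rewrite divr_gt0.
  have [N1 h1] := cauf _ e1; have [N2 h2] := caug _ e2.
  exists (maxn N1 N2) => m n; rewrite !geq_max => /andP[m1 m2] /andP[n1 n2].
  have {h1} := h1 m n m1 n1; have {h2} := h2 m n m2 n2.
  have E1 := finite_energyB (efn m) (efn n).
  have E2 := finite_energyB (egn m) (egn n).
  have -> : (fun x => a * fn m x + gn m x) \- (fun x => a * fn n x + gn n x) =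
      (fun x => a * (fn m x - fn n x) + (gn m x - gn n x)).
    by apply/funext => x /=; ring.
  rewrite !energyE//; try by apply: finite_energyD => //; exact: finite_energyZ.
  move=> h2 h1; apply: le_lt_trans (form_sqrD_le a E1 E2) _.
  move: h1; rewrite ltr_pdivlMr; last by rewrite mulr_gt0// ltr_wpDr ?sqr_ge0.
  move: h2 (form_ge0 (fn m \- fn n)) (sqr_ge0 a).
  rewrite -/(form (fn m \- fn n) (fn m \- fn n)).
  rewrite -/(form (gn m \- gn n) (gn m \- gn n)).
  move: (form _ _) (form _ _) (a ^+ 2) => p q r; nra.
Qed.

(** Testing against Dirac masses suffices: they span the finitely supported functions, and both
    sides pass to the limit along an approximating sequence of the test function. *)
Lemma form_operatorP f k : dom_closure G f -> wl2 mu k ->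
  (forall x, form f (delta x) = mu x * k x) -> form_operator G f k.
Proof.
move=> df sk hd; split => //; first exact/ell2E.
have ef := dom_closure_finite_energy df.
have fin h : finsupp h -> form f h = wdot mu k h.
  move=> /finsuppP[s us hs].
  suff [] : [/\ finite_energy h, wl2 mu h & form f h = wdot mu k h] by [].
  move: s h hs {us}; apply: finsupp_ind => [|h x c [eh sh fh]].
    split; [exact: finite_energy0|exact: wl20|].
    rewrite wdotC wdot0l formC /form (_ : gradient _ = fun=> 0) ?wdot0l//.
    by apply/funext => -[[x y]|x] //=; rewrite subrr.
  have ed := finite_energy_delta x; have sd := finsupp_ell2 (finsupp_delta x).
  split; first exact/finite_energyD/finite_energyZ.
    by apply: wl2D; [exact: mu_ge0| |exact: wl2Z].
  rewrite formDr//; last exact: finite_energyZ.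
  rewrite formZr// wdotDr//; [|exact: mu_ge0|exact: wl2Z].
  by rewrite wdotZr// ?dot_delta ?fh ?hd//; exact: mu_ge0.
move=> h dh; rewrite energy_closureE//; case: dh => hn ah.
have [eh ch ceh] := form_approx_cvg ah; have [/ell2E sh fh _ _] := ah.
have c1 : form f (hn n) @[n --> \oo] --> form f h.
  apply: (@wdot_cvg _ _ _ (fun=> gradient f)) => //.
  - exact: edge_weight_ge0.
  - by move=> n; exact: finsupp_finite_energy.
  - rewrite (_ : (fun _ => _) = fun=> 0); first exact: cvg_cst.
    apply/funext => n; rewrite (_ : (fun _ => _) = fun=> 0) ?wnorm0//.
    by apply/funext => i; rewrite subrr.
have c2 : form f (hn n) @[n --> \oo] --> wdot mu k h.
  under eq_fun do rewrite fin//.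
  apply: (@wdot_cvg _ _ _ (fun=> k)) => //.
  - exact: mu_ge0.
  - by move=> n; exact: finsupp_ell2.
  - rewrite (_ : (fun _ => _) = fun=> 0); first exact: cvg_cst.
    apply/funext => n; rewrite (_ : (fun _ => _) = fun=> 0) ?wnorm0//.
    by apply/funext => i; rewrite subrr.
by apply: cvg_unique c1 c2.
Qed.

Lemma form_operatorE f k h : form_operator G f k -> dom_closure G h ->
  form f h = wdot mu k h.
Proof.
by move=> [df /ell2E sk fk] dh; rewrite -energy_closureE// fk.
Qed.

Lemma form_operatorD a f g k l : form_operator G f k -> form_operator G g l ->
  form_operator G (fun x => a * f x + g x) (fun x => a * k x + l x).
Proof.
move=> Lf Lg; have [df /ell2E sk _] := Lf; have [dg /ell2E sl _] := Lg.
have ef := dom_closure_finite_energy df; have eg := dom_closure_finite_energy dg.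
apply: form_operatorP.
- exact: dom_closureD.
- by apply: wl2D; [exact: mu_ge0|exact: wl2Z|].
- move=> x; have ed := finite_energy_delta x.
  have dd := finsupp_dom_closure (finsupp_delta x).
  rewrite formDl//; last exact: finite_energyZ.
  rewrite formZl// (form_operatorE Lf dd) (form_operatorE Lg dd) !dot_delta.
  by ring.
Qed.

End graph_form.

(** * The resolvent *)

Section vertex_exhaustion.
Variables (R : realType) (X : countType).

Definition first_vertices (n : nat) : seq X :=
  pmap (@pickle_inv X) (iota 0 n).

Lemma mem_first_vertices n x : (x \in first_vertices n) = (pickle x < n)%N.
Proof.
rewrite mem_pmap; apply/mapP/idP => [[k]|xn].
  rewrite mem_iota add0n /= => kn kx.
  by have := @pickle_invK X k; rewrite -kx /= => ->.
by exists (pickle x); rewrite ?mem_iota// pickleK_inv.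
Qed.

Lemma first_vertices_uniq n : uniq (first_vertices n).
Proof.
by apply: (pmap_uniq (@pickle_invK X)); exact: iota_uniq.
Qed.

Lemma finsupp_bounded (f : X -> R) : finsupp f -> bounded_fun f.
Proof.
move=> /finsuppP[s us fs]; exists (\sum_(x <- s) `|f x|) => x.
have [xs|/fs ->] := boolP (x \in s); last by rewrite normr0 sumr_ge0.
by rewrite (big_rem x)//= lerDl sumr_ge0.
Qed.

End vertex_exhaustion.
Arguments first_vertices {X} n.

Section resolvent.
Variables (R : realType) (X : countType) (G : graph R X).
Local Notation w := (weight G).
Local Notation mu := (vmeas G).
Local Notation ka := (killing G).
Local Notation mu0 := (mu_ge0 G).
Implicit Types (f g s : X -> R).

Definition degree x : R := (wdeg G x + ka x) / mu x.

Lemma wdeg_ge0 x : 0 <= wdeg G x.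
Proof. by apply: rsum_ge0 => y; exact: weight_ge0. Qed.

Lemma degree_ge0 x : 0 <= degree x.
Proof.
rewrite /degree; apply: divr_ge0; last exact: mu_ge0.
by apply: addr_ge0; [exact: wdeg_ge0|exact: killing_ge0].
Qed.

Lemma laplacian_degree f x : bounded_fun f ->
  laplacian G f x = degree x * f x - wsum G x f / mu x.
Proof.
move=> bf; rewrite laplacianE// /degree; have := vmeas_gt0 G x => m0.
by field; rewrite gt_eqF.
Qed.

Lemma le_wsum x f g : asum (fun y => w x y * f y) ->
  asum (fun y => w x y * g y) -> (forall y, f y <= g y) ->
  wsum G x f <= wsum G x g.
Proof.
move=> sf sg fg; apply: ler_rsum => // y.
by rewrite ler_wpM2l ?weight_ge0.
Qed.

Lemma wsum_ge0 x f : (forall y, 0 <= f y) -> 0 <= wsum G x f.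
Proof. by move=> f0; apply: rsum_ge0 => y; rewrite mulr_ge0 ?weight_ge0. Qed.

Variable h : R.
Hypothesis h0 : 0 < h.

(* Jacobi iteration for [(1 + h L) g = f]. Step [k] only keeps the first [k]
   vertices, so that all iterates have finite support. *)
Definition jacobi_step f u x : R :=
  (f x + h / mu x * wsum G x u) / (1 + h * degree x).

Fixpoint jacobi_iter f (k : nat) : X -> R :=
  if k is k'.+1 then
    fun x => if (pickle x < k')%N then jacobi_step f (jacobi_iter f k') x else 0
  else fun=> 0.

Lemma diag_gt0 x : 0 < 1 + h * degree x.
Proof. by rewrite ltr_wpDr// mulr_ge0 ?degree_ge0// ltW. Qed.

Lemma hmu_ge0 x : 0 <= h / mu x.
Proof. by rewrite divr_ge0 ?mu_ge0// ltW. Qed.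

Lemma jacobi_supp f k x : (k <= pickle x)%N -> jacobi_iter f k x = 0.
Proof. by case: k => //= k kx; rewrite ltnNge (ltnW kx). Qed.

Lemma jacobi_finsupp f k : finsupp (jacobi_iter f k).
Proof.
apply/finsuppP; exists (first_vertices k); first exact: first_vertices_uniq.
by move=> x; rewrite mem_first_vertices -leqNgt => /jacobi_supp.
Qed.

Lemma jacobi_asum f k x : asum (fun y => w x y * jacobi_iter f k y).
Proof. exact/asum_weightM/finsupp_bounded/jacobi_finsupp. Qed.

(** The inequality [f <= s + h D s], with the neighbour sum moved to the left as in the Jacobi
    step. *)
Definition supersolution f s := forall x,
  asum (fun y => w x y * s y) /\
  f x + h / mu x * wsum G x s <= (1 + h * degree x) * s x.

(** A Jacobi step is monotone and does not raise a supersolution, so iterates that start at 0 stay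
    below it. In the limit the resolvent lies below every nonnegative supersolution. *)
Lemma jacobi_le_supersolution f s k : (forall x, 0 <= s x) ->
  supersolution f s -> forall x, jacobi_iter f k x <= s x.
Proof.
move=> s0 ss; elim: k => //= k ih x; case: ifP => // _.
rewrite /jacobi_step ler_pdivrMr ?diag_gt0// [leRHS]mulrC.
have [sas H] := ss x; apply: le_trans H.
by rewrite lerD2l ler_wpM2l ?hmu_ge0// le_wsum//; exact: jacobi_asum.
Qed.

Section nonneg_data.
Variable f : X -> R.
Hypotheses (f0 : forall x, 0 <= f x) (sf : wl2 mu f).

Local Notation g := (jacobi_iter f).

Lemma jacobi_ge0 k x : 0 <= g k x.
Proof.
elim: k x => //= k ih x; case: ifP => // _.
by rewrite divr_ge0 ?(ltW (diag_gt0 x))// addr_ge0// mulr_ge0 ?hmu_ge0// wsum_ge0.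
Qed.

Lemma jacobi_leS k x : g k x <= g k.+1 x.
Proof.
elim: k x => [|k ih] x; first exact: jacobi_ge0.
rewrite [leLHS]/= [leRHS]/=; case: ifPn => xk; last first.
  exact: (jacobi_ge0 k.+2 x).
rewrite (ltn_trans xk (ltnSn k)) ler_wpM2r ?invr_ge0 ?(ltW (diag_gt0 x))//.
rewrite lerD2l ler_wpM2l ?hmu_ge0// le_wsum//; first exact: jacobi_asum.
exact: (jacobi_asum f k.+1).
Qed.

Lemma jacobi_nondecreasing x : nondecreasing_seq (fun k => g k x).
Proof. by apply/nondecreasing_seqP => k; exact: jacobi_leS. Qed.

Local Notation fe k := (finsupp_finite_energy G (jacobi_finsupp f k)).
Local Notation l2 k := (finsupp_ell2 G (jacobi_finsupp f k)).

Definition hform u v := wdot mu u v + h * form G u v.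

Lemma hform_delta k x : hform (g k) (delta R x) =
  mu x * ((1 + h * degree x) * g k x - h / mu x * wsum G x (g k)).
Proof.
rewrite /hform dot_delta (green_delta (jacobi_asum f k x)).2 /degree.
by have m0 := vmeas_gt0 G x; field; rewrite gt_eqF.
Qed.

(** The residual of an iterate is its next increment times the diagonal. As the iterates increase
    they are subsolutions where they are updated, and as they converge the residual vanishes in the
    limit. *)
Lemma hform_delta_S k x : (pickle x < k)%N -> hform (g k) (delta R x) =
  mu x * (f x + (1 + h * degree x) * (g k x - g k.+1 x)).
Proof.
move=> xk; rewrite hform_delta /= xk /jacobi_step.
have m0 := vmeas_gt0 G x; have d0 := diag_gt0 x.
by congr (_ * _); field; rewrite !gt_eqF.
Qed.

Lemma hform_delta_le k x : (pickle x < k)%N ->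
  hform (g k) (delta R x) <= mu x * f x.
Proof.
move=> xk; rewrite hform_delta_S// ler_wpM2l ?mu_ge0//.
rewrite gerDl pmulr_rle0 ?diag_gt0// subr_le0; exact: jacobi_leS.
Qed.

Lemma hform_sum u v (r : seq X) : finite_energy G u -> wl2 mu u ->
  uniq r -> (forall x, x \notin r -> v x = 0) ->
  hform u v = \sum_(x <- r) v x * hform u (delta R x).
Proof.
move=> eu su; have key (c : X -> R) (r' : seq X) :
    let z := fun y => \sum_(x <- r') c x * delta R x y in
    finsupp z /\ hform u z = \sum_(x <- r') c x * hform u (delta R x).
  elim: r' => [|x r' [fz ih]] /=.
    rewrite big_nil; under eq_fun do rewrite big_nil.
    split; first exact: finsupp0.
    rewrite /hform wdotC wdot0l formC /form (_ : gradient _ = fun=> 0).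
      by rewrite wdot0l mulr0 addr0.
    by apply/funext => -[[y z]|y] //=; rewrite subrr.
  have fd := finsupp_delta R x; have fcd := finsuppZ (c x) fd.
  under eq_fun do rewrite big_cons.
  split; first exact: finsuppD.
  rewrite big_cons -ih /hform wdotDr; [|exact: mu0|exact: finsupp_ell2|exact: finsupp_ell2|by []].
  rewrite formDr; [|exact: finsupp_finite_energy|exact: finsupp_finite_energy|by []].
  rewrite wdotZr; [|exact: mu0|exact: finsupp_ell2|by []].
  rewrite formZr; [|exact: finsupp_finite_energy|by []].
  by ring.
move=> ur vr; have [_ <-] := key v r; congr hform; apply/funext => y.
have [yr|yr] := boolP (y \in r).
  rewrite (big_rem y)//= /delta eqxx mulr1 big_seq big1 ?addr0// => x.
  by rewrite mem_rem_uniq// inE eq_sym => /andP[/negbTE -> _]; rewrite mulr0.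
rewrite vr// big_seq big1// => x xr; rewrite /delta.
by case: eqVneq => [yx|_]; rewrite ?mulr0//; rewrite yx xr in yr.
Qed.

Lemma dot_sum v (r : seq X) : uniq r -> (forall x, x \notin r -> v x = 0) ->
  wdot mu f v = \sum_(x <- r) v x * (mu x * f x).
Proof.
move=> ur vr; rewrite /wdot (rsum_finsupp ur).
  by apply: eq_bigr => x _; rewrite mulrA mulrC.
by move=> x /vr ->; rewrite !mulr0.
Qed.

Lemma jacobi_vertices k x : x \notin first_vertices k -> g k x = 0.
Proof. by rewrite mem_first_vertices -leqNgt; exact: jacobi_supp. Qed.

(** The subsolution inequality tested with the nonnegative iterate itself. *)
Lemma jacobi_energy_le k : hform (g k) (g k) <= wdot mu f (g k).
Proof.
rewrite (hform_sum (fe k) (l2 k) (first_vertices_uniq X k) (@jacobi_vertices k)).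
rewrite (dot_sum (first_vertices_uniq X k) (@jacobi_vertices k)).
rewrite big_seq [leRHS]big_seq; apply: ler_sum => x.
rewrite mem_first_vertices => xk.
by rewrite ler_wpM2l ?jacobi_ge0// hform_delta_le.
Qed.

Lemma jacobi_norm_le k : wnorm mu (g k) <= wnorm mu f.
Proof.
have [->|n0] := eqVneq (wnorm mu (g k)) 0; first exact: wnorm_ge0.
have np : 0 < wnorm mu (g k) by rewrite lt_def n0 wnorm_ge0.
rewrite -(ler_pM2r np) -expr2 wnorm_sqr//; last exact: mu0.
apply: le_trans (le_trans (ler_norm _) (wnorm_CS mu0 sf (l2 k))).
apply: le_trans (jacobi_energy_le k).
by rewrite lerDl mulr_ge0 ?form_ge0// ltW.
Qed.

Definition jacobi_lim x : R := limn (fun k => g k x).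

Lemma jacobi_cvg x : g k x @[k --> \oo] --> jacobi_lim x.
Proof.
apply: nondecreasing_is_cvgn; first exact: jacobi_nondecreasing.
exists (wnorm mu f / Num.sqrt (mu x)) => _ [k _ <-].
apply: le_trans (ler_norm _) _.
apply: le_trans (wnorm_pt mu0 (vmeas_gt0 G x) (l2 k)) _.
by rewrite ler_wpM2r ?invr_ge0 ?sqrtr_ge0// jacobi_norm_le.
Qed.

Lemma jacobi_le_lim k x : g k x <= jacobi_lim x.
Proof.
apply: cvgr_to_ge (@jacobi_cvg x) _; exists k => // n kn.
exact: jacobi_nondecreasing.
Qed.

Lemma jacobi_lim_ge0 x : 0 <= jacobi_lim x.
Proof. exact: jacobi_le_lim 0%N x. Qed.

Lemma jacobi_lim_ell2 : wl2 mu jacobi_lim.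
Proof.
have [] // := @wnorm_fatou _ _ _ mu0 _ \oo _ (fun k => g k) jacobi_lim (wnorm mu f).
- exact: wnorm_ge0.
- exact: jacobi_cvg.
- by apply: nearW => k; split; [exact: (l2 k)|exact: jacobi_norm_le].
Qed.

Lemma jacobi_dot_cvg : wdot mu f (g k) @[k --> \oo] --> wdot mu f jacobi_lim.
Proof.
apply: (@rsum_dominated _ _ _ _ _ _ _ (fun x => mu x * (f x * jacobi_lim x))).
- exact: (wl2_mul mu0 sf jacobi_lim_ell2).
- apply: nearW => k x; rewrite ger0_norm; last first.
    by rewrite !mulr_ge0 ?mu_ge0 ?jacobi_ge0.
  by rewrite !ler_wpM2l ?mu_ge0 ?jacobi_le_lim.
- by move=> x; do 2 (apply: cvgM; first exact: cvg_cst); exact: jacobi_cvg.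
- by move=> x; rewrite ger0_norm// !mulr_ge0 ?mu_ge0 ?jacobi_lim_ge0.
Qed.

Lemma hform_delta_cvg x :
  hform (g l) (delta R x) @[l --> \oo] --> mu x * f x.
Proof.
have c : mu x * (f x + (1 + h * degree x) * (g l x - g l.+1 x)) @[l --> \oo] -->
    mu x * (f x + (1 + h * degree x) * (jacobi_lim x - jacobi_lim x)).
  apply: cvgM; first exact: cvg_cst.
  apply: cvgD; first exact: cvg_cst.
  apply: cvgM; first exact: cvg_cst.
  apply: cvgB; first exact: jacobi_cvg.
  by have := jacobi_cvg (x := x); rewrite -(cvg_shiftS (fun l => g l x)); apply.
rewrite subrr mulr0 addr0 in c.
apply: cvg_trans c; apply: near_eq_cvg.
exists (pickle x).+1 => // l xl /=.
by rewrite -hform_delta_S.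
Qed.

Lemma hform_cvg k : hform (g l) (g k) @[l --> \oo] --> wdot mu f (g k).
Proof.
rewrite (dot_sum (first_vertices_uniq X k) (@jacobi_vertices k)).
under eq_fun => l do rewrite (hform_sum (fe l) (l2 l)
  (first_vertices_uniq X k) (@jacobi_vertices k)).
apply: (@cvg_sum_seq R X nat \oo _ (fun l x => g k x * hform (g l) (delta R x))
  (fun x => g k x * (mu x * f x))) => x.
by apply: cvgM; [exact: cvg_cst|exact: hform_delta_cvg].
Qed.

Lemma hformB u v : finite_energy G u -> finite_energy G v -> wl2 mu u ->
  wl2 mu v -> hform (fun x => u x - v x) (fun x => u x - v x) =
  hform u u - 2 * hform u v + hform v v.
Proof.
move=> eu ev su sv; have E y : u y - v y = u y + (-1) * v y by rewrite mulN1r.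
rewrite /hform /form gradientB; under eq_fun do rewrite E.
rewrite wdot_sqrD//; last exact: mu0.
rewrite (_ : (fun i => _) = fun i => gradient u i + (-1) * gradient v i); last first.
  by apply/funext => i; rewrite mulN1r.
by rewrite wdot_sqrD//; [ring|exact: edge_weight_ge0].
Qed.

Lemma hformB_le u v : finite_energy G u -> finite_energy G v -> wl2 mu u ->
  wl2 mu v -> hform (fun x => u x - v x) (fun x => u x - v x) <=
  2 * (hform u u + hform v v).
Proof.
move=> eu ev su sv; rewrite hformB// /hform /form.
have := wdot_ge0 mu0 (fun x => u x + 1 * v x); rewrite wdot_sqrD//; last exact: mu0.
have := wdot_ge0 (edge_weight_ge0 G) (fun i => gradient u i + 1 * gradient v i).
rewrite wdot_sqrD//; last exact: edge_weight_ge0.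
move=> /(mulr_ge0 (ltW h0)); lra.
Qed.

(** Two indices are compared through a fixed [k]. For [p] large, [hform (g p) (g k)] is close to
    [wdot mu f (g k)]; by [jacobi_energy_le] the energy of [g p - g k] is then at most about
    [wdot mu f (g p) - wdot mu f (g k)], and both terms are near their common limit. *)
Lemma jacobi_energy_cauchy (e : R) : 0 < e -> exists N : nat, forall p q,
  (N <= p)%N -> (N <= q)%N ->
  hform (fun x => g p x - g q x) (fun x => g p x - g q x) <= e.
Proof.
move=> e0; have e16 : 0 < e / 16 by rewrite divr_gt0.
have /cvgrPdist_le /(_ _ e16) [k _ hk] := jacobi_dot_cvg.
have dk := hk k (leqnn k).
have /cvgrPdist_le /(_ _ e16) [N1 _ hN] := @hform_cvg k.
exists (maxn k N1).
have near_k p : (maxn k N1 <= p)%N ->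
    hform (fun x => g p x - g k x) (fun x => g p x - g k x) <= e / 4.
  rewrite geq_max => /andP[kp N1p].
  rewrite hformB; [|exact: (fe p)|exact: (fe k)|exact: (l2 p)|exact: (l2 k)].
  have := jacobi_energy_le p; have := jacobi_energy_le k.
  have := hN p N1p; rewrite ler_distl => /andP[H1 H2].
  have := hk p kp; move: dk; rewrite !ler_distl => /andP[H3 H4] /andP[H5 H6].
  lra.
move=> p q /near_k hp /near_k hq.
have ep := finite_energyB (fe p) (fe k); have eq := finite_energyB (fe q) (fe k).
have sp := wl2B mu0 (l2 p) (l2 k); have sq := wl2B mu0 (l2 q) (l2 k).
have E : (fun x => g p x - g q x) =
    (fun x => (g p x - g k x) - (g q x - g k x)) by apply/funext => x; ring.
rewrite E; apply: le_trans (hformB_le ep eq sp sq) _; lra.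
Qed.

Lemma jacobi_lim_operator : form_operator G jacobi_lim
  (fun x => h^-1 * (f x - jacobi_lim x)).
Proof.
have ca (e : R) : 0 < e -> exists N : nat, forall p q, (N <= p)%N -> (N <= q)%N ->
    wnorm mu (fun x => g p x - g q x) <= e.
  move=> e0; have [N hN] := jacobi_energy_cauchy (exprn_gt0 2 e0).
  exists N => p q Np Nq; apply: wnorm_le; first exact: ltW.
  apply: le_trans (hN p q Np Nq).
  by rewrite lerDl mulr_ge0 ?form_ge0// ltW.
have [sl cl] := wnorm_cauchy_cvg mu0 (fun k => l2 k) jacobi_cvg ca.
have ap : form_approx G jacobi_lim g.
  split; [exact/ell2E|exact: jacobi_finsupp|exact: cl|].
  move=> e e0; have he0 : 0 < h * e / 2 by rewrite divr_gt0// mulr_gt0.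
  have [N hN] := jacobi_energy_cauchy he0; exists N => p q Np Nq.
  have ed := finite_energyB (fe p) (fe q).
  rewrite energyE//; have := hN p q Np Nq; rewrite /hform.
  have := wdot_ge0 mu0 (fun x => g p x - g q x).
  rewrite -/(g p \- g q); move: (form _ _ _) => F; nra.
have dl : dom_closure G jacobi_lim by exists g.
have sk : wl2 mu (fun x => h^-1 * (f x - jacobi_lim x)).
  by apply: wl2Z; apply: wl2B => //; exact: mu0.
apply: form_operatorP => // x.
have [el _ cel] := form_approx_cvg ap.
have ed := finite_energy_delta G x.
have c1 : form G (g l) (delta R x) @[l --> \oo] --> form G jacobi_lim (delta R x).
  apply: (@wdot_cvg _ _ _ (fun l => gradient (g l)) (fun=> gradient (delta R x))) => //.
  - exact: edge_weight_ge0.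
  - by move=> l; exact: (fe l).
  - rewrite (_ : (fun _ => _) = fun=> 0); first exact: cvg_cst.
    apply/funext => n; rewrite (_ : (fun _ => _) = fun=> 0) ?wnorm0//.
    by apply/funext => i; rewrite subrr.
have c2 : hform (g l) (delta R x) @[l --> \oo] -->
    mu x * jacobi_lim x + h * form G jacobi_lim (delta R x).
  apply: cvgD; last by apply: cvgM => //; exact: cvg_cst.
  under eq_fun do rewrite dot_delta.
  by apply: cvgM; [exact: cvg_cst|exact: jacobi_cvg].
have E := cvg_unique _ c2 (@hform_delta_cvg x).
have {}E : mu x * jacobi_lim x + h * form G jacobi_lim (delta R x) = mu x * f x.
  exact: E.
have hn0 : h != 0 by rewrite gt_eqF.
apply: (mulfI hn0); rewrite mulrCA mulVKf//.
by move: E; lra.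
Qed.

Lemma jacobi_lim_lower x : f x / (1 + h * degree x) <= jacobi_lim x.
Proof.
(* Vertex [x] is first updated in iterate [(pickle x).+2]; dropping its nonnegative neighbour sum
   leaves the bound. *)
apply: le_trans (jacobi_le_lim (pickle x).+2 x); rewrite /= ltnS leqnn.
rewrite ler_wpM2r ?invr_ge0 ?(ltW (diag_gt0 x))// lerDl.
by rewrite mulr_ge0 ?hmu_ge0// wsum_ge0// => y; exact: (jacobi_ge0 (pickle x).+1).
Qed.

Lemma jacobi_lim_le_supersolution s : (forall x, 0 <= s x) ->
  supersolution f s -> forall x, jacobi_lim x <= s x.
Proof.
move=> s0 ss x; apply: cvgr_to_le (@jacobi_cvg x) _; apply: nearW => k.
exact: jacobi_le_supersolution.
Qed.

End nonneg_data.

End resolvent.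

Lemma cvg_at_right0P (R : realType) (F : R -> R) :
  F t @[t --> 0^'+] --> (0 : R) <->
  forall e, 0 < e -> exists2 d, 0 < d & forall t, 0 < t <= d -> `|F t| <= e.
Proof.
split=> [/cvgr0Pnorm_le H e e0|H].
  have [d /= d0 hd] := H e e0.
  exists (d / 2); first by rewrite divr_gt0.
  move=> t /andP[t0 td]; apply: hd => //=.
  by rewrite sub0r normrN gtr0_norm//; lra.
apply/cvgr0Pnorm_le => e e0; have [d d0 hd] := H e e0.
exists d => //= t /=; rewrite sub0r normrN => td t0.
by apply: hd; rewrite t0 /=; move: td; rewrite gtr0_norm// => /ltW.
Qed.

Lemma le0_of_cvg0 (R : realType) (c : R) (b : nat -> R) :
  (forall n, c <= b n) -> b n @[n --> \oo] --> (0 : R) -> c <= 0.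
Proof. by move=> cb b0; apply: cvgr_to_ge b0 _; exact: nearW. Qed.

(** * Resolvents as commuting contractions of l^2 *)

Section resolvent_operator.
Variables (R : realType) (X : countType) (G : graph R X).
Local Notation mu := (vmeas G).
Local Notation mu0 := (mu_ge0 G).
Local Notation N := (wnorm mu).
Implicit Types (f g k : X -> R) (h : R).

Definition resolvent h f : X -> R :=
  get [set g | form_operator G g (fun x => h^-1 * (f x - g x))].
Local Notation J := resolvent.

Lemma wnorm_eq0 f : wl2 mu f -> N f <= 0 -> f = fun=> 0.
Proof.
move=> sf nf; apply/funext => x; apply/eqP; rewrite -normr_le0.
apply: le_trans (wnorm_pt mu0 (vmeas_gt0 G x) sf) _.
by rewrite pmulr_lle0// invr_gt0 sqrtr_gt0 vmeas_gt0.
Qed.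

Lemma form_operator_ell2 f g : form_operator G f g -> wl2 mu f /\ wl2 mu g.
Proof. by move=> [/dom_closure_ell2 ? /ell2E ?]. Qed.

Lemma form_operator_dot_ge0 f g : form_operator G f g -> 0 <= wdot mu f g.
Proof.
move=> Lf; have [df _ _] := Lf.
by rewrite wdotC -(form_operatorE Lf df) form_ge0.
Qed.

Lemma form_operatorB f g k l : form_operator G f k -> form_operator G g l ->
  form_operator G (fun x => f x - g x) (fun x => k x - l x).
Proof.
move=> Lf Lg; have := form_operatorD (-1) Lg Lf.
by congr form_operator; apply/funext => x; ring.
Qed.

(** The difference [d] of two solutions satisfies [L d = - d / h], while [L] is nonnegative, so
    [d = 0]. *)
Lemma resolvent_unique h f g g' : 0 < h ->
  form_operator G g (fun x => h^-1 * (f x - g x)) ->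
  form_operator G g' (fun x => h^-1 * (f x - g' x)) -> g = g'.
Proof.
move=> h0 Lg Lg'; have Ld := form_operatorB Lg Lg'.
have [sd _] := form_operator_ell2 Ld.
have := form_operator_dot_ge0 Ld.
rewrite (_ : (fun x => h^-1 * (f x - g x) - _) =
  (fun x => (- h^-1) * (g x - g' x))); last by apply/funext => x; ring.
rewrite wdotZr//; last exact: mu0.
rewrite mulNr oppr_ge0 pmulr_rle0 ?invr_gt0// => H.
have := wnorm_eq0 sd; rewrite /wnorm ler0_sqrtr// => /(_ (lexx 0)) E.
apply/funext => x; apply/eqP; rewrite -subr_eq0; apply/eqP.
by have := congr1 (fun u => u x) E.
Qed.

Lemma resolvent_exists h f : 0 < h -> wl2 mu f ->
  exists g, form_operator G g (fun x => h^-1 * (f x - g x)).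
Proof.
move=> h0 sf.
have sp : wl2 mu (f^\+).
  apply: wl2_le sf; [exact: mu0|] => x; rewrite /funrpos.
  by case: (leP (f x) 0) => H; rewrite ?normr0.
have sn : wl2 mu (f^\-).
  apply: wl2_le sf; [exact: mu0|] => x; rewrite /funrneg.
  by case: (leP (- f x) 0) => H; rewrite ?normr0// normrN.
have p0 x : 0 <= f^\+ x by have [] := funrposneg_ge0 f x.
have n0 x : 0 <= f^\- x by have [] := funrposneg_ge0 f x.
have := form_operatorB (jacobi_lim_operator h0 p0 sp) (jacobi_lim_operator h0 n0 sn).
move=> H; eexists; move: H; congr form_operator; apply/funext => x.
by rewrite [f x in RHS](funrposnegE f); ring.
Qed.

Lemma resolventP h f : 0 < h -> wl2 mu f ->
  form_operator G (J h f) (fun x => h^-1 * (f x - J h f x)).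
Proof.
move=> h0 sf; have [g Lg] := resolvent_exists h0 sf.
by have := getI (P := [set g | form_operator G g (fun x => h^-1 * (f x - g x))]) Lg.
Qed.

Opaque resolvent.

Lemma resolvent_eq h f g : 0 < h -> wl2 mu f ->
  form_operator G g (fun x => h^-1 * (f x - g x)) -> J h f = g.
Proof. by move=> h0 sf; apply: resolvent_unique h0 (resolventP h0 sf). Qed.

Lemma resolvent_ell2 h f : 0 < h -> wl2 mu f -> wl2 mu (J h f).
Proof. by move=> h0 sf; have [] := form_operator_ell2 (resolventP h0 sf). Qed.

Lemma resolvent_jacobi h f : 0 < h -> wl2 mu f -> (forall x, 0 <= f x) ->
  J h f = jacobi_lim G h f.
Proof.
by move=> h0 sf f0; apply: resolvent_eq => //; exact: jacobi_lim_operator.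
Qed.

Lemma resolventD h a f g : 0 < h -> wl2 mu f -> wl2 mu g ->
  J h (fun x => a * f x + g x) = (fun x => a * J h f x + J h g x).
Proof.
move=> h0 sf sg; apply: resolvent_eq => //.
  by apply: wl2D => //; [exact: mu0|exact: wl2Z].
have := form_operatorD a (resolventP h0 sf) (resolventP h0 sg).
by congr form_operator; apply/funext => x; ring.
Qed.

Lemma resolventB h f g : 0 < h -> wl2 mu f -> wl2 mu g ->
  J h (fun x => f x - g x) = (fun x => J h f x - J h g x).
Proof.
move=> h0 sf sg; apply: resolvent_eq => //; first exact: (wl2B mu0).
have := form_operatorB (resolventP h0 sf) (resolventP h0 sg).
by congr form_operator; apply/funext => x; ring.
Qed.

(** Nonnegativity of [L] at [J h f] gives |J f|^2 <= <J f, f>, and Cauchy-Schwarz concludes. *)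
Lemma resolvent_norm h f : 0 < h -> wl2 mu f -> N (J h f) <= N f.
Proof.
move=> h0 sf; have sJ := resolvent_ell2 h0 sf.
have := form_operator_dot_ge0 (resolventP h0 sf).
rewrite wdotZr//; [|exact: mu0|exact: (wl2B mu0)].
rewrite pmulr_rge0 ?invr_gt0// wdotBr//; last exact: mu0.
rewrite subr_ge0 => H.
have [->|n0] := eqVneq (N (J h f)) 0; first exact: wnorm_ge0.
have np : 0 < N (J h f) by rewrite lt_def n0 wnorm_ge0.
rewrite -(ler_pM2r np) -expr2 wnorm_sqr; last exact: mu0.
apply: le_trans H _; rewrite mulrC.
by apply: le_trans (wnorm_CS mu0 sJ sf); exact: ler_norm.
Qed.

(* The resolvent identity read as [J (f + h L f) = f]. *)
Lemma resolvent_domain h f g : 0 < h -> form_operator G f g ->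
  J h f = (fun x => f x - h * J h g x) /\ form_operator G (J h f) (J h g).
Proof.
move=> h0 Lf; have [sf sg] := form_operator_ell2 Lf.
have hn0 : h != 0 by rewrite gt_eqF.
have E : f = (fun x => J h f x + h * J h g x).
  have E : J h (fun x => h * g x + f x) = f.
    apply: resolvent_eq => //.
      by apply: wl2D => //; [exact: mu0|exact: wl2Z].
    by move: Lf; congr form_operator; apply/funext => x; field.
  rewrite -[LHS]E resolventD//.
  by apply/funext => x; rewrite addrC.
split; first by apply/funext => x; rewrite {2}E; ring.
have := resolventP h0 sf; congr form_operator; apply/funext => x.
by rewrite {1}E; field.
Qed.

(** [J h] commutes with [L] on its domain, so it maps the equation that characterises [J h' f] to
    the one that characterises [J h' (J h f)]. *)
Lemma resolvent_commute h h' f : 0 < h -> 0 < h' -> wl2 mu f ->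
  J h (J h' f) = J h' (J h f).
Proof.
move=> h0 h0' sf; apply/esym; apply: resolvent_eq => //.
  exact: resolvent_ell2.
have [_] := resolvent_domain h0 (resolventP h0' sf); congr form_operator.
have sJ := resolvent_ell2 h0' sf; have sB := wl2B mu0 sf sJ.
have := resolventD h'^-1 h0 sB (wl20 mu).
have -> : J h (fun=> 0) = fun=> 0.
  apply: resolvent_eq => //; first exact: wl20.
  have := form_operatorB (resolventP h0 sf) (resolventP h0 sf).
  by congr form_operator; apply/funext => x; ring.
rewrite (_ : (fun x => h'^-1 * (f x - J h' f x) + 0) =
  fun x => h'^-1 * (f x - J h' f x)); last by apply/funext => x; rewrite addr0.
by move=> ->; rewrite resolventB//; apply/funext => x; rewrite addr0.
Qed.

Lemma resolvent_dist h f g : 0 < h -> form_operator G f g ->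
  N (fun x => J h f x - f x) <= h * N g.
Proof.
move=> h0 Lf; have [sf sg] := form_operator_ell2 Lf.
rewrite {1}(resolvent_domain h0 Lf).1.
rewrite (_ : (fun x => _) = fun x => (- h) * J h g x); last first.
  by apply/funext => x; ring.
rewrite wnormZ; [|exact: mu0|exact: resolvent_ell2].
by rewrite normrN gtr0_norm// ler_pM2l// resolvent_norm.
Qed.

(** Without local finiteness [f] may lie outside the domain of [L], so [resolvent_dist] is replaced
    by an energy bound. Testing with [f] and with [J h f] gives |f - J f|^2 = h (form (J f) f - form
    (J f) (J f)), and nonnegativity of the form at [J f - f / 2] bounds the bracket. *)
Lemma resolvent_dist_finsupp h f : 0 < h -> finsupp f ->
  N (fun x => f x - J h f x) ^+ 2 <= h * form G f f.
Proof.
move=> h0 ff; have sf := finsupp_ell2 G ff; have LJ := resolventP h0 sf.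
have sJ := resolvent_ell2 h0 sf; have [dJ _ _] := LJ.
have df := finsupp_dom_closure G ff.
have eJ := dom_closure_finite_energy dJ; have ef := finsupp_finite_energy G ff.
have sB := wl2B mu0 sf sJ.
have := form_operatorE LJ dJ; have := form_operatorE LJ df.
rewrite !(wdotZl mu0)//.
rewrite (wnorm_sqr mu0) (wdotBr mu0)// => E1 E2.
have hn0 : h != 0 by rewrite gt_eqF.
have {}E1 : wdot mu (fun i => f i - J h f i) f = h * form G (J h f) f.
  by rewrite E1 mulVKf.
have {}E2 : wdot mu (fun i => f i - J h f i) (J h f) = h * form G (J h f) (J h f).
  by rewrite E2 mulVKf.
rewrite E1 E2 -mulrBr ler_pM2l//.
have := form_ge0 G (fun x => (- (2^-1)) * f x + J h f x).
have em := finite_energyZ (- 2^-1) ef.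
rewrite formDl ?formDr//; try exact: finite_energyD.
rewrite !formZl// ?formZr// (formC G f (J h f)).
have := form_ge0 G f; lra.
Qed.

Lemma restrict_first_finsupp f n : finsupp (restrict_first f n).
Proof.
apply/finsuppP; exists (first_vertices n); first exact: first_vertices_uniq.
by move=> x; rewrite mem_first_vertices /restrict_first => /negbTE ->.
Qed.

Lemma restrict_first_cvg f : wl2 mu f ->
  N (fun x => f x - restrict_first f n x) @[n --> \oo] --> (0 : R).
Proof.
move=> sf; have E : (fun n => wdot mu (fun x => f x - restrict_first f n x)
    (fun x => f x - restrict_first f n x)) @ \oo --> (0 : R).
  rewrite -[X in _ --> X](rsum0 R X).
  apply: (@rsum_dominated _ _ _ _ _ _ _ (fun x => mu x * f x ^+ 2)) => //.
  - apply: nearW => n x; rewrite ger0_norm; last first.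
      by rewrite mulr_ge0 ?mu_ge0// -expr2 sqr_ge0.
    rewrite ler_wpM2l ?mu_ge0// -expr2 /restrict_first; case: ifP => _.
      by rewrite subrr expr0n sqr_ge0.
    by rewrite subr0.
  - move=> x; apply: cvg_near_cst; exists (pickle x).+1 => // n /= xn.
    by rewrite /restrict_first xn subrr mulr0 mulr0.
  - by move=> x; rewrite normr0 mulr_ge0 ?mu_ge0 ?sqr_ge0.
apply/cvgr0Pnorm_le => e e0; move/cvgr0Pnorm_le : E => /(_ _ (exprn_gt0 2 e0)).
apply: filterS => n; rewrite !ger0_norm ?wnorm_ge0 ?wdot_ge0//; last exact: mu0.
by move=> H; apply: wnorm_le => //; exact: ltW.
Qed.

Lemma resolvent_small f e : wl2 mu f -> 0 < e -> exists2 d, 0 < d &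
  forall h, 0 < h <= d -> N (fun x => J h f x - f x) <= e.
Proof.
move=> sf e0; have e4 : 0 < e / 4 by rewrite divr_gt0.
have /cvgr0Pnorm_le /(_ _ e4) [n _ /(_ n (leqnn n))] := restrict_first_cvg sf.
rewrite ger0_norm ?wnorm_ge0//; set u := restrict_first f n => fu.
have ffu : finsupp u by exact: restrict_first_finsupp.
have su := finsupp_ell2 G ffu.
exists ((e / 4) ^+ 2 / (1 + form G u u)).
  by rewrite divr_gt0 ?exprn_gt0// ltr_wpDr// form_ge0.
move=> h /andP[h0 hd]; have sJ := resolvent_ell2 h0 sf; have sJu := resolvent_ell2 h0 su.
have uJ : N (fun x => u x - J h u x) <= e / 4.
  rewrite -(@ler_pXn2r _ 2)// ?nnegrE ?wnorm_ge0//; last exact: ltW.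
  apply: le_trans (resolvent_dist_finsupp h0 ffu) _.
  move: hd; rewrite ler_pdivlMr; last by rewrite ltr_wpDr// form_ge0.
  by apply: le_trans; rewrite ler_pM2l// lerDr.
rewrite (_ : (fun x => _) = fun x =>
  (J h (fun x => f x - u x) x + (- 1) * (u x - J h u x)) + (- 1) * (f x - u x)); last first.
  by rewrite resolventB//; apply/funext => x; ring.
have sB := wl2B mu0 sf su; have sB' := wl2B mu0 su sJu.
apply: le_trans (wnormD mu0 _ _) _; [|exact: wl2Z|].
  by apply: wl2D; [exact: mu0|exact: resolvent_ell2|exact: wl2Z].
rewrite wnormZ//; last exact: mu0.
apply: le_trans (lerD (wnormD mu0 _ _) (lexx _)) _.
- exact: resolvent_ell2.
- exact: wl2Z.
rewrite wnormZ//; last exact: mu0.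
rewrite normrN normr1 !mul1r.
have := resolvent_norm h0 sB; lra.
Qed.

End resolvent_operator.

(** * The heat semigroup *)

Section semigroup_construction.
Variables (R : realType) (X : countType) (G : graph R X).
Local Notation mu := (vmeas G).
Local Notation mu0 := (mu_ge0 G).
Local Notation N := (wnorm mu).
Local Notation J := (resolvent G).
Implicit Types (f g k : X -> R) (h e t s : R) (n m p q : nat).

Definition ldist f g : R := N (fun x => f x - g x).

(* [lra] would try to unify distinct norms by unfolding them. *)
Ltac abstract_norms :=
  repeat match goal with
  | H : is_true ?T |- _ => match T with
      | context [wnorm _ _] => revert H
      | context [ldist _ _] => revert H end
  end;
  repeat match goal with
  | |- context [ldist ?f ?g] => generalize (ldist f g); intro
  end;
  repeat match goal with
  | |- context [wnorm ?m ?f] => generalize (wnorm m f); intro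
  end;
  intros.

Lemma ldist_ge0 f g : 0 <= ldist f g. Proof. exact: wnorm_ge0. Qed.

Lemma ldistC f g : ldist f g = ldist g f. Proof. exact: wnormBC. Qed.

Lemma ldistxx f : ldist f f = 0.
Proof.
rewrite /ldist (_ : (fun x => _) = fun=> 0) ?wnorm0//.
by apply/funext => x; rewrite subrr.
Qed.

Lemma ldist_triangle g f k : wl2 mu f -> wl2 mu g -> wl2 mu k ->
  ldist f k <= ldist f g + ldist g k.
Proof. by move=> sf sg sk; exact: (wnorm_triangle mu0 sf sk sg). Qed.

Lemma ldist_eq0 f g : wl2 mu f -> wl2 mu g -> ldist f g <= 0 -> f = g.
Proof.
move=> sf sg H; have E := wnorm_eq0 (wl2B mu0 sf sg) H.
apply/funext => x; apply/eqP; rewrite -subr_eq0; apply/eqP.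
by have := congr1 (fun u => u x) E.
Qed.

Lemma ldist_pt f g x : wl2 mu f -> wl2 mu g ->
  `|f x - g x| <= ldist f g / Num.sqrt (mu x).
Proof. by move=> sf sg; have := wnorm_pt mu0 (vmeas_gt0 G x) (wl2B mu0 sf sg). Qed.

Lemma ldist_cvg_pt (u : nat -> X -> R) f x : (forall n, wl2 mu (u n)) ->
  wl2 mu f -> ldist (u n) f @[n --> \oo] --> (0 : R) ->
  u n x @[n --> \oo] --> f x.
Proof.
move=> su sf uf; apply: (@cvg_dist_le0 _ _ _ _ _ (fun n => ldist (u n) f / Num.sqrt (mu x))).
  by apply: nearW => n; rewrite distrC; exact: ldist_pt.
by rewrite -[X in _ --> X](mul0r (Num.sqrt (mu x))^-1); apply: cvgM => //; exact: cvg_cst.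
Qed.

Lemma wnorm_ldist f g : wl2 mu f -> wl2 mu g -> N f <= N g + ldist f g.
Proof.
move=> sf sg; rewrite addrC; apply: le_trans (wnormD mu0 (wl2B mu0 sf sg) sg).
rewrite le_eqVlt; apply/orP; left; apply/eqP; congr wnorm.
by apply/funext => x; rewrite subrK.
Qed.

Section iterates.
Variable h : R.
Hypothesis h0 : 0 < h.
Local Notation I n f := (iter n (J h) f).

Lemma iter_ell2 n f : wl2 mu f -> wl2 mu (I n f).
Proof. by move=> sf; elim: n => //= n; exact: resolvent_ell2. Qed.

Lemma iter_norm n f : wl2 mu f -> N (I n f) <= N f.
Proof.
move=> sf; elim: n => //= n; apply: le_trans.
by apply: resolvent_norm => //; exact: iter_ell2.
Qed.

Lemma iter_linear n a f g : wl2 mu f -> wl2 mu g ->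
  I n (fun x => a * f x + g x) = (fun x => a * I n f x + I n g x).
Proof.
by move=> sf sg; elim: n => //= n ->; rewrite resolventD//; exact: iter_ell2.
Qed.

Lemma iterB n f g : wl2 mu f -> wl2 mu g ->
  I n (fun x => f x - g x) = (fun x => I n f x - I n g x).
Proof.
by move=> sf sg; elim: n => //= n ->; rewrite resolventB//; exact: iter_ell2.
Qed.

Lemma iter_ldist n f g : wl2 mu f -> wl2 mu g ->
  ldist (I n f) (I n g) <= ldist f g.
Proof.
by move=> sf sg; rewrite /ldist -iterB//; apply: iter_norm; exact: (wl2B mu0).
Qed.

Lemma iter_domain n f g : form_operator G f g -> form_operator G (I n f) (I n g).
Proof. by move=> Lf; elim: n => //= n /(resolvent_domain h0)[]. Qed.

Lemma iter_near_id n f g : form_operator G f g ->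
  ldist (I n f) f <= n%:R * h * N g.
Proof.
move=> Lf; have [sf sg] := form_operator_ell2 Lf.
elim: n => /= [|n ih]; first by rewrite ldistxx !mul0r.
apply: le_trans (ldist_triangle (iter_ell2 n.+1 sf) (iter_ell2 n sf) sf) _.
have := resolvent_dist h0 (iter_domain n Lf).
rewrite -/(ldist (I n.+1 f) _) -addn1 natrD mulrDl mul1r mulrDl addrC => H.
apply: lerD => //; apply: le_trans H _.
by rewrite ler_pM2l//; exact: iter_norm.
Qed.

(* Crude first-order expansion: [J^n f = f - h (J g + ... + J^n g)]. *)
Lemma iter_expansion n f g e : form_operator G f g ->
  (forall i, (i <= n)%N -> ldist (I i g) g <= e) ->
  N (fun x => I n f x - f x + n%:R * h * g x) <= n%:R * h * e.
Proof.
move=> Lf; have [sf sg] := form_operator_ell2 Lf.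
elim: n => [|n ih] ge.
  rewrite mul0r mul0r (_ : (fun x => _) = fun=> 0) ?wnorm0//.
  by apply/funext => x; rewrite !mul0r subrr addr0.
have E := (resolvent_domain h0 (iter_domain n Lf)).1.
rewrite (_ : (fun x => _) = fun x =>
    (I n f x - f x + n%:R * h * g x) + (- h) * (I n.+1 g x - g x)); last first.
  apply/funext => x; rewrite [I n.+1 f]/= E -[J h (I n g)]/(I n.+1 g).
  by rewrite -(addn1 n) natrD; ring.
have s1 : wl2 mu (fun x => I n f x - f x + n%:R * h * g x).
  apply: wl2D; [exact: mu0| |exact: wl2Z].
  by apply: wl2B; [exact: mu0|exact: iter_ell2|].
have s2 : wl2 mu (fun x => I n.+1 g x - g x).
  by apply: wl2B; [exact: mu0|exact: iter_ell2|].
apply: le_trans (wnormD mu0 s1 (wl2Z _ s2)) _.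
rewrite wnormZ//; last exact: mu0.
rewrite normrN gtr0_norm// -(addn1 n) natrD mulrDl mul1r mulrDl.
apply: lerD; first by apply: ih => i /leqW; exact: ge.
by rewrite addn1 ler_pM2l ?ge.
Qed.

End iterates.

(** One step of size [h] and two of size [h / 2] both agree with [f - h L f] up to order [h^2], the
    error being controlled by [k], which is L^2 f. *)
Lemma resolvent_halving h f g k : 0 < h -> form_operator G f g ->
  form_operator G g k ->
  ldist (J h f) (J (h / 2) (J (h / 2) f)) <= 2 * h ^+ 2 * N k.
Proof.
move=> h0 Lf Lg; have [sf sg] := form_operator_ell2 Lf.
have [_ sk] := form_operator_ell2 Lg.
have k0 : 0 < h / 2 by rewrite divr_gt0.
have [E1 _] := resolvent_domain h0 Lf.
have [E2 L2] := resolvent_domain k0 Lf.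
have [E3 _] := resolvent_domain k0 L2.
set g1 := J (h / 2) g in E2 E3 L2; set g2 := J (h / 2) g1 in E3.
have sg1 : wl2 mu g1 by exact: resolvent_ell2.
have sg2 : wl2 mu g2 by exact: resolvent_ell2.
have sJg : wl2 mu (J h g) by exact: resolvent_ell2.
rewrite /ldist E3 E2 E1.
rewrite (_ : (fun x => _) = fun x => (h / 2) *
  ((g1 x - J h g x) + (g2 x - J h g x))); last first.
  by apply/funext => x; field.
have b1 : ldist g1 g <= h / 2 * N k by exact: resolvent_dist.
have b2 : ldist g2 g1 <= h / 2 * N k.
  exact: le_trans (iter_ldist k0 1 sg1 sg) b1.
have b3 : ldist (J h g) g <= h * N k by exact: resolvent_dist.
have := ldist_triangle sg2 sg1 sg; have := ldist_triangle sg1 sg sJg.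
have := ldist_triangle sg2 sg sJg; rewrite (ldistC g (J h g)) => t1 t2 t3.
rewrite wnormZ; [|exact: mu0|by apply: wl2D; [exact: mu0|exact: (wl2B mu0)|exact: (wl2B mu0)]].
have t4 : N (fun x => g1 x - J h g x + (g2 x - J h g x)) <=
    ldist g1 (J h g) + ldist g2 (J h g).
  exact: (wnormD mu0 (wl2B mu0 sg1 sJg) (wl2B mu0 sg2 sJg)).
rewrite gtr0_norm//.
have : N (fun i : X => g1 i - J h g i + (g2 i - J h g i)) <= 4 * h * N k.
  apply: le_trans t4 _; have : 0 <= h * N k by rewrite mulr_ge0 ?wnorm_ge0// ltW.
  by abstract_norms; lra.
move/(ler_wpM2l (ltW k0)) => /le_trans; apply.
by rewrite le_eqVlt; apply/orP; left; apply/eqP; field.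
Qed.

(** Each of the [n] exchanges of an [A] for a [B] costs at most the distance of [A f] and [B f]:
    commutation moves all other factors outside, where they contract. The consistency error is thus
    only ever measured at [f] itself. *)
Lemma iter_telescope (A B : (X -> R) -> X -> R) n f :
  (forall u, wl2 mu u -> wl2 mu (A u)) -> (forall u, wl2 mu u -> wl2 mu (B u)) ->
  (forall u v, wl2 mu u -> wl2 mu v -> ldist (A u) (A v) <= ldist u v) ->
  (forall u v, wl2 mu u -> wl2 mu v -> ldist (B u) (B v) <= ldist u v) ->
  (forall u, wl2 mu u -> A (B u) = B (A u)) -> wl2 mu f ->
  ldist (iter n A f) (iter n B f) <= n%:R * ldist (A f) (B f).
Proof.
move=> sA sB cA cB com.
have sAn (i : nat) u : wl2 mu u -> wl2 mu (iter i A u).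
  by move=> su; elim: i => //= i; exact: sA.
have sBn (i : nat) u : wl2 mu u -> wl2 mu (iter i B u).
  by move=> su; elim: i => //= i; exact: sB.
have comn (i : nat) u : wl2 mu u -> iter i A (B u) = B (iter i A u).
  by move=> su; elim: i => //= i ->; rewrite com//; exact: sAn.
have cAn (i : nat) u v : wl2 mu u -> wl2 mu v -> ldist (iter i A u) (iter i A v) <= ldist u v.
  move=> su sv; elim: i => //= i; apply: le_trans.
  by apply: cA; exact: sAn.
move=> sf; elim: n => [|n ih]; first by rewrite /= ldistxx mul0r.
have s1 := sAn n _ (sA _ sf); have s2 := sAn n _ (sB _ sf).
rewrite iterSr [iter n.+1 B f]/=.
apply: le_trans (ldist_triangle s1 s2 (sB _ (sBn n _ sf))) _.
rewrite -addn1 natrD mulrDl mul1r addrC; apply: lerD.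
  by rewrite comn//; apply: le_trans ih; apply: cB; [exact: sAn|exact: sBn].
by apply: cAn; [exact: sA|exact: sB].
Qed.

Lemma iter_halving h n f : 0 < h -> wl2 mu f ->
  ldist (iter n (J h) f) (iter n.*2 (J (h / 2)) f) <=
  n%:R * ldist (J h f) (J (h / 2) (J (h / 2) f)).
Proof.
move=> h0 sf; have k0 : 0 < h / 2 by rewrite divr_gt0.
have sK u : wl2 mu u -> wl2 mu (J (h / 2) u) by exact: resolvent_ell2.
rewrite -muln2 iterM.
refine (@iter_telescope (J h) (iter 2 (J (h / 2))) n f _ _ _ _ _ sf).
- by move=> u; exact: resolvent_ell2.
- by move=> u su; exact/sK/sK.
- exact: (iter_ldist h0 1).
- exact: (iter_ldist k0 2).
- move=> u su /=; rewrite (resolvent_commute h0 k0 (sK _ su)).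
  by rewrite (resolvent_commute h0 k0 su).
Qed.

Lemma iter_uniform f e : wl2 mu f -> 0 < e -> exists2 d, 0 < d &
  forall h n, 0 < h -> n%:R * h <= d -> ldist (iter n (J h) f) f <= e.
Proof.
move=> sf e0; have e3 : 0 < e / 3 by rewrite divr_gt0.
have [d0 d0p hd] := resolvent_small sf e3.
have := hd d0; rewrite d0p lexx => /(_ isT) Jf.
have LJ := resolventP d0p sf; set g := fun x => _ in LJ.
have sJ := resolvent_ell2 d0p sf.
exists (e / 3 / (1 + N g)); first by rewrite divr_gt0// ltr_wpDr// wnorm_ge0.
move=> h n h0; rewrite ler_pdivlMr; last by rewrite ltr_wpDr// wnorm_ge0.
move=> nh; have nh0 : 0 <= n%:R * h by rewrite mulr_ge0// ltW.
have H := iter_near_id h0 n LJ.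
have s1 := iter_ell2 h0 n sf; have s2 := iter_ell2 h0 n sJ.
apply: le_trans (ldist_triangle s1 s2 sf) _.
have := ldist_triangle s2 sJ sf; have := iter_ldist h0 n sf sJ.
rewrite (ldistC f) -/(ldist (J d0 f) f) in Jf *; move: H nh.
by abstract_norms; lra.
Qed.

(* [exp(- t L)] is obtained as the limit of backward Euler steps of dyadic size. *)
Definition mesh n : R := 2^-1 ^+ n.

Definition steps n t : nat := Num.truncn (t * 2 ^+ n).

Definition approx n t f : X -> R := iter (steps n t) (J (mesh n)) f.

Lemma mesh_gt0 n : 0 < mesh n. Proof. by rewrite exprn_gt0// invr_gt0. Qed.

Lemma meshS n : mesh n.+1 = mesh n / 2. Proof. by rewrite /mesh exprSr. Qed.

Lemma mesh_cvg0 : mesh n @[n --> \oo] --> (0 : R).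
Proof. by apply: cvg_expr; rewrite gtr0_norm ?invr_gt0// invf_lt1// ltr1n. Qed.

Lemma steps_bounds n t : 0 <= t ->
  (steps n t)%:R * mesh n <= t /\ t - mesh n <= (steps n t)%:R * mesh n.
Proof.
move=> t0; have /truncn_itv /andP[] : 0 <= t * 2 ^+ n by rewrite mulr_ge0// exprn_ge0.
rewrite -/(steps n t) => a b.
have mE : mesh n = (2 ^+ n)^-1 by rewrite /mesh exprVn.
have p0 : 0 < 2 ^+ n :> R by rewrite exprn_gt0.
split; first by rewrite mE ler_pdivrMr.
rewrite lerBlDr mE -[X in _ + X]mul1r -mulrDl natr1 ler_pdivlMr//.
exact: ltW.
Qed.

Lemma stepsS n t : 0 <= t ->
  steps n.+1 t = (steps n t).*2 \/ steps n.+1 t = (steps n t).*2.+1.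
Proof.
move=> t0; have p : 0 <= t * 2 ^+ n by rewrite mulr_ge0// exprn_ge0.
have /andP[] := truncn_itv p; rewrite -/(steps n t) -(natr1 (steps n t)) => a b.
have E : t * 2 ^+ n.+1 = 2 * (t * 2 ^+ n) by rewrite exprS; ring.
have E2 : ((steps n t).*2.+1)%:R = 2 * (steps n t)%:R + 1 :> R.
  by rewrite -(natr1 (steps n t).*2) -mul2n natrM.
rewrite /steps E; have [c|c] := ltP (2 * (t * 2 ^+ n)) ((steps n t).*2.+1)%:R.
  left; apply: truncn_def; rewrite c andbT -mul2n natrM; lra.
right; apply: truncn_def; rewrite c /= -/(steps n t) -(natr1 (steps n t).*2.+1) E2; lra.
Qed.

Lemma stepsD n s t : 0 <= s -> 0 <= t ->
  steps n (s + t) = (steps n s + steps n t)%N \/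
  steps n (s + t) = (steps n s + steps n t).+1.
Proof.
move=> s0 t0; have p : 0 <= s * 2 ^+ n by rewrite mulr_ge0// exprn_ge0.
have p' : 0 <= t * 2 ^+ n by rewrite mulr_ge0// exprn_ge0.
have /andP[] := truncn_itv p; rewrite -/(steps n s) -(natr1 (steps n s)) => a b.
have /andP[] := truncn_itv p'; rewrite -/(steps n t) -(natr1 (steps n t)) => a' b'.
rewrite {1 4}/steps mulrDl.
have [c|c] := ltP (s * 2 ^+ n + t * 2 ^+ n) ((steps n s + steps n t).+1)%:R.
  left; apply: truncn_def; rewrite c andbT natrD; lra.
right; apply: truncn_def; rewrite c /= -(natr1 (steps n s + steps n t).+1).
rewrite -(natr1 (steps n s + steps n t)) natrD; lra.
Qed.

Lemma approx_ell2 n t f : wl2 mu f -> wl2 mu (approx n t f).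
Proof. exact/iter_ell2/mesh_gt0. Qed.

(** About [t / mesh n] halvings, each at a cost of order [mesh n] squared, give the first term. The
    term [N g] pays for the extra step when halving the mesh yields an odd number of steps. *)
Lemma approx_step t f g k n : 0 <= t -> form_operator G f g ->
  form_operator G g k ->
  ldist (approx n.+1 t f) (approx n t f) <= (2 * t * N k + N g) * mesh n.
Proof.
move=> t0 Lf Lg; have [sf sg] := form_operator_ell2 Lf.
have m0 := mesh_gt0 n; have m0' := mesh_gt0 n.+1.
have H := iter_halving (steps n t) m0 sf; rewrite -meshS in H.
have H2 := resolvent_halving m0 Lf Lg; rewrite -meshS in H2.
have [b1 _] := steps_bounds n t0.
have H3 : ldist (approx n t f) (iter (steps n t).*2 (J (mesh n.+1)) f) <=
    2 * t * N k * mesh n.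
  apply: le_trans H _; apply: le_trans (ler_wpM2l _ H2) _ => //.
  rewrite [leLHS](_ : _ = ((steps n t)%:R * mesh n) * (2 * N k * mesh n)); last by ring.
  rewrite [leRHS](_ : _ = t * (2 * N k * mesh n)); last by ring.
  by apply: ler_wpM2r => //; rewrite !mulr_ge0 ?wnorm_ge0// ltW.
have s1 := approx_ell2 n t sf; have s2 := iter_ell2 m0' (steps n t).*2 sf.
have s3 := approx_ell2 n.+1 t sf.
apply: le_trans (ldist_triangle s3 s2 s1) _.
rewrite mulrDl addrC (ldistC _ (approx n t f)) lerD//.
rewrite /approx; case: (stepsS n t0) => ->.
  by rewrite ldistxx mulr_ge0 ?wnorm_ge0// ltW.
have := resolvent_dist m0' (iter_domain m0' (steps n t).*2 Lf).
rewrite -/(ldist _ _) => /le_trans; apply.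
rewrite mulrC; apply: ler_pM; rewrite ?wnorm_ge0 ?(ltW m0')//.
  exact: iter_norm.
by rewrite meshS; lra.
Qed.

Lemma approx_cauchy_dom t f g k p q : 0 <= t -> form_operator G f g ->
  form_operator G g k -> (p <= q)%N ->
  ldist (approx q t f) (approx p t f) <= (2 * t * N k + N g) * (2 * mesh p).
Proof.
move=> t0 Lf Lg pq; have [sf _] := form_operator_ell2 Lf.
set C := 2 * t * N k + N g.
(* This form closes the induction: one refinement costs [C * mesh q], which is C times
   [2 * mesh q - 2 * mesh q.+1]. *)
suff : ldist (approx q t f) (approx p t f) <= C * (2 * mesh p - 2 * mesh q).
  move=> /le_trans; apply; rewrite ler_wpM2l//.
    by rewrite addr_ge0 ?wnorm_ge0// !mulr_ge0 ?wnorm_ge0.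
  by have := mesh_gt0 q; lra.
elim: q pq => [|q ih]; first by rewrite leqn0 => /eqP ->; rewrite ldistxx subrr mulr0.
rewrite leq_eqVlt => /predU1P[->|]; first by rewrite ldistxx subrr mulr0.
rewrite ltnS => /ih {}ih.
apply: le_trans (ldist_triangle _ (approx_ell2 q t sf) _) _; try exact: approx_ell2.
have := approx_step q t0 Lf Lg; rewrite -/C; move: ih.
by rewrite meshS {Lf Lg}; clearbody C; abstract_norms; lra.
Qed.

Lemma domain_square_dense f e : wl2 mu f -> 0 < e -> exists u g k,
  [/\ form_operator G u g, form_operator G g k & ldist f u <= e].
Proof.
move=> sf e0; have e2 : 0 < e / 2 by rewrite divr_gt0.
have [d d0 hd] := resolvent_small sf e2.
have := hd d; rewrite d0 lexx => /(_ isT) H.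
have sJ := resolvent_ell2 d0 sf; have sJJ := resolvent_ell2 d0 sJ.
have L1 := resolventP d0 sf.
have [_ L2] := resolvent_domain d0 L1.
exists (J d (J d f)), (J d (fun x => d^-1 * (f x - J d f x))).
eexists; split; [exact: L2|apply: resolventP => //|].
  by apply: wl2Z; exact: (wl2B mu0).
apply: le_trans (ldist_triangle sf sJ sJJ) _.
have : ldist (J d f) (J d (J d f)) <= ldist f (J d f).
  by rewrite /ldist -resolventB//; apply: resolvent_norm => //; exact: (wl2B mu0).
rewrite -/(ldist (J d f) f) in H; rewrite (ldistC f); abstract_norms; lra.
Qed.

Lemma approx_ldist n t f g : wl2 mu f -> wl2 mu g ->
  ldist (approx n t f) (approx n t g) <= ldist f g.
Proof. exact/iter_ldist/mesh_gt0. Qed.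

Lemma approx_cauchy t f e : 0 <= t -> wl2 mu f -> 0 < e -> exists K : nat,
  forall p q, (K <= p)%N -> (K <= q)%N -> ldist (approx p t f) (approx q t f) <= e.
Proof.
move=> t0 sf e0; have e4 : 0 < e / 4 by rewrite divr_gt0.
have [u [g [k [Lu Lg fu]]]] := domain_square_dense sf e4.
have [su _] := form_operator_ell2 Lu.
set C := 2 * t * N k + N g.
have C0 : 0 <= C by rewrite addr_ge0 ?wnorm_ge0// !mulr_ge0 ?wnorm_ge0.
have e1 : 0 < e / 4 / (2 * (C + 1)) by rewrite !divr_gt0// mulr_gt0// ltr_wpDl.
have /cvgr0Pnorm_le /(_ _ e1) [K _ hK] := mesh_cvg0.
have key p q : (K <= p)%N -> (p <= q)%N -> ldist (approx p t f) (approx q t f) <= e.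
  move=> Kp pq; have := approx_cauchy_dom t0 Lu Lg pq; rewrite -/C => H.
  have := hK p Kp; rewrite gtr0_norm ?mesh_gt0// ler_pdivlMr; last first.
    by rewrite mulr_gt0// ltr_wpDl.
  move=> H2.
  have sp := approx_ell2 p t sf; have sq := approx_ell2 q t sf.
  have up := approx_ell2 p t su; have uq := approx_ell2 q t su.
  have := ldist_triangle sp up sq; have := ldist_triangle up uq sq.
  have := approx_ldist p t sf su; have := approx_ldist q t sf su.
  rewrite (ldistC (approx q t u) (approx p t u)) in H.
  rewrite (ldistC (approx q t u) (approx q t f)).
  have := mesh_gt0 p; move: H H2 fu C0; clearbody C; abstract_norms; nra.
exists K => p q Kp Kq; case/orP: (leq_total p q) => pq; first exact: key.
by rewrite ldistC; exact: key.
Qed.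

Definition min_semigroup t f : X -> R := fun x => limn (fun n => approx n t f x).
Local Notation P := min_semigroup.

Lemma min_semigroup_cvg t f : 0 <= t -> wl2 mu f ->
  [/\ wl2 mu (P t f), forall x, approx n t f x @[n --> \oo] --> P t f x &
      ldist (approx n t f) (P t f) @[n --> \oo] --> (0 : R)].
Proof.
move=> t0 sf.
have [|a0 [sa0 ca la]] := wnorm_complete (vmeas_gt0 G) (fun n => approx_ell2 n t sf).
  by move=> e e0; exact: approx_cauchy.
have -> : P t f = a0 by apply/funext => x; exact: cvg_lim (ca x).
by split.
Qed.

Lemma min_semigroup_ell2 t f : 0 <= t -> wl2 mu f -> wl2 mu (P t f).
Proof. by move=> t0 sf; have [] := min_semigroup_cvg t0 sf. Qed.

Lemma min_semigroup_linear t a f g : 0 <= t -> wl2 mu f -> wl2 mu g ->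
  P t (fun x => a * f x + g x) = (fun x => a * P t f x + P t g x).
Proof.
move=> t0 sf sg; apply/funext => x; apply: cvg_lim => //.
rewrite /approx; under eq_fun do rewrite iter_linear ?mesh_gt0//.
have [_ cf _] := min_semigroup_cvg t0 sf; have [_ cg _] := min_semigroup_cvg t0 sg.
by apply: cvgD; [apply: cvgM; [exact: cvg_cst|exact: cf]|exact: cg].
Qed.

Lemma min_semigroup_norm t f : 0 <= t -> wl2 mu f -> N (P t f) <= N f.
Proof.
move=> t0 sf; have [sP cf _] := min_semigroup_cvg t0 sf.
have [] // := @wnorm_fatou _ _ _ mu0 _ \oo _ (fun n => approx n t f) (P t f) (N f).
- exact: wnorm_ge0.
- apply: nearW => n; split; first exact: approx_ell2.
  exact/iter_norm/sf/mesh_gt0.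
Qed.

Lemma min_semigroupB t f g : 0 <= t -> wl2 mu f -> wl2 mu g ->
  P t (fun x => f x - g x) = (fun x => P t f x - P t g x).
Proof.
move=> t0 sf sg; have := min_semigroup_linear (-1) t0 sg sf.
rewrite (_ : (fun x => _) = fun x => f x - g x); last by apply/funext => x; ring.
by move=> ->; apply/funext => x; ring.
Qed.

Lemma min_semigroup_ldist t f g : 0 <= t -> wl2 mu f -> wl2 mu g ->
  ldist (P t f) (P t g) <= ldist f g.
Proof.
move=> t0 sf sg; rewrite /ldist -min_semigroupB//.
by apply: min_semigroup_norm => //; exact: (wl2B mu0).
Qed.

Lemma min_semigroup0 f : wl2 mu f -> P 0 f = f.
Proof.
move=> sf; apply/funext => x; apply: cvg_lim => //.
rewrite /approx /steps (_ : (fun n => _) = fun=> f x); first exact: cvg_cst.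
by apply/funext => n; rewrite mul0r truncn0.
Qed.

(** Truncated step numbers add up to within one step, and one extra resolvent step tends to the
    identity as the mesh shrinks. *)
Lemma min_semigroupD s t f : 0 <= s -> 0 <= t -> wl2 mu f ->
  P (s + t) f = P s (P t f).
Proof.
move=> s0 t0 sf; have st0 : 0 <= s + t by exact: addr_ge0.
have [sst _ cst] := min_semigroup_cvg st0 sf.
have [st _ ct] := min_semigroup_cvg t0 sf.
have [ss _ cs] := min_semigroup_cvg s0 st.
apply: ldist_eq0 => //.
apply: (@le0_of_cvg0 _ _ (fun n => ldist (approx n (s + t) f) (P (s + t) f) +
  ldist (J (mesh n) f) f + ldist (approx n t f) (P t f) +
  ldist (approx n s (P t f)) (P s (P t f)))); last first.
  rewrite -[X in _ --> X](_ : 0 + 0 + 0 + 0 = 0); last by rewrite !addr0.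
  refine (cvgD (cvgD (cvgD cst _) ct) cs).
  apply/cvgr0Pnorm_le => e e0; have [d d0 hd] := resolvent_small sf e0.
  have /cvgr0Pnorm_le /(_ _ d0) := mesh_cvg0; apply: filterS => n.
  rewrite gtr0_norm ?mesh_gt0// ger0_norm ?ldist_ge0// => nd.
  by apply: hd; rewrite mesh_gt0.
move=> n; have m0 := mesh_gt0 n.
have a1 := approx_ell2 n (s + t) sf; have a2 := approx_ell2 n t sf.
have a3 := approx_ell2 n s a2; have a4 := approx_ell2 n s st.
have sJ := resolvent_ell2 m0 sf.
have H : ldist (approx n (s + t) f) (approx n s (approx n t f)) <= ldist (J (mesh n) f) f.
  rewrite /approx -iterD; case: (stepsD n s0 t0) => ->.
    by rewrite ldistxx ldist_ge0.
  by rewrite iterSr; exact: iter_ldist.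
have := approx_ldist n s a2 st.
have := ldist_triangle sst a1 ss; have := ldist_triangle a1 a3 ss.
have := ldist_triangle a3 a4 ss.
by rewrite (ldistC (P (s + t) f) (approx n (s + t) f)); abstract_norms; lra.
Qed.

Lemma min_semigroup_uniform f e : wl2 mu f -> 0 < e -> exists2 d, 0 < d &
  forall t, 0 <= t <= d -> ldist (P t f) f <= e.
Proof.
move=> sf e0; have [d d0 hd] := iter_uniform sf e0.
exists d => // t /andP[t0 td]; have [sP cP _] := min_semigroup_cvg t0 sf.
have [] // := @wnorm_fatou _ _ _ mu0 _ \oo _
  (fun n x => approx n t f x - f x) (fun x => P t f x - f x) e.
- exact: ltW.
- by move=> x; apply: cvgB; [exact: cP|exact: cvg_cst].
- apply: nearW => n; split; first by apply: (wl2B mu0) => //; exact: approx_ell2.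
  apply: hd; first exact: mesh_gt0.
  by apply: le_trans td; have [] := steps_bounds n t0.
Qed.

Lemma min_semigroup_expansion f g e : form_operator G f g -> 0 < e ->
  exists2 d, 0 < d & forall t, 0 <= t <= d ->
    N (fun x => P t f x - f x + t * g x) <= t * e.
Proof.
move=> Lf e0; have [sf sg] := form_operator_ell2 Lf.
have [d d0 hd] := iter_uniform sg e0.
exists d => // t /andP[t0 td]; have [sP cP _] := min_semigroup_cvg t0 sf.
have cm : (steps n t)%:R * mesh n @[n --> \oo] --> t.
  apply: cvg_dist_le0 mesh_cvg0; apply: nearW => n.
  have [b1 b2] := steps_bounds n t0; rewrite ger0_norm; lra.
have [] // := @wnorm_fatou _ _ _ mu0 _ \oo _
  (fun n x => approx n t f x - f x + (steps n t)%:R * mesh n * g x)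
  (fun x => P t f x - f x + t * g x) (t * e).
- by rewrite mulr_ge0// ltW.
- move=> x; apply: cvgD; first by apply: cvgB; [exact: cP|exact: cvg_cst].
  by apply: cvgM => //; exact: cvg_cst.
- apply: nearW => n; have m0 := mesh_gt0 n; split.
    apply: wl2D; [exact: mu0| |exact: wl2Z].
    by apply: (wl2B mu0) => //; exact: approx_ell2.
  have [b1 _] := steps_bounds n t0.
  apply: le_trans (_ : (steps n t)%:R * mesh n * e <= _); last first.
    by rewrite ler_wpM2r// ltW.
  apply: iter_expansion => // i it; apply: hd => //.
  apply: le_trans (le_trans _ b1) td.
  by rewrite ler_wpM2r ?ler_nat// ltW.
Qed.

Lemma min_semigroup_C0 : C0_semigroup G P.
Proof.
split.
- move=> t t0; split.
  + by move=> f /ell2E sf; apply/ell2E; exact: min_semigroup_ell2.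
  + by move=> a f g /ell2E sf /ell2E sg; exact: min_semigroup_linear.
  + by exists 1 => f /ell2E sf; rewrite mul1r; exact: min_semigroup_norm.
- by move=> f /ell2E; exact: min_semigroup0.
- by move=> s t f s0 t0 /ell2E; exact: min_semigroupD.
- move=> f /ell2E sf; apply/cvg_at_right0P => e e0.
  have [d d0 hd] := min_semigroup_uniform sf e0; exists d => // t /andP[t0 td].
  rewrite ger0_norm; last exact: sqrtr_ge0.
  by apply: hd; rewrite (ltW t0).
Qed.

Lemma form_operator_generator f g : form_operator G f g -> generator G P f (\- g).
Proof.
move=> Lf; have [sf sg] := form_operator_ell2 Lf.
split; [exact/ell2E|by apply/ell2E; exact: wl2N|].
apply/cvg_at_right0P => e e0; have [d d0 hd] := min_semigroup_expansion Lf e0.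
exists d => // t /andP[t0 td]; rewrite ger0_norm; last exact: sqrtr_ge0.
have t0' := ltW t0; have sP := min_semigroup_ell2 t0' sf.
have s1 : wl2 mu (fun x => P t f x - f x + t * g x).
  by apply: wl2D; [exact: mu0|exact: (wl2B mu0)|exact: wl2Z].
have := hd t; rewrite t0' td => /(_ isT) H.
rewrite -[ell2_norm G _]/(N _) (_ : (fun x => _) = fun x => t^-1 *
  (P t f x - f x + t * g x)); last first.
  by apply/funext => x /=; field; rewrite gt_eqF.
by rewrite wnormZ; [rewrite gtr0_norm ?invr_gt0// mulrC ler_pdivrMr// mulrC|exact: mu0|].
Qed.

Lemma generator_dissipative f g : generator G P f g -> wdot mu f g <= 0.
Proof.
move=> [/ell2E sf /ell2E sg /cvg_at_right0P H].
rewrite leNgt; apply/negP => fg.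
have n0 : 0 < 1 + N f by rewrite ltr_wpDr// wnorm_ge0.
have e0 : 0 < wdot mu f g / 2 / (1 + N f) by rewrite !divr_gt0.
have [d d0 /(_ d)] := H _ e0; rewrite d0 lexx => /(_ isT).
rewrite ger0_norm; last exact: sqrtr_ge0.
rewrite -[ell2_norm G _]/(N _) ler_pdivlMr// => hd.
have d0' := ltW d0; have sP := min_semigroup_ell2 d0' sf.
have sd := wl2B mu0 sP sf.
have sc := wl2Z d^-1 sd; have sB := wl2B mu0 sc sg.
have := wnorm_CS mu0 sB sf; rewrite ler_norml => /andP[+ _].
rewrite (wdotBl mu0)// (wdotZl mu0)// (wdotBl mu0)// (wdotC mu g f) => H1.
have : wdot mu (P d f) f - wdot mu f f <= 0.
  rewrite subr_le0; apply: le_trans (ler_norm _) _.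
  apply: le_trans (wnorm_CS mu0 sP sf) _.
  rewrite -(wnorm_sqr mu0) expr2 ler_wpM2r ?wnorm_ge0//.
  exact: min_semigroup_norm.
have di : 0 < d^-1 by rewrite invr_gt0.
move=> H2; have : d^-1 * (wdot mu (P d f) f - wdot mu f f) <= 0 by rewrite pmulr_rle0.
move: H1 hd (wnorm_ge0 mu f); set A := d^-1 * _; set B := N _; set C := N f.
have := wnorm_ge0 mu (fun i => d^-1 * (P d f i - f i) - g i); rewrite -/B; nra.
Qed.

(** Maximality of [L]. If the generator sends [f] to [- g], put [u = J 1 (f + g)], so that
    [u + L u = f + g]. The generator then fixes [f - u], and dissipativity forces [f = u]. *)
Lemma generator_form_operator f g : generator G P f (\- g) -> form_operator G f g.
Proof.
move=> Af; have [/ell2E sf /ell2E sg' cf] := Af.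
have sg : wl2 mu g by move: (wl2N sg'); apply: wl2_le; [exact: mu0|]
  => x /=; rewrite opprK.
have sfg := wl2D mu0 sf sg.
have L := resolventP ltr01 sfg; set u := J 1 _ in L.
have su := resolvent_ell2 ltr01 sfg; rewrite -/u in su.
have [_ _ cu] := form_operator_generator L.
have Ad : generator G P (fun x => f x - u x) (fun x => f x - u x).
  have sd := wl2B mu0 sf su.
  split; [exact/ell2E|exact/ell2E|].
  apply/cvg_at_right0P => e e0; have e2 : 0 < e / 2 by rewrite divr_gt0.
  move/cvg_at_right0P : cf => /(_ _ e2)[d1 d10 h1].
  move/cvg_at_right0P : cu => /(_ _ e2)[d2 d20 h2].
  exists (Num.min d1 d2); first by rewrite lt_min d10.
  move=> t /andP[t0]; rewrite le_min => /andP[t1 t2].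
  have {h1} := h1 t; rewrite t0 t1 => /(_ isT).
  have {h2} := h2 t; rewrite t0 t2 => /(_ isT).
  rewrite !ger0_norm; try exact: sqrtr_ge0.
  rewrite -![ell2_norm G _]/(N _) => h2 h1.
  have t0' := ltW t0; have sPf := min_semigroup_ell2 t0' sf.
  have sPu := min_semigroup_ell2 t0' su.
  rewrite min_semigroupB//.
  have s1 : wl2 mu (fun x => t^-1 * (P t f x - f x) - (\- g) x).
    by apply: (wl2B mu0) => //; apply: wl2Z; exact: (wl2B mu0).
  have s2 : wl2 mu (fun x => t^-1 * (P t u x - u x) -
      (\- (fun y => 1^-1 * (f y + g y - u y))) x).
    apply: (wl2B mu0); first by apply: wl2Z; exact: (wl2B mu0).
    by apply: wl2N; apply: wl2Z; exact: (wl2B mu0).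
  rewrite [X in N X](_ : _ = fun x => (t^-1 * (P t f x - f x) - (\- g) x) -
    (t^-1 * (P t u x - u x) - (\- (fun y => 1^-1 * (f y + g y - u y))) x)).
    apply: le_trans (wnormB mu0 s1 s2) _; rewrite (splitr e); exact: lerD.
  by apply/funext => x /=; rewrite invr1; ring.
have := generator_dissipative Ad; rewrite -(wnorm_sqr mu0) => H.
have {}H : ldist f u <= 0.
  rewrite -[leLHS](ger0_norm (ldist_ge0 f u)) -sqrtr_sqr.
  by rewrite ler0_sqrtr.
have E := ldist_eq0 sf su H.
move: L; rewrite -E; congr form_operator; apply/funext => x.
by rewrite invr1 mul1r addrC addKr.
Qed.

End semigroup_construction.

(** For each slope [e > 0] the set where f t <= f a + e (t - a) has a supremum, which continuity
    keeps in the set and right growth pushes up to [b]. The hypotheses are one-sided because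
    semigroup orbits come with right derivatives and norms have corners. *)
Lemma dini_nonincreasing (R : realType) (f : R -> R) (a b : R) : a <= b ->
  (forall t, a <= t <= b -> forall e, 0 < e -> exists2 d, 0 < d &
     forall s, a <= s <= b -> `|s - t| < d -> `|f s - f t| <= e) ->
  (forall t, a <= t < b -> forall e, 0 < e -> exists2 d, 0 < d &
     forall s, t < s <= b -> s < t + d -> f s <= f t + e * (s - t)) ->
  f b <= f a.
Proof.
move=> ab fc fd; apply/ler_addgt0Pr => e0 e00.
have [E|ab'] := eqVneq a b; first by rewrite E lerDl ltW.
have {}ab' : a < b by rewrite lt_neqAle ab'.
pose e := e0 / (b - a); have e_gt0 : 0 < e by rewrite divr_gt0// subr_gt0.
pose S := [set t | a <= t <= b /\ f t <= f a + e * (t - a)].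
have Sa : S a by split; [rewrite lexx ab|rewrite subrr mulr0 addr0].
have hS : has_sup S by split; [exists a|exists b => t [/andP[]]].
set c := sup S.
have ac : a <= c by apply: sup_upper_bound => //.
have cb : c <= b by apply: ge_sup => //; [exists a|move=> t [/andP[]]].
have Sc : f c <= f a + e * (c - a).
  apply/ler_addgt0Pr => e1 e10; have e2 : 0 < e1 / 2 by rewrite divr_gt0.
  have [|d d0 hd] := fc c _ _ e2; first by rewrite ac cb.
  have [t [/andP[at_ tb] St] ct] := sup_adherent d0 hS.
  have tc : t <= c by apply: sup_upper_bound => //; split; rewrite ?at_.
  have td : `|t - c| < d.
    by rewrite distrC ger0_norm ?subr_ge0//; move: ct; rewrite -/c; lra.
  have := hd t; rewrite at_ tb => /(_ isT td) H.
  move: H; rewrite ler_distl => /andP[H _].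
  have : e * (t - a) <= e * (c - a) by rewrite ler_pM2l// lerB.
  by move: St H; lra.
have [cE|cnb] := eqVneq c b.
  by move: Sc; rewrite cE /e divfK// subr_eq0 gt_eqF.
have {}cb' : c < b by rewrite lt_neqAle cnb.
have [|d d0 hd] := fd c _ _ e_gt0; first by rewrite ac.
pose s := Num.min b (c + d / 2).
have cs : c < s by rewrite lt_min cb' ltrDl divr_gt0.
have sb : s <= b by rewrite ge_min lexx.
have sd : s < c + d by rewrite gt_min ltrD2l ltr_pdivrMr// ltr_pMr// ltr1n orbT.
have Ss : S s.
  split; first by rewrite sb (le_trans ac (ltW cs)).
  have := hd s; rewrite cs sb => /(_ isT sd); move: Sc; lra.
have : s <= c by apply: sup_upper_bound.
by rewrite leNgt cs.
Qed.

(** * C0-semigroups with generator [- L], without assuming contractivity *)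

Section semigroup_uniqueness.
Variables (R : realType) (X : countType) (G : graph R X).
Local Notation mu := (vmeas G).
Local Notation mu0 := (mu_ge0 G).
Local Notation N := (wnorm mu).
Local Notation ld := (ldist G).
Implicit Types (f g k : X -> R) (h e t s : R).

(** A vector of the unit ball at which the operator norm is attained up to the factor 2/3 stands in
    for the norm itself. If the supremum vanishes, the zero vector serves. *)
Lemma near_norming (T : (X -> R) -> X -> R) (C : R) :
  (forall a f g, wl2 mu f -> wl2 mu g ->
    T (fun x => a * f x + g x) = (fun x => a * T f x + T g x)) ->
  (forall f, wl2 mu f -> N (T f) <= C * N f) -> (forall f, wl2 mu f -> wl2 mu (T f)) ->
  exists2 xi, wl2 mu xi /\ N xi <= 1 &
    forall f, wl2 mu f -> N (T f) <= 3 / 2 * N (T xi) * N f.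
Proof.
move=> Tl Tb Ts.
pose S := [set r | exists f, [/\ wl2 mu f, N f <= 1 & r = N (T f)]].
have S0 : S (N (T (fun=> 0))).
  by exists (fun=> 0); split; [exact: wl20|rewrite wnorm0|].
have hS : has_sup S.
  split; first by eexists; exact: S0.
  exists `|C| => _ [f [sf f1 ->]]; apply: le_trans (Tb f sf) _.
  apply: le_trans (ler_wpM2r (wnorm_ge0 _ _) (ler_norm C)) _.
  by rewrite ler_piMr.
set A := sup S.
have A0 : 0 <= A by apply: le_trans (sup_upper_bound hS S0); exact: wnorm_ge0.
have TA f : wl2 mu f -> N (T f) <= A * N f.
  move=> sf; have [n0|n0] := eqVneq (N f) 0.
    by rewrite n0 mulr0; apply: le_trans (Tb f sf) _; rewrite n0 mulr0.
  have np : 0 < N f by rewrite lt_def n0 wnorm_ge0.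
  have sfn := wl2Z (N f)^-1 sf.
  have := Tl (N f)^-1 f (fun=> 0) sf (wl20 mu).
  have := Tl (- 1) f f sf sf.
  rewrite (_ : (fun x => _) = fun=> 0); last by apply/funext => x; ring.
  move=> ->.
  rewrite (_ : (fun x => _ * f x + 0) = fun x => (N f)^-1 * f x); last first.
    by apply/funext => x; rewrite addr0.
  rewrite [RHS in _ = RHS -> _](_ : _ = fun x => (N f)^-1 * T f x); last first.
    by apply/funext => x; ring.
  move=> E; rewrite -ler_pdivrMr// mulrC.
  apply: sup_upper_bound => //; exists (fun x => (N f)^-1 * f x); split => //.
    by rewrite wnormZ//; [rewrite gtr0_norm ?invr_gt0// mulVf|exact: mu0].
  by rewrite E wnormZ; [rewrite gtr0_norm ?invr_gt0|exact: mu0|exact: Ts].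
have [A00|Ap] := leP A 0.
  exists (fun=> 0); first by split; [exact: wl20|rewrite wnorm0].
  move=> f sf; apply: le_trans (TA f sf) _.
  apply: (@le_trans _ _ 0); first by rewrite mulr_le0_ge0 ?wnorm_ge0.
  by rewrite !mulr_ge0 ?wnorm_ge0.
have A3 : 0 < A / 3 by rewrite divr_gt0.
have [_ [xi [sx x1 ->]] hx] := sup_adherent A3 hS.
exists xi => // f sf; apply: le_trans (TA f sf) _.
rewrite ler_wpM2r ?wnorm_ge0//; rewrite -/A in hx; lra.
Qed.

Lemma ell2_wl2 f : ell2 G f -> wl2 mu f.
Proof. exact: (proj1 (ell2E G f)). Qed.

Lemma wl2_ell2 f : wl2 mu f -> ell2 G f.
Proof. exact: (proj2 (ell2E G f)). Qed.

Variable P : R -> (X -> R) -> X -> R.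
Hypothesis CP : C0_semigroup G P.

Lemma C0_ell2 t f : 0 <= t -> wl2 mu f -> wl2 mu (P t f).
Proof.
move=> t0 sf; have [H _ _ _] := CP; have [h _ _] := H t t0.
exact/ell2_wl2/h/wl2_ell2.
Qed.

Lemma C0_linear t a f g : 0 <= t -> wl2 mu f -> wl2 mu g ->
  P t (fun x => a * f x + g x) = (fun x => a * P t f x + P t g x).
Proof.
move=> t0 sf sg; have [H _ _ _] := CP; have [_ h _] := H t t0.
by apply: h; exact: wl2_ell2.
Qed.

Lemma C0_sub t f g : 0 <= t -> wl2 mu f -> wl2 mu g ->
  P t (fun x => f x - g x) = (fun x => P t f x - P t g x).
Proof.
move=> t0 sf sg; have := C0_linear (-1) t0 sg sf.
rewrite (_ : (fun x => _) = fun x => f x - g x); last by apply/funext => x; ring.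
by move=> ->; apply/funext => x; ring.
Qed.

Lemma C0_bounded t : 0 <= t -> exists C, forall f, wl2 mu f -> N (P t f) <= C * N f.
Proof.
move=> t0; have [H _ _ _] := CP; have [_ _ [C hC]] := H t t0.
by exists C => f sf; exact/hC/wl2_ell2.
Qed.

Lemma C0_at0 f e : wl2 mu f -> 0 < e -> exists2 d, 0 < d &
  forall t, 0 <= t <= d -> ld (P t f) f <= e.
Proof.
move=> sf e0; have [_ P0 _ H] := CP; have sf' := wl2_ell2 sf.
have /cvg_at_right0P /(_ _ e0) [d d0 hd] := H f sf'.
exists d => // t /andP[]; rewrite le_eqVlt => /predU1P[<- _|t0 td].
  by rewrite P0// ldistxx ltW.
have := hd t; rewrite t0 td => /(_ isT).
by rewrite ger0_norm//; exact: sqrtr_ge0.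
Qed.

(* Uniform boundedness principle near 0, by Sokal's gliding-hump argument. *)
Lemma C0_locally_bounded : exists d C, [/\ 0 < d, 0 <= C &
  forall t f, 0 <= t <= d -> wl2 mu f -> N (P t f) <= C * N f].
Proof.
apply: contrapT => unb.
have bad (n : nat) : exists t, 0 <= t <= n.+1%:R^-1 /\
    exists f, wl2 mu f /\ 4 ^+ n * N f < N (P t f).
  apply: contrapT => ok; apply: unb.
  exists n.+1%:R^-1, (4 ^+ n); split; [by rewrite invr_gt0|exact: exprn_ge0|].
  move=> t f ht sf; rewrite leNgt; apply/negP => h.
  by apply: ok; exists t; split => //; exists f.
have [t_ ht] := choice bad.
have t0 n : 0 <= t_ n by have [/andP[]] := ht n.
have norming n : exists xi, [/\ wl2 mu xi, N xi <= 1,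
    forall f, wl2 mu f -> N (P (t_ n) f) <= 3 / 2 * N (P (t_ n) xi) * N f &
    2 / 3 * 4 ^+ n <= N (P (t_ n) xi)].
  have [C hC] := C0_bounded (t0 n).
  have [xi [sx x1] hx] := near_norming (fun a f g => @C0_linear (t_ n) a f g (t0 n)) hC
    (fun f => @C0_ell2 (t_ n) f (t0 n)).
  exists xi; split => //; have [_ [f [sf hf]]] := ht n.
  have := hx f sf; have := wnorm_ge0 mu f; have := wnorm_ge0 mu (P (t_ n) xi).
  move: hf; move: (N f) (N (P (t_ n) f)) (N (P (t_ n) xi)) => a b c h1 c0 a0 h2.
  have {}h1 : 4 ^+ n * a < 3 / 2 * c * a by exact: lt_le_trans h1 h2.
  have ap : 0 < a.
    by rewrite lt_def a0 andbT; apply/eqP => az; move: h1; rewrite az !mulr0 ltxx.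
  by move: h1; rewrite ltr_pM2r// => h1; lra.
have [xi hxi] := choice norming.
(* Step lengths 3^-n are played against norms of order 4^n. All later steps together amount to at
   most half of step [n], hence change its image by at most 3/4 of the guaranteed size, and
   [(4 / 3)^n / 6] remains. *)
pose c n : R := 3^-1 ^+ n.
have c0 n : 0 < c n by rewrite exprn_gt0// invr_gt0.
pose up n (u : X -> R) := fun x => u x + c n * xi n x.
pose dn n (u : X -> R) := fun x => u x - c n * xi n x.
(* The images of [u + c xi] and [u - c xi] differ by [2 c P xi], so one of them has norm at least
   [c N (P xi)]. *)
pose step n u := if c n * N (P (t_ n) (xi n)) <= N (P (t_ n) (up n u))
  then up n u else dn n u.
pose fix x n : X -> R := if n is n'.+1 then step n' (x n') else fun=> 0.
have sxi n : wl2 mu (xi n) by have [] := hxi n.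
have scx n : wl2 mu (fun y => c n * xi n y) by exact: wl2Z.
have step_ell2 n u : wl2 mu u -> wl2 mu (step n u).
  move=> su; rewrite /step; case: ifP => _; first exact: (wl2D mu0).
  exact: (wl2B mu0).
have sx n : wl2 mu (x n).
  by elim: n => [|n ih]; [exact: wl20|exact: step_ell2].
have step_ld n u : wl2 mu u -> ld (step n u) u <= c n.
  move=> su; have [_ x1 _ _] := hxi n.
  have nc : N (fun y => c n * xi n y) <= c n.
    by rewrite wnormZ//; [rewrite gtr0_norm// ler_piMr// ltW|exact: mu0].
  rewrite /step; case: ifP => _; rewrite /ldist.
    rewrite (_ : (fun y => _) = fun y => c n * xi n y)//.
    by apply/funext => y; rewrite /up; ring.
  rewrite (_ : (fun y => _) = fun y => - (c n * xi n y)) ?wnormN//.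
  by apply/funext => y; rewrite /dn; ring.
have step_big n u : wl2 mu u -> c n * N (P (t_ n) (xi n)) <= N (P (t_ n) (step n u)).
  move=> su; rewrite /step; case: ifPn => //; rewrite -ltNge => small.
  have su' : wl2 mu (up n u) by exact: (wl2D mu0).
  have sd : wl2 mu (dn n u) by exact: (wl2B mu0).
  have E : (fun y => 2 * c n * P (t_ n) (xi n) y) =
      (fun y => P (t_ n) (up n u) y - P (t_ n) (dn n u) y).
    rewrite -C0_sub// (_ : (fun y => up n u y - _) = fun y => 2 * c n * xi n y + 0).
      rewrite C0_linear//; last exact: wl20.
      have -> : P (t_ n) (fun=> 0) = fun=> 0.
        have := C0_linear (-1) (t0 n) (sxi n) (sxi n).
        rewrite (_ : (fun y => _) = fun=> 0); last by apply/funext => y; ring.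
        by move=> ->; apply/funext => y; ring.
      by apply/funext => y; rewrite addr0.
    by apply/funext => y; rewrite /up /dn; ring.
  have := congr1 N E; rewrite wnormZ; [|exact: mu0|exact: C0_ell2].
  have c2 : 0 < 2 * c n by rewrite mulr_gt0.
  rewrite gtr0_norm// => {}E.
  have := wnormB mu0 (C0_ell2 (t0 n) su') (C0_ell2 (t0 n) sd).
  rewrite -E; move: small.
  move: (N (P (t_ n) (xi n))) (N (P (t_ n) (up n u))) (N (P (t_ n) (dn n u))).
  by move=> p q r; lra.
have xld n m : (n <= m)%N -> ld (x m) (x n) <= 3 / 2 * (c n - c m).
  elim: m => [|m ih]; first by rewrite leqn0 => /eqP ->; rewrite ldistxx subrr mulr0.
  rewrite leq_eqVlt => /predU1P[->|]; first by rewrite ldistxx subrr mulr0.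
  rewrite ltnS => /ih {}ih.
  apply: le_trans (ldist_triangle (sx m.+1) (sx m) (sx n)) _.
  have := step_ld m (x m) (sx m); rewrite -[step m (x m)]/(x m.+1).
  have -> : c m.+1 = c m / 3 by rewrite /c exprSr.
  move: ih; move: (ld (x m) (x n)) (ld (x m.+1) (x m)) => p q; lra.
have c_cvg : c n @[n --> \oo] --> (0 : R).
  by apply: cvg_expr; rewrite gtr0_norm ?invr_gt0// invf_lt1// ltr1n.
have [e e0|y [sy _ xy]] := wnorm_complete (vmeas_gt0 G) sx.
  have e2 : 0 < e / 2 by rewrite divr_gt0.
  have /cvgr0Pnorm_le /(_ _ e2) [K _ hK] := c_cvg.
  have key p q : (K <= p)%N -> (p <= q)%N -> ld (x q) (x p) <= e.
    move=> Kp pq; have := xld p q pq; have := hK p Kp; rewrite gtr0_norm//.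
    have := c0 q; move: (ld _ _) => r; lra.
  exists K => p q Kp Kq; case/orP: (leq_total p q) => pq; last exact: key.
  by rewrite -/(ld (x p) (x q)) ldistC; exact: key.
have yld n : ld y (x n) <= 3 / 2 * c n.
  have H m : (n <= m)%N -> ld y (x n) - 3 / 2 * c n <= ld (x m) y.
    move=> nm; have := ldist_triangle sy (sx m) (sx n).
    have := xld n m nm; have := c0 m; rewrite (ldistC G (x m) y).
    move: (ld y (x m)) (ld (x m) (x n)) (ld y (x n)) => p q r; lra.
  rewrite -subr_le0; apply: cvgr_to_ge xy _; exists n => // m /=; exact: H.
have big n : 6^-1 * (4 / 3) ^+ n <= N (P (t_ n) y).
  have [_ _ hb hl] := hxi n.
  have h1 := step_big n (x n) (sx n); rewrite -[step n (x n)]/(x n.+1) in h1.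
  have h2 := hb _ (wl2B mu0 (sx n.+1) sy); rewrite C0_sub// in h2.
  have h3 := wnorm_ldist (C0_ell2 (t0 n) (sx n.+1)) (C0_ell2 (t0 n) sy).
  have h4 := yld n.+1; rewrite ldistC in h4.
  rewrite -/(ld (x n.+1) y) -/(ld (P (t_ n) (x n.+1)) _) in h2.
  have cS : c n.+1 = c n / 3 by rewrite /c exprSr.
  rewrite cS in h4.
  have E : (4 / 3) ^+ n = 4 ^+ n * c n by rewrite exprMn.
  have f4 : 0 <= 4 ^+ n :> R by rewrite exprn_ge0.
  rewrite E; have := c0 n; move: h1 h2 h3 h4 hl.
  move: f4.
  move: (N (P (t_ n) (xi n))) (N (P (t_ n) (x n.+1))) (N (P (t_ n) y)).
  move: (ld (x n.+1) y) (ld (P (t_ n) (x n.+1)) (P (t_ n) y)) (c n) (4 ^+ n).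
  move=> a b cn fn p q r fn0 h1 h2 h3 h4 h5 cn0.
  have p0 : 0 <= p by lra.
  have : p * a <= p * (cn / 2) by rewrite ler_wpM2l//; lra.
  have : fn * cn <= 3 / 2 * p * cn by rewrite ler_wpM2r ?(ltW cn0)//; lra.
  lra.
have [d d0 hd] := C0_at0 sy ltr01.
have grow n : n%:R / 3 <= (4 / 3) ^+ n :> R.
  elim: n => [|n ih]; first by rewrite mul0r expr0 ler01.
  have : 1 <= (4 / 3) ^+ n :> R by rewrite exprn_ege1//; lra.
  by rewrite exprS -(natr1 n); move: ih; move: (_ ^+ n) => q; lra.
have Ny0 : 0 <= 18 * (N y + 1) by rewrite mulr_ge0// addr_ge0// wnorm_ge0.
have di : 0 <= d^-1 by rewrite invr_ge0 ltW.
(* The first bound makes [(4 / 3)^n / 6 >= n / 18] exceed [N y + 1]; the second makes [t_ n] so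
   small that the image of [y] has norm at most [N y + 1]. *)
pose n := maxn (Num.bound (18 * (N y + 1))) (Num.bound d^-1).
have n1 : 18 * (N y + 1) < n%:R.
  by apply: lt_le_trans (archi_boundP Ny0) _; rewrite ler_nat leq_maxl.
have n2 : d^-1 < n.+1%:R.
  by apply: lt_le_trans (archi_boundP di) _; rewrite ler_nat leqW// leq_maxr.
have tn : 0 <= t_ n <= d.
  rewrite t0 /=; have [/andP[_ h] _] := ht n; apply: le_trans h _.
  by rewrite -[d]invrK lef_pV2 ?posrE ?invr_gt0// ltW.
have h1 := hd _ tn; have h2 := wnorm_ldist (C0_ell2 (t0 n) sy) sy.
have h3 := big n; have h4 := grow n.
move: h1 h2 h3 h4 n1; move: (ld _ _) (N y) (N _) (_ ^+ n) (n%:R) => a b p q r.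
by move=> *; lra.
Qed.

Hypothesis AP : forall f g, generator G P f (\- g) <-> form_operator G f g.

(** [P t] is bounded and commutes with the difference quotients at 0, so it carries the limit
    defining the generator at [f] to the one at [P t f]. *)
Lemma C0_domain f g t : 0 <= t -> form_operator G f g ->
  form_operator G (P t f) (P t g).
Proof.
move=> t0 Lf; apply/AP; have [sf' sg' H] := proj2 (AP f g) Lf.
have sf := ell2_wl2 sf'; have sg : wl2 mu g by case: (form_operator_ell2 Lf).
split; [exact/wl2_ell2/C0_ell2|exact/wl2_ell2/wl2N/C0_ell2|].
apply/cvg_at_right0P => e e0; have [C hC] := C0_bounded t0.
have [K K0 CK] : exists2 K, 0 <= K & C <= K by exists `|C|; rewrite ?ler_norm.
have c1 : 0 < 1 + K by rewrite ltr_wpDr.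
have e1 : 0 < e / (1 + K) by rewrite divr_gt0.
move/cvg_at_right0P : H => /(_ _ e1)[d d0 hd]; exists d => // s /andP[s0 sd].
have s0' := ltW s0.
have := hd s; rewrite s0 sd => /(_ isT).
rewrite !ger0_norm; try exact: sqrtr_ge0.
have sPs := C0_ell2 s0' sf; have s1 := wl2B mu0 sPs sf.
have s2 : wl2 mu (fun x => s^-1 * (P s f x - f x) - (\- g) x).
  by apply: (wl2B mu0); [exact: wl2Z|exact: wl2N].
have E : (fun x => s^-1 * (P s (P t f) x - P t f x) - (\- P t g) x) =
    P t (fun x => s^-1 * (P s f x - f x) - (\- g) x).
  rewrite (_ : (fun x => s^-1 * (P s f x - f x) - (\- g) x) =
    fun x => s^-1 * (P s f x - f x) + g x); last by apply/funext => x /=; rewrite opprK.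
  rewrite C0_linear// C0_sub//.
  have [_ _ PD _] := CP; have sf2 := wl2_ell2 sf.
  rewrite -(PD s t f s0' t0 sf2) -(PD t s f t0 s0' sf2) addrC.
  by apply/funext => x /=; rewrite opprK.
rewrite E -/(N _) => h1; apply: le_trans (hC _ s2) _.
rewrite ler_pdivlMr// in h1.
apply: le_trans h1; rewrite [leLHS]mulrC ler_wpM2l ?wnorm_ge0//.
by apply: le_trans CK _; rewrite lerDr.
Qed.

Lemma C0_right_derivative f g t e : 0 <= t -> form_operator G f g -> 0 < e ->
  exists2 d, 0 < d & forall s, 0 < s <= d ->
    N (fun x => s^-1 * (P (t + s) f x - P t f x) + P t g x) <= e.
Proof.
move=> t0 Lf e0; have [_ _ /cvg_at_right0P H] := proj2 (AP _ _) (C0_domain t0 Lf).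
have [d d0 hd] := H _ e0; exists d => // s /andP[s0 sd].
have := hd s; rewrite s0 sd => /(_ isT).
rewrite ger0_norm; last exact: sqrtr_ge0.
have [_ _ PD _] := CP; have [sf _] := form_operator_ell2 Lf.
rewrite addrC PD//; [|exact: ltW|exact: wl2_ell2].
suff -> : (fun x => s^-1 * (P s (P t f) x - P t f x) + P t g x) =
  (fun x => s^-1 * (P s (P t f) x - P t f x) - (\- P t g) x) by [].
by apply/funext => x /=; rewrite opprK.
Qed.

Lemma C0_orbit_dist d C f r s : 0 <= r <= d -> r <= s ->
  (forall t u, 0 <= t <= d -> wl2 mu u -> N (P t u) <= C * N u) -> wl2 mu f ->
  ld (P s f) (P r f) <= C * ld (P (s - r) f) f.
Proof.
move=> rd rs hC sf; have [_ _ PD _] := CP.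
have [r0 _] := andP rd; have sr0 : 0 <= s - r by rewrite subr_ge0.
rewrite -{1}(subrKC r s) PD//; last exact: wl2_ell2.
have sP := C0_ell2 sr0 sf.
by rewrite /ldist -C0_sub//; apply: hC => //; exact: (wl2B mu0).
Qed.

End semigroup_uniqueness.

(** * Identification of [heat] with the constructed semigroup *)

Section heat.
Variables (R : realType) (X : countType) (G : graph R X).
Local Notation mu := (vmeas G).
Local Notation mu0 := (mu_ge0 G).
Local Notation N := (wnorm mu).
Local Notation ld := (ldist G).
Local Notation Q := (min_semigroup G).
Implicit Types (f g : X -> R) (h e t s : R).

Lemma min_semigroup_generator f g : generator G Q f (\- g) <-> form_operator G f g.
Proof. by split; [exact: generator_form_operator|exact: form_operator_generator]. Qed.

Variable P : R -> (X -> R) -> X -> R.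
Hypothesis CP : C0_semigroup G P.
Hypothesis AP : forall f g, generator G P f (\- g) <-> form_operator G f g.

Section small_time.
Variables (d C : R) (f g : X -> R).
Hypotheses (C0 : 0 <= C) (Lf : form_operator G f g).
Hypothesis hC : forall s u, 0 <= s <= d -> wl2 mu u -> N (P s u) <= C * N u.

Let sf : wl2 mu f. Proof. by case: (form_operator_ell2 Lf). Qed.
Let sg : wl2 mu g. Proof. by case: (form_operator_ell2 Lf). Qed.
Let CQ := min_semigroup_C0 G.
Let u s x := P s f x - Q s f x.
Let v s x := P s g x - Q s g x.

Lemma gap_ell2 s : 0 <= s -> wl2 mu (u s) /\ wl2 mu (v s).
Proof.
move=> s0; split; apply: (wl2B mu0).
- exact: (C0_ell2 CP s0 sf).
- exact: (C0_ell2 CQ s0 sf).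
- exact: (C0_ell2 CP s0 sg).
- exact: (C0_ell2 CQ s0 sg).
Qed.

(** [v s] is [L] applied to [u s], since both semigroups preserve the domain of [L] and commute with
    it. This sign makes the squared norm of the gap nonincreasing. *)
Lemma gap_dissipative s : 0 <= s -> 0 <= wdot mu (u s) (v s).
Proof.
move=> s0; apply: (@form_operator_dot_ge0 _ _ G); apply: form_operatorB.
  exact: (C0_domain CP AP).
exact: (C0_domain CQ min_semigroup_generator).
Qed.

Lemma gap_dist r s : 0 <= r <= d -> r <= s ->
  ld (u s) (u r) <= C * ld (P (s - r) f) f + ld (Q (s - r) f) f.
Proof.
move=> rd rs; have [r0 _] := andP rd; have s0 := le_trans r0 rs.
have sr0 : 0 <= s - r by rewrite subr_ge0.
have hQ t w : 0 <= t <= d -> wl2 mu w -> N (Q t w) <= 1 * N w.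
  by move=> /andP[t0 _] sw; rewrite mul1r; exact: min_semigroup_norm.
have h1 := C0_orbit_dist CP rd rs hC sf; have h2 := C0_orbit_dist CQ rd rs hQ sf.
rewrite mul1r in h2.
have s1 := C0_ell2 CP s0 sf; have s2 := C0_ell2 CP r0 sf.
have s3 := C0_ell2 CQ s0 sf; have s4 := C0_ell2 CQ r0 sf.
rewrite /ldist (_ : (fun x => _) =
  fun x => (P s f x - P r f x) - (Q s f x - Q r f x)); last first.
  by apply/funext => x; rewrite /u; ring.
apply: le_trans (wnormB mu0 (wl2B mu0 s1 s2) (wl2B mu0 s3 s4)) _.
exact: lerD.
Qed.

Lemma gap_continuous t : 0 <= t <= d -> forall e, 0 < e -> exists2 a, 0 < a &
  forall s, 0 <= s <= d -> `|s - t| < a ->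
    `|wdot mu (u s) (u s) - wdot mu (u t) (u t)| <= e.
Proof.
move=> td e e0; pose K := (C + 1) * N f.
have K0 : 0 <= K by rewrite mulr_ge0 ?wnorm_ge0// addr_ge0.
have uK s : 0 <= s <= d -> N (u s) <= K.
  move=> sd; have [s0 _] := andP sd.
  apply: le_trans (wnormB mu0 (C0_ell2 CP s0 sf) (C0_ell2 CQ s0 sf)) _.
  rewrite /K mulrDl mul1r; apply: lerD; first exact: hC.
  exact: min_semigroup_norm.
have e1 : 0 < e / (2 * K + 1) / (C + 1).
  by rewrite !divr_gt0// ltr_wpDl// mulr_ge0.
have [a1 a10 h1] := C0_at0 CP sf e1; have [a2 a20 h2] := C0_at0 CQ sf e1.
have key r s : 0 <= r <= d -> 0 <= s <= d -> r <= s -> s - r < Num.min a1 a2 ->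
    `|wdot mu (u s) (u s) - wdot mu (u r) (u r)| <= e.
  move=> rd sd rs; rewrite lt_min => /andP[r1 r2].
  have sr0 : 0 <= s - r by rewrite subr_ge0.
  have := gap_dist rd rs.
  have := h1 (s - r); rewrite sr0 (ltW r1) => /(_ isT) b1.
  have := h2 (s - r); rewrite sr0 (ltW r2) => /(_ isT) b2 b3.
  have {}b3 : ld (u s) (u r) <= e / (2 * K + 1).
    have c1 : 0 < C + 1 by rewrite ltr_wpDl.
    rewrite -[leRHS](divfK (lt0r_neq0 c1)) mulrDr mulr1 mulrC.
    by apply: le_trans b3 (lerD (ler_wpM2l C0 b1) b2).
  have [su _] := gap_ell2 (proj1 (andP sd)); have [sr _] := gap_ell2 (proj1 (andP rd)).
  have E : wdot mu (u s) (u s) - wdot mu (u r) (u r) =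
      wdot mu (fun x => u s x - u r x) (fun x => u s x + u r x).
    rewrite (wdotBl mu0)//; last exact: (wl2D mu0).
    rewrite (wdotDr mu0 su sr su) (wdotDr mu0 su sr sr).
    by rewrite (wdotC mu (u r) (u s)); ring.
  rewrite E; apply: le_trans (wnorm_CS mu0 (wl2B mu0 su sr) (wl2D mu0 su sr)) _.
  have b4 := wnormD mu0 su sr; have b5 := uK _ sd; have b6 := uK _ rd.
  have K1 : 0 < 2 * K + 1 by rewrite ltr_wpDl// mulr_ge0.
  rewrite ler_pdivlMr// in b3.
  apply: le_trans b3; rewrite -/(ld (u s) (u r)) ler_wpM2l ?ldist_ge0//.
  by apply: le_trans b4 _; move: b5 b6; move: (N (u s)) (N (u r)) => *; lra.
exists (Num.min a1 a2); first by rewrite lt_min a10.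
move=> s sd; have [st|ts] := leP s t.
  by rewrite distrC ger0_norm ?subr_ge0// distrC; exact: key.
by rewrite ger0_norm ?subr_ge0 ?(ltW ts)//; apply: key => //; exact: ltW.
Qed.

(** Expanding [u s = u t + h (rho - v t)] gives |u t|^2 - 2 h <u t, v t> + 2 h <u t, rho> + h^2 |rho
    - v t|^2. The second term has the good sign; [e1] makes the third at most [h e / 2], and [a3]
    does so for the fourth. *)
Lemma gap_right_derivative t : 0 <= t < d -> forall e, 0 < e -> exists2 a, 0 < a &
  forall s, t < s <= d -> s < t + a ->
    wdot mu (u s) (u s) <= wdot mu (u t) (u t) + e * (s - t).
Proof.
move=> /andP[t0 td] e e0; have [sut svt] := gap_ell2 t0.
pose A := N (u t); pose B := N (v t).
have A0 : 0 <= A by exact: wnorm_ge0.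
have B0 : 0 <= B by exact: wnorm_ge0.
pose e1 := Num.min 1 (e / (4 * (A + 1))).
have A1 : 0 < 4 * (A + 1) by rewrite mulr_gt0// ltr_wpDl.
have e10 : 0 < e1 by rewrite lt_min ltr01 divr_gt0.
have e12 : 0 < e1 / 2 by rewrite divr_gt0.
have [a1 a10 h1] := C0_right_derivative CP AP t0 Lf e12.
have [a2 a20 h2] := C0_right_derivative CQ min_semigroup_generator t0 Lf e12.
pose a3 := e / (2 * (1 + B) ^+ 2).
have a30 : 0 < a3 by rewrite divr_gt0// mulr_gt0// exprn_gt0// ltr_wpDr.
exists (Num.min a1 (Num.min a2 a3)); first by rewrite !lt_min a10 a20.
move=> s /andP[ts sd]; rewrite -ltrBlDl !lt_min => /and3P[s1 s2 s3].
pose h := s - t; have h0 : 0 < h by rewrite subr_gt0.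
have s0 : 0 <= s by exact: le_trans t0 (ltW ts).
have {h1} := h1 h; rewrite h0 (ltW s1) => /(_ isT).
have {h2} := h2 h; rewrite h0 (ltW s2) => /(_ isT).
rewrite (_ : t + h = s); last by rewrite /h addrC subrK.
set r1 := (fun x => _ + Q t g x); set r2 := (fun x => _ + P t g x) => h2 h1.
have sr1 : wl2 mu r1.
  apply: (wl2D mu0); last exact: min_semigroup_ell2.
  by apply: wl2Z; apply: (wl2B mu0); exact: min_semigroup_ell2.
have sr2 : wl2 mu r2.
  apply: (wl2D mu0); last exact: (C0_ell2 CP).
  by apply: wl2Z; apply: (wl2B mu0); exact: (C0_ell2 CP).
pose rho x := r2 x - r1 x.
have srho : wl2 mu rho by exact: (wl2B mu0).
have nrho : N rho <= e1.
  by apply: le_trans (wnormB mu0 sr2 sr1) _; rewrite (splitr e1) lerD.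
have E : u s = fun x => u t x + h * (rho x - v t x).
  apply/funext => x; rewrite /rho /r1 /r2 /u /v; field.
  by rewrite gt_eqF.
have sw := wl2B mu0 srho svt.
rewrite {1 2}E (wdot_sqrD mu0 _ sut sw) (wdotBr mu0)//.
have D := gap_dissipative t0.
have nw : N (fun x => rho x - v t x) <= 1 + B.
  apply: le_trans (wnormB mu0 srho svt) _; rewrite lerD2r.
  by apply: le_trans nrho _; rewrite ge_min lexx.
rewrite -[wdot mu (fun x => rho x - v t x) _](wnorm_sqr mu0).
have c1 : wdot mu (u t) rho <= e / 4.
  apply: le_trans (ler_norm _) _; apply: le_trans (wnorm_CS mu0 sut srho) _.
  have : N rho <= e / (4 * (A + 1)) by apply: le_trans nrho _; rewrite ge_min lexx orbT.
  rewrite ler_pdivlMr// -/A => H.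
  have : 0 <= N rho by exact: wnorm_ge0.
  by move: H; move: (N rho) => q; nra.
have c2 : h * N (fun x => rho x - v t x) ^+ 2 <= e / 2.
  have B1 : 0 < 2 * (1 + B) ^+ 2 by rewrite mulr_gt0// exprn_gt0// ltr_wpDr.
  have : h <= e / (2 * (1 + B) ^+ 2) by exact: ltW s3.
  rewrite ler_pdivlMr// => H.
  have : N (fun x => rho x - v t x) ^+ 2 <= (1 + B) ^+ 2.
    by rewrite lerXn2r ?nnegrE ?wnorm_ge0// addr_ge0.
  move: H; move: (N _ ^+ 2) ((1 + B) ^+ 2) => p q H1 H2.
  have : h * p <= h * q by rewrite ler_pM2l.
  by move: H1; lra.
rewrite -/h; move: D c1 c2.
move: (wdot mu (u t) (v t)) (wdot mu (u t) rho) (N _ ^+ 2) (wdot mu (u t) (u t)).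
move=> p q r z D c1 c2.
have : 2 * h * (q - p) <= h * (e / 2).
  by rewrite -mulrA mulrCA ler_pM2l//; lra.
have : h ^+ 2 * r <= h * (e / 2) by rewrite expr2 -mulrA ler_pM2l.
lra.
Qed.

Lemma C0_small_time t : 0 <= t <= d -> P t f = Q t f.
Proof.
move=> td; have [t0 td'] := andP td.
have H : wdot mu (u t) (u t) <= wdot mu (u 0) (u 0).
  apply: (@dini_nonincreasing _ (fun s => wdot mu (u s) (u s)) 0 t) => //.
    move=> s /andP[s0 st] e e0; have sd : 0 <= s <= d by rewrite s0 (le_trans st).
    have [a a0 ha] := gap_continuous sd e0; exists a => // r /andP[r0 rt].
    by apply: ha; rewrite r0 (le_trans rt).
  move=> s /andP[s0 st] e e0; have sd : 0 <= s < d by rewrite s0 (lt_le_trans st).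
  have [a a0 ha] := gap_right_derivative sd e0; exists a => // r /andP[r0 rt].
  by apply: ha; rewrite r0 (le_trans rt).
have u0 : u 0 = fun=> 0.
  have [_ P0 _ _] := CP; apply/funext => x.
  by rewrite /u P0 ?min_semigroup0 ?subrr//; exact: wl2_ell2.
rewrite u0 wdot0l -(wnorm_sqr mu0) in H.
apply: (@ldist_eq0 _ _ G); [exact: (C0_ell2 CP)|exact: min_semigroup_ell2|].
rewrite -[leLHS](ger0_norm (ldist_ge0 G _ _)) -sqrtr_sqr.
by rewrite ler0_sqrtr.
Qed.

End small_time.

(** For small times the domain of [L] is dense and [P] has a uniform bound there; an arbitrary time
    is an integer multiple of a small one. *)
Lemma C0_unique t f : 0 <= t -> wl2 mu f -> P t f = Q t f.
Proof.
have [d [C [d0 C0 hC]]] := C0_locally_bounded CP.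
have small s u : 0 <= s <= d -> wl2 mu u -> P s u = Q s u.
  move=> sd su; have [s0 _] := andP sd.
  have sP := C0_ell2 CP s0 su; have sQ := min_semigroup_ell2 s0 su.
  apply: (ldist_eq0 sP sQ); apply/ler_addgt0Pr => e e0; rewrite add0r.
  have e1 : 0 < e / (C + 1) by rewrite divr_gt0// ltr_wpDl.
  have [w [z [k [Lw _ uw]]]] := domain_square_dense su e1.
  have [sw _] := form_operator_ell2 Lw.
  have E := C0_small_time C0 Lw hC sd.
  have sPw := C0_ell2 CP s0 sw.
  have := ldist_triangle sP sPw sQ.
  have : ld (P s u) (P s w) <= C * ld u w.
    by rewrite /ldist -(C0_sub CP)//; apply: hC => //; exact: (wl2B mu0).
  have : ld (P s w) (Q s u) <= ld u w.
    by rewrite E ldistC; exact: min_semigroup_ldist.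
  rewrite ler_pdivlMr ?ltr_wpDl// in uw.
  move: uw; move: (ld u w) (ld (P s u) (P s w)) (ld (P s w) (Q s u)) (ld _ _).
  by move=> p q r z'; lra.
move=> t0 sf; have [_ _ PD _] := CP.
have dt : 0 <= t / d by rewrite divr_ge0// ltW.
pose n := Num.bound (t / d); have nb := archi_boundP dt; rewrite -/n in nb.
have n0 : 0 < n%:R :> R by exact: le_lt_trans dt nb.
pose s := t / n%:R.
have sd : 0 <= s <= d.
  rewrite divr_ge0 ?(ltW n0)//= ler_pdivrMr// mulrC -ler_pdivrMr//.
  exact: ltW.
have [s0 _] := andP sd.
have key (m : nat) : P (m%:R * s) f = Q (m%:R * s) f.
  elim: m => [|m ih].
    have [_ P0 _ _] := CP; rewrite mul0r P0 ?min_semigroup0//.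
    exact: wl2_ell2.
  have m0 : 0 <= m%:R * s by rewrite mulr_ge0.
  rewrite -(natr1 m) mulrDl mul1r addrC PD//; last exact: wl2_ell2.
  rewrite min_semigroupD// ih small//.
  exact: min_semigroup_ell2.
have := key n; rewrite /s mulrC divfK//.
by rewrite gt_eqF.
Qed.

End heat.

(** [heat] is a choice from a set that [min_semigroup] shows to be inhabited; by [C0_unique] all its
    elements agree at nonnegative times on l^2. *)
Lemma heatE (R : realType) (X : countType) (G : graph R X) (t : R) (f : X -> R) :
  0 <= t -> wl2 (vmeas G) f -> heat G t f = min_semigroup G t f.
Proof.
pose S := [set P | C0_semigroup G P /\
  forall f g, generator G P f (\- g) <-> form_operator G f g].
have [] : S (get S).
  apply: (getI (x := min_semigroup G)); split; first exact: min_semigroup_C0.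
  exact: min_semigroup_generator.
by move=> c a t0 sf; exact: (C0_unique c a t0 sf).
Qed.

Lemma is_derive_eps (R : realType) (F : R -> R) (x l : R) :
  (forall e, 0 < e -> exists2 d, 0 < d & forall y, `|y - x| < d ->
     `|F y - F x - (y - x) * l| <= e * `|y - x|) -> is_derive x 1 F l.
Proof.
move=> H; have c : h^-1 *: ((F \o shift x) h - F x) @[h --> 0^'] --> l.
  apply/cvgrPdist_le => e e0; have [d d0 hd] := H e e0.
  exists d => // h /=; rewrite sub0r normrN => hd' hn0.
  rewrite distrC -[X in X <= _](_ : `|h|^-1 * `|F (h + x) - F x - h * l| = _).
    have h0 : 0 < `|h| by rewrite normr_gt0.
    rewrite mulrC ler_pdivrMr//.
    have := hd (h + x); rewrite addrK; exact.
  rewrite -normfV -normrM; congr (`| _ |).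
  by rewrite mulrBr mulKf.
have E : (fun h => h^-1 *: ((F \o shift x) (h *: 1) - F x)) =
    (fun h => h^-1 *: ((F \o shift x) h - F x)).
  by apply/funext => h; rewrite [h *: 1]mulr1.
have dF : derivable F x 1 by rewrite /derivable E; apply: cvgP c.
apply: DeriveDef => //; rewrite /derive E; exact: cvg_lim c.
Qed.

(** * Regularity, positivity and sub-Markov bounds of orbits *)

Section orbits.
Variables (R : realType) (X : countType) (G : graph R X).
Local Notation mu := (vmeas G).
Local Notation mu0 := (mu_ge0 G).
Local Notation N := (wnorm mu).
Local Notation ld := (ldist G).
Local Notation Q := (min_semigroup G).
Local Notation J := (resolvent G).
Implicit Types (f g : X -> R) (h e t s r : R) (x y : X).

(* Truncating negative times makes every orbit continuous on the whole line. *)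
Definition orbit f x s : R := Q (Num.max s 0) f x.

Lemma orbitE f x s : 0 <= s -> orbit f x s = Q s f x.
Proof. by move=> s0; rewrite /orbit max_l. Qed.

Lemma min_semigroup_dist f r s : 0 <= r <= s -> wl2 mu f ->
  ld (Q s f) (Q r f) <= ld (Q (s - r) f) f.
Proof.
move=> /andP[r0 rs] sf; rewrite -[leRHS]mul1r.
apply: (C0_orbit_dist (min_semigroup_C0 G) (d := r)) => //; first by rewrite r0 lexx.
by move=> t u /andP[t0 _] su; rewrite mul1r; exact: min_semigroup_norm.
Qed.

Lemma orbit_continuous f x : wl2 mu f -> continuous (orbit f x).
Proof.
move=> sf t; apply/cvgrPdist_le => e e0.
have q0 : 0 < Num.sqrt (mu x) by rewrite sqrtr_gt0 vmeas_gt0.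
have e1 : 0 < e * Num.sqrt (mu x) by rewrite mulr_gt0.
have [d d0 hd] := min_semigroup_uniform sf e1.
have key r s : 0 <= r <= s -> s - r <= d -> `|Q s f x - Q r f x| <= e.
  move=> rs sr; have [r0 rs'] := andP rs; have s0 := le_trans r0 rs'.
  apply: le_trans (ldist_pt x (min_semigroup_ell2 s0 sf) (min_semigroup_ell2 r0 sf)) _.
  rewrite ler_pdivrMr//; apply: le_trans (min_semigroup_dist rs sf) _.
  by apply: hd; rewrite subr_ge0 rs' sr.
exists d => // s /= ts; rewrite /orbit.
set a := Num.max t 0; set b := Num.max s 0.
have ab : `|a - b| <= `|t - s|.
  rewrite /a /b; case: (leP t 0) => t0; case: (leP s 0) => s0.
  - by rewrite subrr normr0.
  - by rewrite sub0r normrN gtr0_norm// ler0_norm; lra.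
  - by rewrite subr0 gtr0_norm// ger0_norm; lra.
  - by [].
have a0 : 0 <= a by rewrite le_max lexx orbT.
have b0 : 0 <= b by rewrite le_max lexx orbT.
have [abl|bal] := leP a b.
  rewrite distrC; apply: key; first by rewrite a0.
  have : `|a - b| <= d by apply: le_trans ab (ltW ts).
  by rewrite ler0_norm ?subr_le0// opprB.
apply: key; first by rewrite b0 ltW.
have : `|a - b| <= d by apply: le_trans ab (ltW ts).
by rewrite gtr0_norm ?subr_gt0.
Qed.

Lemma orbit_is_derive f g x t : form_operator G f g -> 0 < t ->
  is_derive t 1 (orbit f x) (- orbit g x t).
Proof.
move=> Lf t0; have [sf sg] := form_operator_ell2 Lf.
apply: is_derive_eps => e e0.
have q0 : 0 < Num.sqrt (mu x) by rewrite sqrtr_gt0 vmeas_gt0.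
have e2 : 0 < e / 2 by rewrite divr_gt0.
have e1 : 0 < e / 2 * Num.sqrt (mu x) by rewrite mulr_gt0.
have [d1 d10 h1] := min_semigroup_expansion Lf e1.
have /cvgrPdist_le /(_ _ e2) [d2 /= d20 h2] := @orbit_continuous g x sg t.
have key r s : 0 <= r <= s -> s - r <= d1 ->
    `|orbit f x s - orbit f x r + (s - r) * orbit g x r| <= e / 2 * (s - r).
  move=> /andP[r0 rs] sr; have s0 := le_trans r0 rs.
  have sr0 : 0 <= s - r by rewrite subr_ge0.
  rewrite !orbitE//.
  have sQ := min_semigroup_ell2 sr0 sf.
  have sB := wl2B mu0 sQ sf.
  have sw : wl2 mu (fun z => (s - r) * g z + (Q (s - r) f z - f z)).
    by apply: (wl2D mu0) => //; exact: wl2Z.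
  have -> : Q s f x - Q r f x + (s - r) * Q r g x =
      Q r (fun z => (s - r) * g z + (Q (s - r) f z - f z)) x.
    rewrite min_semigroup_linear// min_semigroupB// -min_semigroupD//.
    by rewrite (addrC r) subrK addrC.
  have sQw := min_semigroup_ell2 r0 sw.
  apply: le_trans (wnorm_pt mu0 (vmeas_gt0 G x) sQw) _.
  rewrite ler_pdivrMr//; apply: le_trans (min_semigroup_norm r0 sw) _.
  have := h1 (s - r); rewrite sr0 sr => /(_ isT) H.
  rewrite (_ : (fun z => _) = fun z => Q (s - r) f z - f z + (s - r) * g z).
    by apply: le_trans H _; rewrite le_eqVlt; apply/orP; left; apply/eqP; ring.
  by apply/funext => z; rewrite addrC.
exists (Num.min t (Num.min d1 d2)); first by rewrite !lt_min t0 d10.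
move=> s; rewrite !lt_min => /and3P[st sd1 sd2].
have s0 : 0 <= s by move: st; rewrite ltr_norml; lra.
have [ts|st'] := leP t s.
  have st0 : 0 <= s - t by rewrite subr_ge0.
  rewrite !(ger0_norm st0) in sd1 *.
  have := key t s; rewrite (ltW t0) ts => /(_ isT (ltW sd1)).
  rewrite mulrN opprK => /le_trans; apply.
  by rewrite ler_wpM2r//; lra.
(* For [s < t] the expansion is based at [s]; continuity of the orbit of [g] replaces its value at
   [s] by the one at [t]. *)
have ts0 : 0 <= t - s by rewrite subr_ge0 ltW.
have E1 : `|s - t| = t - s by rewrite distrC ger0_norm.
have sd2' : `|t - s| < d2 by rewrite distrC.
have H2 := h2 s sd2'.
have := key s t; rewrite s0 (ltW st') -E1 => /(_ isT (ltW sd1)); rewrite E1 => H1.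
set a := orbit f x t in H1 *; set b := orbit f x s in H1 *.
set u := orbit g x t in H2 *; set v := orbit g x s in H1 H2.
rewrite -normrN.
have -> : - (b - a - (s - t) * - u) = (a - b + (t - s) * v) + (t - s) * (u - v) by ring.
apply: le_trans (ler_normD _ _) _.
rewrite [leRHS](_ : _ = e / 2 * (t - s) + (t - s) * (e / 2)); last by field.
by apply: lerD => //; rewrite normrM ger0_norm// ler_wpM2l.
Qed.

Lemma orbit_FTC f g x r t : form_operator G f g -> 0 <= r < t ->
  (\int[lebesgue_measure]_(s in `[r, t]) (orbit g x s)%:E =
   (orbit f x r - orbit f x t)%:E)%E.
Proof.
move=> Lf /andP[r0 rt]; have [sf sg] := form_operator_ell2 Lf.
have cf := @orbit_continuous f x sf; have cg := @orbit_continuous g x sg.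
have D s : s \in `]r, t[ -> is_derive s 1 (fun s => - orbit f x s) (orbit g x s).
  rewrite in_itv /= => /andP[rs st].
  have := orbit_is_derive x Lf (le_lt_trans r0 rs) => H.
  by have := is_deriveN H; rewrite opprK.
rewrite (continuous_FTC2 (F := fun s => - orbit f x s) rt).
- by rewrite -EFinD opprK addrC.
- exact: continuous_subspaceT.
- split.
  + by move=> s /D[].
  + by apply: cvgN; apply: cvg_at_right_filter; exact: cf.
  + by apply: cvgN; apply: cvg_at_left_filter; exact: cf.
- by move=> s /D H; rewrite derive1E; exact: derive_val.
Qed.

Lemma resolvent_ge0 h f x : 0 < h -> wl2 mu f -> (forall y, 0 <= f y) ->
  0 <= J h f x.
Proof.
by move=> h0 sf f0; rewrite resolvent_jacobi//; exact: (jacobi_lim_ge0 h0).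
Qed.

Lemma supersolution1 h f : 0 < h ->
  (forall x, f x <= 1 + h * (killing G x / mu x)) -> supersolution G h f (fun=> 1).
Proof.
move=> h0 f1 x.
have E : (fun y => weight G x y * 1) = weight G x.
  by apply/funext => y; rewrite mulr1.
rewrite /wsum E -/(wdeg G x); split; first exact: asum_weight.
have m0 := vmeas_gt0 G x; rewrite mulr1 /degree.
rewrite [leRHS](_ : _ = 1 + h * (killing G x / mu x) + h / mu x * wdeg G x).
  by rewrite lerD2r.
by field; rewrite gt_eqF.
Qed.

Lemma resolvent_le1 h f x : 0 < h -> wl2 mu f -> (forall y, 0 <= f y <= 1) ->
  J h f x <= 1.
Proof.
move=> h0 sf f01; have f0 y : 0 <= f y by case/andP: (f01 y).
rewrite resolvent_jacobi//; apply: (jacobi_lim_le_supersolution h0 f0 sf (s := fun=> 1)) => //.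
apply: supersolution1 => // y; case/andP: (f01 y) => _ /le_trans; apply.
by rewrite lerDl mulr_ge0 ?divr_ge0 ?killing_ge0 ?mu_ge0// ltW.
Qed.

Lemma min_semigroup_ge0 t f x : 0 <= t -> wl2 mu f -> (forall y, 0 <= f y) ->
  0 <= Q t f x.
Proof.
move=> t0 sf f0; have [_ cf _] := min_semigroup_cvg t0 sf.
apply: cvgr_to_ge (cf x) _; apply: nearW => n; rewrite /approx.
elim: (steps n t) x => [|m ih] x; first exact: f0.
apply: resolvent_ge0; [exact: mesh_gt0|exact/iter_ell2/sf/mesh_gt0|exact: ih].
Qed.

Lemma min_semigroup_mono t f g x : 0 <= t -> wl2 mu f -> wl2 mu g ->
  (forall y, f y <= g y) -> Q t f x <= Q t g x.
Proof.
move=> t0 sf sg fg; rewrite -subr_ge0.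
have := min_semigroup_ge0 x t0 (wl2B mu0 sg sf).
by rewrite min_semigroupB//; apply => y; rewrite subr_ge0.
Qed.

Lemma min_semigroup_le1 t f x : 0 <= t -> wl2 mu f -> (forall y, 0 <= f y <= 1) ->
  Q t f x <= 1.
Proof.
move=> t0 sf f01; have [_ cf _] := min_semigroup_cvg t0 sf.
apply: cvgr_to_le (cf x) _; apply: nearW => n; rewrite /approx.
suff : forall y, 0 <= iter (steps n t) (J (mesh R n)) f y <= 1 by move=> /(_ x)/andP[].
elim: (steps n t) => [|m ih] y; first exact: f01.
have si := iter_ell2 (mesh_gt0 R n) m sf.
rewrite /= resolvent_le1 ?mesh_gt0// andbT resolvent_ge0 ?mesh_gt0//.
by move=> z; case/andP: (ih z).
Qed.

End orbits.

(** * Escape to infinity *)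

Section defect.
Variables (R : realType) (X : countType) (G : graph R X).
Local Notation mu := (vmeas G).
Local Notation ka := (killing G).
Local Notation mu0 := (mu_ge0 G).
Local Notation J := (resolvent G).
Implicit Types (f g s : X -> R) (x y : X) (m n : nat).
Variable h : R.
Hypothesis h0 : 0 < h.

(* As [(1 + h D) 1 = 1 + h kappa / mu], these solutions would increase to 1 if no
   mass were lost at infinity. *)
Definition source m : X -> R := restrict_first (fun y => 1 + h * (ka y / mu y)) m.

Definition partial_sol m : X -> R := J h (source m).

(* The probabilistic reading is [E_x exp(- lifetime / h)], the life time being
   the time of escape to infinity. *)
Definition defect x : R := 1 - limn (fun m => partial_sol m x).

Lemma kamu_ge0 y : 0 <= ka y / mu y.
Proof. by rewrite divr_ge0 ?killing_ge0 ?mu_ge0. Qed.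

Lemma source_full_ge1 y : 1 <= 1 + h * (ka y / mu y).
Proof. by rewrite lerDl mulr_ge0 ?kamu_ge0// ltW. Qed.

Lemma restrict_first_ell2 f m : wl2 mu (restrict_first f m).
Proof. exact/finsupp_ell2/restrict_first_finsupp. Qed.

Lemma restrict_first_mono f m n x : (forall y, 0 <= f y) -> (m <= n)%N ->
  restrict_first f m x <= restrict_first f n x.
Proof.
move=> f0 mn; rewrite /restrict_first; case: ifP => xm; last by case: ifP.
by rewrite (leq_trans xm mn).
Qed.

Lemma restrict_first_ge0 f m x : (forall y, 0 <= f y) -> 0 <= restrict_first f m x.
Proof. by move=> f0; rewrite /restrict_first; case: ifP. Qed.

Lemma source_ell2 m : wl2 mu (source m).
Proof. exact: restrict_first_ell2. Qed.

Lemma source_ge0 m x : 0 <= source m x.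
Proof. by apply: restrict_first_ge0 => y; exact: le_trans ler01 (source_full_ge1 y). Qed.

Lemma source_le m x : source m x <= 1 + h * (ka x / mu x).
Proof.
rewrite /source /restrict_first; case: ifP => // _.
exact: le_trans ler01 (source_full_ge1 x).
Qed.

Lemma partial_sol_ell2 m : wl2 mu (partial_sol m).
Proof. exact/resolvent_ell2/source_ell2. Qed.

Lemma partial_sol_operator m : form_operator G (partial_sol m)
  (fun x => h^-1 * (source m x - partial_sol m x)).
Proof. exact/resolventP/source_ell2. Qed.

Lemma partial_sol_ge0 m x : 0 <= partial_sol m x.
Proof. exact: (resolvent_ge0 x h0 (source_ell2 m) (source_ge0 m)). Qed.

Lemma partial_sol_le m s x : (forall y, 0 <= s y) ->
  supersolution G h (fun y => 1 + h * (ka y / mu y)) s -> partial_sol m x <= s x.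
Proof.
move=> s0 ss; rewrite /partial_sol resolvent_jacobi//; last 2 first.
- exact: source_ell2.
- exact: source_ge0.
apply: (jacobi_lim_le_supersolution h0 (source_ge0 m) (source_ell2 m)) => // y.
have [sy hy] := ss y; split => //.
by apply: le_trans hy; rewrite lerD2r source_le.
Qed.

Lemma partial_sol_le1 m x : partial_sol m x <= 1.
Proof.
apply: (@partial_sol_le m (fun=> 1)) => //; apply: supersolution1 => //.
Qed.

Lemma partial_sol_mono x : nondecreasing_seq (fun m => partial_sol m x).
Proof.
move=> m n mn; rewrite -subr_ge0.
have := resolvent_ge0 x h0 (wl2B mu0 (source_ell2 n) (source_ell2 m)).
rewrite resolventB//; [|exact: source_ell2|exact: source_ell2].
apply => y; rewrite subr_ge0; apply: restrict_first_mono => // z.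
exact: le_trans ler01 (source_full_ge1 z).
Qed.

Lemma partial_sol_cvg x : partial_sol m x @[m --> \oo] --> 1 - defect x.
Proof.
rewrite /defect subKr; apply: nondecreasing_is_cvgn; first exact: partial_sol_mono.
by exists 1 => _ [m _ <-]; exact: partial_sol_le1.
Qed.

Lemma partial_sol_le_lim m x : partial_sol m x <= 1 - defect x.
Proof.
apply: cvgr_to_ge (@partial_sol_cvg x) _; exists m => // n mn.
exact: partial_sol_mono.
Qed.

Lemma defect_ge0 x : 0 <= defect x.
Proof.
have : 1 - defect x <= 1.
  by apply: cvgr_to_le (@partial_sol_cvg x) _; apply: nearW => m; exact: partial_sol_le1.
lra.
Qed.

Lemma defect_le1 x : defect x <= 1.
Proof. by have := partial_sol_le_lim 0 x; have := partial_sol_ge0 0 x; lra. Qed.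

Lemma bounded_unit s : (forall x, 0 <= s x <= 1) -> bounded_fun s.
Proof. by move=> s01; exists 1 => x; have /andP[a b] := s01 x; rewrite ger0_norm. Qed.

Lemma defect_bounded : bounded_fun defect.
Proof. by apply: bounded_unit => x; rewrite defect_ge0 defect_le1. Qed.

Lemma partial_sol_equation m x :
  mu x * (h^-1 * (source m x - partial_sol m x)) =
  wdeg G x * partial_sol m x - wsum G x (partial_sol m) + ka x * partial_sol m x.
Proof.
have bg : bounded_fun (partial_sol m).
  by apply: bounded_unit => y; rewrite partial_sol_ge0 partial_sol_le1.
rewrite -(green_delta (asum_weightM G x bg)).2.
rewrite (form_operatorE (partial_sol_operator m)) ?dot_delta//.
exact/finsupp_dom_closure/finsupp_delta.
Qed.

Lemma defect_laplacian x : laplacian G defect x = - h^-1 * defect x.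
Proof.
rewrite laplacianE; last exact: defect_bounded.
have cw : wsum G x (partial_sol m) @[m --> \oo] --> wsum G x (fun y => 1 - defect y).
  apply: (@rsum_dominated _ _ _ _ _ _ _ (weight G x)); first exact: asum_weight.
  - apply: nearW => m y; rewrite normrM ger0_norm ?weight_ge0// ler_piMr ?weight_ge0//.
    by rewrite ger0_norm ?partial_sol_ge0 ?partial_sol_le1.
  - by move=> y; apply: cvgM; [exact: cvg_cst|exact: partial_sol_cvg].
  - move=> y; rewrite normrM ger0_norm ?weight_ge0// ler_piMr ?weight_ge0//.
    have := defect_ge0 y; have := defect_le1 y.
    by rewrite ler_norml; lra.
have c1 : mu x * (h^-1 * (source m x - partial_sol m x)) @[m --> \oo] -->
    mu x * (h^-1 * (1 + h * (ka x / mu x) - (1 - defect x))).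
  do 2 (apply: cvgM; first exact: cvg_cst).
  apply: cvgB; last exact: partial_sol_cvg.
  apply: cvg_near_cst; exists (pickle x).+1 => // m /= xm.
  by rewrite /source /restrict_first xm.
have c2 : mu x * (h^-1 * (source m x - partial_sol m x)) @[m --> \oo] -->
    wdeg G x * (1 - defect x) - wsum G x (fun y => 1 - defect y) + ka x * (1 - defect x).
  under eq_fun do rewrite partial_sol_equation.
  have cp := @partial_sol_cvg x.
  apply: cvgD; last by apply: cvgM => //; exact: cvg_cst.
  by apply: cvgB => //; apply: cvgM => //; exact: cvg_cst.
have E := cvg_unique _ c1 c2.
have {}E : mu x * (h^-1 * (1 + h * (ka x / mu x) - (1 - defect x))) =
  wdeg G x * (1 - defect x) - wsum G x (fun y => 1 - defect y) + ka x * (1 - defect x).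
  exact: E.
have W : wsum G x (fun y => 1 - defect y) = wdeg G x - wsum G x defect.
  rewrite /wsum /wdeg -rsumB; [|exact: asum_weight|exact/asum_weightM/defect_bounded].
  by congr rsum; apply/funext => y; rewrite mulrBr mulr1.
rewrite W in E; have m0 := vmeas_gt0 G x.
have hn0 : h != 0 by rewrite gt_eqF.
have mn0 : mu x != 0 by rewrite gt_eqF.
apply: (mulfI mn0); rewrite mulVKf//.
have : mu x * (h^-1 * (1 + h * (ka x / mu x) - (1 - defect x))) =
  ka x + mu x * (h^-1 * defect x) by field; rewrite hn0 mn0.
rewrite E => H; rewrite mulNr mulrN; lra.
Qed.

(** [1 - s] is a nonnegative supersolution for the full source, so every [partial_sol] lies below
    it. *)
Lemma defect_max s x : (forall y, 0 <= s y <= 1) ->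
  (forall y, s y + h * laplacian G s y <= 0) -> s x <= defect x.
Proof.
move=> s01 sl; have bs := bounded_unit s01.
suff : 1 - defect x <= 1 - s x by lra.
apply: cvgr_to_le (@partial_sol_cvg x) _; apply: nearW => m.
apply: (@partial_sol_le m (fun y => 1 - s y)) => y.
  by case/andP: (s01 y); lra.
have E : (fun z => weight G y z * (1 - s z)) =
    (fun z => weight G y z - weight G y z * s z).
  by apply/funext => z; rewrite mulrBr mulr1.
have sw := asum_weightM G y bs; rewrite /wsum E; split.
  by apply: asumB => //; exact: asum_weight.
rewrite rsumB//; last exact: asum_weight.
rewrite -/(wdeg G y) -/(wsum G y s).
have m0 := vmeas_gt0 G y; have := sl y; rewrite laplacianE//.
rewrite /degree => H.
rewrite -subr_le0 [leLHS](_ : _ = s y + h * ((mu y)^-1 *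
  (wdeg G y * s y - wsum G y s + ka y * s y)))//.
by field; rewrite gt_eqF.
Qed.

(** Comes from the first nontrivial Jacobi iterate at [x]. As [h] tends to 0 the defect disappears
    at each vertex, which later removes [h] from the mass balance. *)
Lemma defect_small x : defect x <= h * degree G x.
Proof.
have xm : source (pickle x).+1 x = 1 + h * (ka x / mu x).
  by rewrite /source /restrict_first ltnSn.
have := partial_sol_le_lim (pickle x).+1 x.
rewrite /partial_sol resolvent_jacobi//; last 2 first.
- exact: source_ell2.
- exact: source_ge0.
have := jacobi_lim_lower h0 (source_ge0 (pickle x).+1) (source_ell2 (pickle x).+1) x.
rewrite xm => H1 H2; have := le_trans H1 H2.
have dg := diag_gt0 G h0 x; rewrite ler_pdivrMr//.
have := source_full_ge1 x; have := defect_ge0 x; have := degree_ge0 G x.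
move: (defect x) (degree G x) (h * (ka x / mu x)) => e d k d0' e0' k1 H.
have hd : 0 <= h * d by rewrite mulr_ge0// ltW.
have : 0 <= e * (h * d) by rewrite mulr_ge0.
move: H k1 hd; move: (h * d) => u; lra.
Qed.

End defect.

(** * Mass balance of the heat semigroup *)

Section escape.
Variables (R : realType) (X : countType) (G : graph R X).
Local Notation mu := (vmeas G).
Local Notation ka := (killing G).
Local Notation mu0 := (mu_ge0 G).
Local Notation Q := (min_semigroup G).
Local Notation leb := (@lebesgue_measure R).
Implicit Types (f g : X -> R) (h e t s r : R) (x y : X) (m n k : nat).

Lemma orbit_ge0 f x s : wl2 mu f -> (forall y, 0 <= f y) -> 0 <= orbit G f x s.
Proof. by move=> sf f0; apply: min_semigroup_ge0 => //; rewrite le_max lexx orbT. Qed.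

Lemma orbit_le1 f x s : wl2 mu f -> (forall y, 0 <= f y <= 1) -> orbit G f x s <= 1.
Proof. by move=> sf f0; apply: min_semigroup_le1 => //; rewrite le_max lexx orbT. Qed.

Lemma orbit_mono f g x s : wl2 mu f -> wl2 mu g -> (forall y, f y <= g y) ->
  orbit G f x s <= orbit G g x s.
Proof. by move=> sf sg fg; apply: min_semigroup_mono => //; rewrite le_max lexx orbT. Qed.

Lemma orbit_linear a f g x s : wl2 mu f -> wl2 mu g ->
  orbit G (fun y => a * f y + g y) x s = a * orbit G f x s + orbit G g x s.
Proof.
move=> sf sg; rewrite /orbit min_semigroup_linear//.
by rewrite le_max lexx orbT.
Qed.

Definition ones m : X -> R := restrict_first (fun=> 1) m.
Definition kills m : X -> R := restrict_first (fun y => ka y / mu y) m.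

Variable x : X.

(** The next three functions are the extended semigroup at [x] applied to 1, to [1 - defect] and to
    kappa / mu. The last takes values in the extended reals because kappa / mu may be unbounded. *)
Definition survival s : R := limn (fun m => orbit G (ones m) x s).
Definition confined h s : R := limn (fun m => orbit G (partial_sol G h m) x s).
Definition kill_rate s : \bar R := limn (fun m => (orbit G (kills m) x s)%:E).

Lemma ones_ell2 m : wl2 mu (ones m). Proof. exact: restrict_first_ell2. Qed.
Lemma kills_ell2 m : wl2 mu (kills m). Proof. exact: restrict_first_ell2. Qed.

Lemma ones01 m y : 0 <= ones m y <= 1.
Proof. by rewrite /ones /restrict_first; case: ifP; rewrite ?ler01 ?lexx. Qed.

Lemma ones_orbit_nd s : nondecreasing_seq (fun m => orbit G (ones m) x s).
Proof.
move=> m n mn; apply: orbit_mono; [exact: ones_ell2|exact: ones_ell2|].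
by move=> y; apply: restrict_first_mono.
Qed.

Lemma ones_orbit_ge0 m s : 0 <= orbit G (ones m) x s.
Proof. by apply: orbit_ge0 => [|y]; [exact: ones_ell2|case/andP: (ones01 m y)]. Qed.

Lemma survival_cvg s : orbit G (ones m) x s @[m --> \oo] --> survival s.
Proof.
apply: nondecreasing_is_cvgn; first exact: ones_orbit_nd.
by exists 1 => _ [m _ <-]; apply: orbit_le1 => [|y]; [exact: ones_ell2|exact: ones01].
Qed.

Lemma ones_orbit_le m s : orbit G (ones m) x s <= survival s.
Proof.
by apply: cvgr_to_ge (@survival_cvg s) _; exists m => // n mn; exact: ones_orbit_nd.
Qed.

Lemma survival_ge0 s : 0 <= survival s.
Proof. exact: le_trans (ones_orbit_ge0 0 s) (ones_orbit_le 0 s). Qed.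

Lemma survival_le1 s : survival s <= 1.
Proof.
apply: cvgr_to_le (@survival_cvg s) _; apply: nearW => m.
by apply: orbit_le1 => [|y]; [exact: ones_ell2|exact: ones01].
Qed.

Lemma orbit0 f : wl2 mu f -> orbit G f x 0 = f x.
Proof. by move=> sf; rewrite orbitE// min_semigroup0. Qed.

Lemma survival0 : survival 0 = 1.
Proof.
apply: cvg_lim => //; apply: cvg_near_cst; exists (pickle x).+1 => // m /= xm.
by rewrite orbit0 ?/ones ?/restrict_first ?xm//; exact: ones_ell2.
Qed.

Lemma kills_orbit_ge0 m s : 0 <= orbit G (kills m) x s.
Proof.
apply: orbit_ge0 => [|y]; first exact: kills_ell2.
by apply: restrict_first_ge0 => z; exact: kamu_ge0.
Qed.

Lemma kills_orbit_nd s : nondecreasing_seq (fun m => (orbit G (kills m) x s)%:E).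
Proof.
move=> m n mn; rewrite lee_fin.
apply: orbit_mono; [exact: kills_ell2|exact: kills_ell2|].
by move=> y; apply: restrict_first_mono => // z; exact: kamu_ge0.
Qed.

Lemma kill_rate_ge0 s : (0 <= kill_rate s)%E.
Proof.
apply: lime_ge; first exact/ereal_nondecreasing_is_cvgn/kills_orbit_nd.
by apply: nearW => m; rewrite lee_fin kills_orbit_ge0.
Qed.

Lemma heat_ext_one s : 0 <= s -> heat_ext G s (fun=> 1) x = (survival s)%:E.
Proof.
move=> s0; apply: cvg_lim => //.
under eq_fun do rewrite (heatE s0 (restrict_first_ell2 G _ _)) -orbitE//.
by apply: cvg_EFin; [exact: nearW|exact: survival_cvg].
Qed.

Lemma heat_ext_kill s : 0 <= s ->
  heat_ext G s (fun y => ka y / mu y) x = kill_rate s.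
Proof.
move=> s0; rewrite /heat_ext /kill_rate; congr (lim (_ @ \oo)).
by apply/funext => m; rewrite (heatE s0 (restrict_first_ell2 G _ _)) -orbitE.
Qed.

Lemma orbit_measurable_real f (D : set R) : wl2 mu f ->
  measurable_fun D (orbit G f x).
Proof.
move=> sf; apply: measurable_funTS; apply: continuous_measurable_fun.
by move=> t; exact: (@orbit_continuous _ _ G f x sf t).
Qed.

Lemma orbit_measurable f (D : set R) : wl2 mu f ->
  measurable_fun D (EFin \o orbit G f x).
Proof. by move=> sf; apply/measurable_EFinP; exact: orbit_measurable_real. Qed.

Section one_mesh.
Variable h : R.
Hypothesis h0 : 0 < h.
Local Notation g := (partial_sol G h).
Local Notation e := (defect G h).

Lemma partial_orbit_nd s : nondecreasing_seq (fun m => orbit G (g m) x s).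
Proof.
move=> m n mn; apply: orbit_mono; [exact: partial_sol_ell2|exact: partial_sol_ell2|].
by move=> y; exact: partial_sol_mono.
Qed.

Lemma partial01 m y : 0 <= g m y <= 1.
Proof. by rewrite partial_sol_ge0 ?partial_sol_le1. Qed.

Lemma partial_orbit_ge0 m s : 0 <= orbit G (g m) x s.
Proof. by apply: orbit_ge0 => [|y]; [exact: partial_sol_ell2|case/andP: (partial01 m y)]. Qed.

Lemma confined_cvg s : orbit G (g m) x s @[m --> \oo] --> confined h s.
Proof.
apply: nondecreasing_is_cvgn; first exact: partial_orbit_nd.
by exists 1 => _ [m _ <-]; apply: orbit_le1 => [|y]; [exact: partial_sol_ell2|exact: partial01].
Qed.

Lemma partial_orbit_le m s : orbit G (g m) x s <= confined h s.
Proof.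
have c := @confined_cvg s; apply: (cvgr_to_ge c).
by exists m; [|move=> n mn; exact: (partial_orbit_nd s mn)].
Qed.

Lemma confined_ge0 s : 0 <= confined h s.
Proof. exact: le_trans (partial_orbit_ge0 0 s) (partial_orbit_le 0 s). Qed.

Lemma confined0 : confined h 0 = 1 - e x.
Proof.
apply: cvg_lim => //; rewrite (_ : (fun m => _) = fun m => g m x); last first.
  by apply/funext => m; apply: orbit0; exact: partial_sol_ell2.
exact: partial_sol_cvg.
Qed.

(** [partial_sol] is at most 1 but need not be finitely supported, so it need not lie below any
    [ones k]; its restrictions do, and they converge to it in l^2. *)
Lemma confined_le_survival s : confined h s <= survival s.
Proof.
apply: cvgr_to_le (@confined_cvg s) _; apply: nearW => m.
have sg := partial_sol_ell2 G h0 m.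
have s0 : 0 <= Num.max s 0 by rewrite le_max lexx orbT.
have c : orbit G (restrict_first (g m) k) x s @[k --> \oo] --> orbit G (g m) x s.
  rewrite /orbit; apply: (@ldist_cvg_pt _ _ G
    (fun k => Q (Num.max s 0) (restrict_first (g m) k)) (Q (Num.max s 0) (g m)) x).
  - by move=> k; exact/min_semigroup_ell2/restrict_first_ell2.
  - exact: min_semigroup_ell2.
  - apply: cvg_dist_le0 (restrict_first_cvg sg); apply: nearW => k.
    rewrite sub0r normrN ger0_norm ?ldist_ge0// ldistC.
    by apply: min_semigroup_ldist => //; exact: restrict_first_ell2.
apply: cvgr_to_le c _; apply: nearW => k; apply: le_trans (ones_orbit_le k s).
apply: orbit_mono; [exact: restrict_first_ell2|exact: ones_ell2|].
move=> y; rewrite /ones /restrict_first; case: ifP => // _.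
by case/andP: (partial01 m y).
Qed.

Lemma orbit_sum (r : seq X) (c : X -> R) s :
  wl2 mu (fun y => \sum_(z <- r) c z * delta R z y) /\
  orbit G (fun y => \sum_(z <- r) c z * delta R z y) x s =
  \sum_(z <- r) c z * orbit G (delta R z) x s.
Proof.
elim: r => [|z r [ih1 ih2]].
  rewrite big_nil; under eq_fun do rewrite big_nil; split; first exact: wl20.
  have := orbit_linear (-1) x s (wl20 mu) (wl20 mu).
  rewrite (_ : (fun y : X => -1 * 0 + 0) = fun=> 0); last by apply/funext => y; ring.
  by move=> H; rewrite [LHS]H; ring.
under eq_fun do rewrite big_cons; rewrite big_cons -ih2.
have sd := finsupp_ell2 G (finsupp_delta R z).
rewrite (orbit_linear (c z) x s sd ih1); split => //.
by apply: (wl2D mu0) => //; exact: wl2Z.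
Qed.

Lemma restrict_first_sum f k : restrict_first f k =
  (fun y => \sum_(z <- first_vertices k) f z * delta R z y).
Proof.
apply/funext => y; rewrite /restrict_first -mem_first_vertices.
have [yr|yr] := boolP (y \in first_vertices k).
  rewrite (big_rem y)//= /delta eqxx mulr1 big_seq big1 ?addr0// => z.
  rewrite mem_rem_uniq ?first_vertices_uniq// inE eq_sym => /andP[/negbTE -> _].
  by rewrite mulr0.
rewrite big_seq big1// => z zr; rewrite /delta.
by case: eqVneq => [yz|_]; rewrite ?mulr0//; rewrite yz zr in yr.
Qed.

(** On the first [k] vertices 1 splits as [g m + (1 - g m)], and [g m] dominates its own
    restriction. The remainder is a finite combination of Dirac masses, so [m] can tend to infinity
    vertex by vertex. *)
Lemma ones_orbit_le_confined k s : orbit G (ones k) x s <=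
  confined h s + \sum_(z <- first_vertices k) e z * orbit G (delta R z) x s.
Proof.
rewrite -lerBlDr.
have c : orbit G (ones k) x s -
      \sum_(z <- first_vertices k) (1 - g m z) * orbit G (delta R z) x s
    @[m --> \oo] --> orbit G (ones k) x s -
      \sum_(z <- first_vertices k) (1 - (1 - e z)) * orbit G (delta R z) x s.
  apply: cvgB; first exact: cvg_cst.
  apply: (@cvg_sum_seq R X nat \oo _ (fun m z => (1 - g m z) * orbit G (delta R z) x s)
    (fun z => (1 - (1 - e z)) * orbit G (delta R z) x s)) => z.
  apply: cvgM; last exact: cvg_cst.
  by apply: cvgB; [exact: cvg_cst|exact: partial_sol_cvg].
under [X in _ - X]eq_bigr do rewrite -[e _](subKr 1).
apply: cvgr_to_le c _; apply: nearW => m.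
apply: le_trans (partial_orbit_le m s).
have sg := partial_sol_ell2 G h0 m.
have [_ <-] := orbit_sum (first_vertices k) (fun z => 1 - g m z) s.
rewrite -(restrict_first_sum (fun z => 1 - g m z)).
set u := restrict_first _ k; have su : wl2 mu u by exact: restrict_first_ell2.
have := orbit_linear (-1) x s su (ones_ell2 k).
rewrite mulN1r addrC => <-; apply: orbit_mono => //.
  by apply: (wl2D mu0); [exact: wl2Z|exact: ones_ell2].
move=> y; rewrite /u /ones /restrict_first; case: ifP => _; first by lra.
by rewrite mulr0 addr0; case/andP: (partial01 m y).
Qed.

Lemma survival_le_confined (E : R) s : (forall y, e y <= E) ->
  survival s <= confined h s + E * survival s.
Proof.
move=> eE; have E0 : 0 <= E by exact: le_trans (defect_ge0 G h0 x) (eE x).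
apply: cvgr_to_le (@survival_cvg s) _; apply: nearW => k.
apply: le_trans (ones_orbit_le_confined k s) _; rewrite lerD2l.
apply: le_trans (ler_wpM2l E0 (ones_orbit_le k s)).
have sk := orbit_sum (first_vertices k) (fun=> 1) s.
rewrite /ones restrict_first_sum sk.2 mulr_sumr; apply: ler_sum => z _.
rewrite mul1r ler_wpM2r//; apply: orbit_ge0; first exact/finsupp_ell2/finsupp_delta.
by move=> y; rewrite /delta ler0n.
Qed.

Definition escaped s : R := survival s - confined h s.

Lemma escaped_ge0 s : 0 <= escaped s.
Proof. by rewrite subr_ge0 confined_le_survival. Qed.

Lemma survival_measurable (D : set R) : measurable_fun D (EFin \o survival).
Proof.
apply/measurable_EFinP/measurable_funTS.
apply: (measurable_fun_cvg (h := fun m => orbit G (ones m) x)).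
  by move=> m; apply: orbit_measurable_real; exact: ones_ell2.
by move=> s _; exact: survival_cvg.
Qed.

Lemma confined_measurable (D : set R) : measurable_fun D (EFin \o confined h).
Proof.
apply/measurable_EFinP/measurable_funTS.
apply: (measurable_fun_cvg (h := fun m => orbit G (g m) x)).
  by move=> m; apply: orbit_measurable_real; exact: partial_sol_ell2.
by move=> s _; exact: confined_cvg.
Qed.

Lemma orbit_integrable f a b : wl2 mu f ->
  leb.-integrable `[a, b] (EFin \o orbit G f x).
Proof.
move=> sf; apply: continuous_compact_integrable; first exact: segment_compact.
by apply: continuous_subspaceT; exact: (@orbit_continuous _ _ G f x sf).
Qed.

(** Integration of d/ds P_s g = - P_s L g, where L g = (ones - g) / h + kills. The terms are
    arranged so that every integrand is nonnegative, ready for monotone convergence. *)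
Lemma balance_step m r t : 0 <= r < t ->
  (h^-1%:E * \int[leb]_(s in `[r, t]) (orbit G (ones m) x s)%:E +
   \int[leb]_(s in `[r, t]) (orbit G (kills m) x s)%:E =
   (orbit G (g m) x r - orbit G (g m) x t)%:E +
   h^-1%:E * \int[leb]_(s in `[r, t]) (orbit G (g m) x s)%:E)%E.
Proof.
move=> rt; have sg := partial_sol_ell2 G h0 m.
have s1 := ones_ell2 m; have s2 := kills_ell2 m.
have ih : 0 <= h^-1 by rewrite invr_ge0 ltW.
have hn0 : h != 0 by rewrite gt_eqF.
have L := partial_sol_operator G h0 m.
set l := (fun y => h^-1 * _) in L; have [_ sl] := form_operator_ell2 L.
have E s : h^-1 * orbit G (ones m) x s + orbit G (kills m) x s =
    orbit G l x s + h^-1 * orbit G (g m) x s.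
  rewrite [RHS]addrC -!orbit_linear//.
  congr orbit; apply/funext => y.
  rewrite /l /source /ones /kills /restrict_first; case: ifP => _; last by ring.
  by move: (ka y / mu y) => c; field.
rewrite -(orbit_FTC x L rt).
rewrite -ge0_integralZl_EFin//; last 2 first.
- by move=> s _; rewrite lee_fin ones_orbit_ge0.
- exact: (orbit_measurable s1).
rewrite -ge0_integralD//; last 4 first.
- by move=> s _; rewrite mule_ge0// lee_fin// ones_orbit_ge0.
- by apply: emeasurable_funM; [exact: measurable_cst|exact: (orbit_measurable s1)].
- by move=> s _; rewrite lee_fin kills_orbit_ge0.
- exact: (orbit_measurable s2).
rewrite -(integralZl _ (orbit_integrable r t sg))//.
rewrite -integralD//; last 2 first.
- exact: orbit_integrable.
- by apply: integrableZl => //; exact: orbit_integrable.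
by apply: eq_integral => s _; rewrite -!EFinM -!EFinD E.
Qed.

Lemma balance r t : 0 <= r < t ->
  (h^-1%:E * \int[leb]_(s in `[r, t]) (survival s)%:E +
   \int[leb]_(s in `[r, t]) kill_rate s =
   (confined h r - confined h t)%:E +
   h^-1%:E * \int[leb]_(s in `[r, t]) (confined h s)%:E)%E.
Proof.
move=> rt; have ih : 0 <= h^-1 by rewrite invr_ge0 ltW.
have c1 : (\int[leb]_(s in `[r, t]) (orbit G (ones m) x s)%:E @[m --> \oo] -->
    \int[leb]_(s in `[r, t]) (survival s)%:E)%E.
  have -> : (\int[leb]_(s in `[r, t]) (survival s)%:E =
      \int[leb]_(s in `[r, t]) limn (fun m => (orbit G (ones m) x s)%:E))%E.
    by apply: eq_integral => s _; rewrite EFin_lim//; exact: survival_cvg.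
  apply: cvg_monotone_convergence => //.
  - by move=> m; exact: (orbit_measurable (ones_ell2 m)).
  - by move=> m s _; rewrite lee_fin ones_orbit_ge0.
  - by move=> s _ m n mn; rewrite lee_fin; exact: ones_orbit_nd.
have c2 : (\int[leb]_(s in `[r, t]) (orbit G (kills m) x s)%:E @[m --> \oo] -->
    \int[leb]_(s in `[r, t]) kill_rate s)%E.
  apply: cvg_monotone_convergence => //.
  - by move=> m; exact: (orbit_measurable (kills_ell2 m)).
  - by move=> m s _; rewrite lee_fin kills_orbit_ge0.
  - by move=> s _; exact: kills_orbit_nd.
have c3 : (\int[leb]_(s in `[r, t]) (orbit G (g m) x s)%:E @[m --> \oo] -->
    \int[leb]_(s in `[r, t]) (confined h s)%:E)%E.
  have -> : (\int[leb]_(s in `[r, t]) (confined h s)%:E =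
      \int[leb]_(s in `[r, t]) limn (fun m => (orbit G (g m) x s)%:E))%E.
    by apply: eq_integral => s _; rewrite EFin_lim//; exact: confined_cvg.
  apply: cvg_monotone_convergence => //.
  - by move=> m; exact: (orbit_measurable (partial_sol_ell2 G h0 m)).
  - by move=> m s _; rewrite lee_fin partial_orbit_ge0.
  - by move=> s _ m n mn; rewrite lee_fin; exact: partial_orbit_nd.
have int_ge0 (F : R -> \bar R) : (forall s, 0 <= F s)%E ->
    (0 <= \int[leb]_(s in `[r, t]) F s)%E by move=> F0; exact: integral_ge0.
have c4 : ((orbit G (g m) x r - orbit G (g m) x t)%:E @[m --> \oo] -->
    (confined h r - confined h t)%:E)%E.
  apply: cvg_EFin; first exact: nearW.
  by apply: cvgB; exact: confined_cvg.
have C1 : (h^-1%:E * \int[leb]_(s in `[r, t]) (orbit G (ones m) x s)%:E +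
    \int[leb]_(s in `[r, t]) (orbit G (kills m) x s)%:E @[m --> \oo] -->
    h^-1%:E * \int[leb]_(s in `[r, t]) (survival s)%:E +
    \int[leb]_(s in `[r, t]) kill_rate s)%E.
  apply: cvgeD c2; last exact: (cvgeZl _ c1).
  apply: ge0_adde_def; rewrite inE.
    apply: mule_ge0; first by rewrite lee_fin.
    by apply: int_ge0 => s; rewrite lee_fin survival_ge0.
  by apply: int_ge0 => s; exact: kill_rate_ge0.
have C2 : ((orbit G (g m) x r - orbit G (g m) x t)%:E +
    h^-1%:E * \int[leb]_(s in `[r, t]) (orbit G (g m) x s)%:E @[m --> \oo] -->
    (confined h r - confined h t)%:E +
    h^-1%:E * \int[leb]_(s in `[r, t]) (confined h s)%:E)%E.
  by apply: cvgeD => //; exact: cvgeZl.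
move: C1; under eq_fun do rewrite balance_step//.
move=> C1; exact: cvg_unique C1 C2.
Qed.

(* Everything in this form of the balance is nonnegative, hence finite. *)
Lemma escape_balance t : 0 <= t ->
  (\int[leb]_(s in `[0%R, t]) kill_rate s +
   h^-1%:E * \int[leb]_(s in `[0%R, t]) (escaped s)%:E =
   (1 - e x - confined h t)%:E)%E.
Proof.
rewrite le_eqVlt => /predU1P[<-|t0].
  by rewrite set_itv1 !integral_set1 mule0 adde0 confined0 subrr.
have ih : 0 <= h^-1 by rewrite invr_ge0 ltW.
have rt : (0 : R) <= 0 < t by rewrite lexx.
have := balance rt; rewrite confined0.
have mc := @confined_measurable `[0%R, t]; have ms := @survival_measurable `[0%R, t].
have me : measurable_fun (`[0%R, t] : set R) (EFin \o escaped).
  apply/measurable_EFinP; apply: measurable_funB.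
    exact/measurable_EFinP.
  exact/measurable_EFinP.
have Ic : (0 <= \int[leb]_(s in `[0%R, t]) (confined h s)%:E)%E.
  by apply: integral_ge0 => s _; rewrite lee_fin confined_ge0.
have Ie : (0 <= \int[leb]_(s in `[0%R, t]) (escaped s)%:E)%E.
  by apply: integral_ge0 => s _; rewrite lee_fin escaped_ge0.
have fin : (\int[leb]_(s in `[0%R, t]) (confined h s)%:E \is a fin_num)%E.
  rewrite ge0_fin_numE//; apply: (@le_lt_trans _ _ (\int[leb]_(s in `[0%R, t]) (cst 1%:E s))%E).
    apply: ge0_le_integral => //.
    - by move=> s _; rewrite lee_fin confined_ge0.
    - by move=> s _; rewrite lee_fin (le_trans (confined_le_survival s)) ?survival_le1.
  rewrite integral_cst// mul1e.
  have := @lebesgue_measure_itv R `[0%R, t]; rewrite /= lte_fin t0 => H.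
  by apply: le_lt_trans (ltry t); rewrite H -EFinB subr0.
have -> : (\int[leb]_(s in `[0%R, t]) (survival s)%:E =
    \int[leb]_(s in `[0%R, t]) (confined h s)%:E +
    \int[leb]_(s in `[0%R, t]) (escaped s)%:E)%E.
  rewrite -ge0_integralD//.
  - by apply: eq_integral => s _; rewrite -EFinD /escaped addrC subrK.
  - by move=> s _; rewrite lee_fin confined_ge0.
  - by move=> s _; rewrite lee_fin escaped_ge0.
rewrite ge0_muleDr//.
move: fin => /fineK <-; set c := fine _; move: Ie.
move: (\int[leb]_(s in _) _)%E => E1 E10; move: (\int[leb]_(s in _) _)%E => E2.
have [hp] : 0 < h^-1 /\ True by rewrite invr_gt0.
move: E1 E2 E10 => [a| |] [b| |] //=.
- by rewrite -!EFinM -!EFinD => _ _ [H]; congr EFin; move: H; lra.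
all: by rewrite gt0_muley ?lte_fin.
Qed.

Definition kill_mass t : R := fine (\int[leb]_(s in `[0%R, t]) kill_rate s).
Definition escape_mass t : R := fine (\int[leb]_(s in `[0%R, t]) (escaped s)%:E).

Lemma kill_integral_ge0 t : (0 <= \int[leb]_(s in `[0%R, t]) kill_rate s)%E.
Proof. by apply: integral_ge0 => s _; exact: kill_rate_ge0. Qed.

Lemma escaped_integral_ge0 t : (0 <= \int[leb]_(s in `[0%R, t]) (escaped s)%:E)%E.
Proof. by apply: integral_ge0 => s _; rewrite lee_fin escaped_ge0. Qed.

Lemma escape_balance_fin t : 0 <= t ->
  [/\ (\int[leb]_(s in `[0%R, t]) kill_rate s)%E = (kill_mass t)%:E,
      (\int[leb]_(s in `[0%R, t]) (escaped s)%:E)%E = (escape_mass t)%:E &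
      kill_mass t + h^-1 * escape_mass t = 1 - e x - confined h t].
Proof.
move=> t0; have := escape_balance t0; rewrite /kill_mass /escape_mass.
have := kill_integral_ge0 t; have := escaped_integral_ge0 t.
have hp : 0 < h^-1 by rewrite invr_gt0.
move: (\int[leb]_(s in _) (escaped s)%:E)%E => A.
move: (\int[leb]_(s in _) kill_rate s)%E => B.
move: A B => [a| |] [b| |] //=; try by rewrite gt0_muley ?lte_fin.
by rewrite -EFinM -EFinD => _ _ [H]; split.
Qed.

Lemma escaped_measurable (D : set R) : measurable_fun D (EFin \o escaped).
Proof.
have mc := @confined_measurable D; have ms := @survival_measurable D.
apply/measurable_EFinP; apply: measurable_funB.
  exact/measurable_EFinP.
exact/measurable_EFinP.
Qed.

Lemma escape_mass_mono r t : 0 <= r -> r <= t -> escape_mass r <= escape_mass t.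
Proof.
move=> r0 rt; have t0 := le_trans r0 rt.
have [_ E1 _] := escape_balance_fin r0; have [_ E2 _] := escape_balance_fin t0.
rewrite -lee_fin -E1 -E2; apply: ge0_subset_integral => //.
- exact: escaped_measurable.
- by move=> s _; rewrite lee_fin escaped_ge0.
- by apply: subset_itvl; rewrite bnd_simp.
Qed.

Lemma escape_mass_lower t c : 0 <= t -> 0 <= c ->
  (forall s, 0 <= s <= t -> c <= escaped s) -> t * c <= escape_mass t.
Proof.
move=> t0 c0 H; have [_ E _] := escape_balance_fin t0.
rewrite -lee_fin -E.
apply: (@le_trans _ _ (\int[leb]_(s in `[0%R, t]) (cst c%:E s))%E).
  rewrite integral_cst//; have := @lebesgue_measure_itv R `[0%R, t].
  rewrite /= => L; have -> : leb `[0%R, t] = t%:E.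
    rewrite L lte_fin; case: ltP => [_|t0']; first by rewrite -EFinB subr0.
    by congr EFin; apply/eqP; rewrite eq_le t0.
  by rewrite -EFinM mulrC.
apply: ge0_le_integral => //.
exact: escaped_measurable.
Qed.

End one_mesh.

Lemma escape_mass_ge0 h t : 0 < h -> 0 <= escape_mass h t.
Proof. by move=> h0; apply: fine_ge0; exact: escaped_integral_ge0. Qed.

(** Up to [e / 2] the mass P_t 1 comes from finitely many vertices, where the defect is at most
    [h * degree]; [h] is chosen against the sum of their degrees. *)
Lemma escaped_small t e : 0 <= t -> 0 < e -> exists2 h, 0 < h & escaped h t <= e.
Proof.
move=> t0 e0; have e2 : 0 < e / 2 by rewrite divr_gt0.
have /cvgrPdist_le /(_ _ e2) [k _ /(_ k (leqnn k)) hk] := @survival_cvg t.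
set S := \sum_(z <- first_vertices k) degree G z.
have S0 : 0 <= S by apply: sumr_ge0 => z _; exact: degree_ge0.
have S1 : 0 < S + 1 by rewrite ltr_wpDl.
exists (e / 2 / (S + 1)); first by rewrite divr_gt0.
set h := e / 2 / (S + 1); have h0 : 0 < h by rewrite divr_gt0.
have := ones_orbit_le_confined h0 k t.
have : \sum_(z <- first_vertices k) defect G h z * orbit G (delta R z) x t <= h * S.
  rewrite mulr_sumr; apply: ler_sum => z _.
  apply: le_trans (_ : defect G h z * 1 <= _).
    rewrite ler_wpM2l ?defect_ge0//; apply: orbit_le1.
      exact/finsupp_ell2/finsupp_delta.
    by move=> y; rewrite /delta; case: (y == z); rewrite ?lexx ?ler01.
  by rewrite mulr1; exact: defect_small.
have : h * S <= e / 2.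
  rewrite /h -mulrA ler_piMr ?(ltW e2)// mulrC ler_pdivrMr// mul1r.
  by rewrite lerDl.
move: hk; rewrite ler_distl => /andP[H1 H2] H3 H4 H5.
rewrite /escaped; move: H1 H2 H3 H4 H5.
move: (\sum_(_ <- _) _) => u; move: (orbit _ _ _ _) => v; lra.
Qed.

(** By [escape_balance_fin] the total is [1 - defect + escaped - escape_mass / h] for every [h]. The
    escape mass grows with time, and [escaped] at the later time is arbitrarily small for suitable
    [h], while the total does not involve [h]. *)
Lemma mass_mono r t : 0 <= r -> r <= t ->
  survival t + kill_mass t <= survival r + kill_mass r.
Proof.
move=> r0 rt; have t0 := le_trans r0 rt.
apply/ler_addgt0Pr => e e0; have [h h0 he] := escaped_small t0 e0.
have [_ _ E1] := escape_balance_fin h0 r0; have [_ _ E2] := escape_balance_fin h0 t0.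
have M := escape_mass_mono h0 r0 rt.
have hi : 0 < h^-1 by rewrite invr_gt0.
have {}M : h^-1 * escape_mass h r <= h^-1 * escape_mass h t by rewrite ler_pM2l.
have := escaped_ge0 h0 r; move: he; rewrite /escaped; lra.
Qed.

End escape.

(** * Completeness as a Liouville property *)

Section completeness.
Variables (R : realType) (X : countType) (G : graph R X).
Local Notation leb := (@lebesgue_measure R).
Implicit Types (h t : R) (x y : X).

Definition total_mass x t : R := survival G x t + kill_mass G x t.

Lemma completeE t : 0 < t ->
  (forall x, (heat_ext G t (fun=> 1%R) x +
     \int[leb]_(s in `[0%R, t])
       heat_ext G s (fun y => (killing G y / vmeas G y)%R) x = 1)%E) <->
  (forall x, total_mass x t = 1).
Proof.
move=> t0; have E x : (heat_ext G t (fun=> 1%R) x +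
     \int[leb]_(s in `[0%R, t])
       heat_ext G s (fun y => (killing G y / vmeas G y)%R) x)%E = (total_mass x t)%:E.
  have [K _ _] := escape_balance_fin G x ltr01 (ltW t0).
  rewrite (heat_ext_one G x (ltW t0)) EFinD -K; congr (_ + _)%E.
  apply: eq_integral => s; rewrite inE /= in_itv /= => /andP[s0 _].
  exact: heat_ext_kill.
by split=> H x; have := H x; rewrite E; [case|move=> ->].
Qed.

Lemma total_mass0 x : total_mass x 0 = 1.
Proof.
rewrite /total_mass survival0 /kill_mass set_itv1 integral_set1 /=.
by rewrite addr0.
Qed.

Lemma defect0_total_mass h t x : 0 < h -> 0 <= t -> (forall y, defect G h y = 0) ->
  total_mass x t = 1.
Proof.
move=> h0 t0 e0.
have esc s : escaped G x h s = 0.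
  apply/eqP; rewrite eq_le escaped_ge0// andbT /escaped.
  have := @survival_le_confined _ _ G x h h0 0 s.
  by rewrite mul0r addr0 subr_le0; apply => y; rewrite e0.
have [_ _] := escape_balance_fin G x h0 t0.
have -> : escape_mass G x h t = 0.
  rewrite /escape_mass (_ : (fun s => _) = fun=> 0%E) ?integral0//.
  by apply/funext => s; rewrite esc.
have := esc t; rewrite /escaped /total_mass e0; lra.
Qed.

(** By [mass_mono] the mass stays 1 on [0, t], so [escaped] equals [defect + escape_mass / h] there.
    It is thus at least [defect], its integral is at least [t * defect], and at time [t] it is at
    least [(1 + t / h) * defect]. Since it is also at most the supremum E of [defect], (1 + t / h) E
    <= E. *)
Lemma total_mass_defect0 h t x : 0 < h -> 0 < t -> (forall y, total_mass y t = 1) ->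
  defect G h x = 0.
Proof.
move=> h0 t0 N1; have t0' := ltW t0.
have hi : 0 < h^-1 by rewrite invr_gt0.
pose S := [set r | exists y, r = defect G h y].
have hS : has_sup S.
  by split; [exists (defect G h x), x|exists 1 => _ [y ->]; exact: defect_le1].
set E := sup S.
have eE y : defect G h y <= E by apply: sup_upper_bound => //; exists y.
have E0 : 0 <= E by exact: le_trans (defect_ge0 G h0 x) (eE x).
have Nr r y : 0 <= r <= t -> total_mass y r = 1.
  move=> /andP[r0 rt]; apply/eqP; rewrite eq_le; apply/andP; split.
    by rewrite -(total_mass0 y); exact: mass_mono.
  by rewrite -(N1 y); exact: mass_mono.
have esc r y : 0 <= r <= t ->
    escaped G y h r = defect G h y + h^-1 * escape_mass G y h r.
  move=> rt; have [r0 _] := andP rt.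
  have [_ _] := escape_balance_fin G y h0 r0.
  by have := Nr r y rt; rewrite /escaped /total_mass; lra.
have key y : (1 + h^-1 * t) * defect G h y <= E.
  have e0 := defect_ge0 G h0 y.
  have low : t * defect G h y <= escape_mass G y h t.
    apply: escape_mass_lower => // s st; rewrite esc// lerDl mulr_ge0 ?(ltW hi)//.
    exact: escape_mass_ge0.
  have tt : 0 <= t <= t by rewrite t0' lexx.
  have := esc t y tt; have := @survival_le_confined _ _ G y h h0 E t eE.
  have := survival_le1 G y t; have := survival_ge0 G y t; rewrite /escaped.
  move: low => /(ler_wpM2l (ltW hi)).
  move: (survival G y t) (confined G y h t) (escape_mass _ _ _ _) => p g m.
  move=> H1 p0 p1 H2 H3.
  have : E * p <= E by rewrite ler_piMr.
  by move: H1; rewrite mulrA; lra.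
have ht : 0 < h^-1 * t by rewrite mulr_gt0.
have le y : defect G h y <= E / (1 + h^-1 * t).
  by rewrite ler_pdivlMr ?addr_gt0// mulrC key.
have EE : E <= E / (1 + h^-1 * t).
  by apply: ge_sup => [|_ [y ->]]; [exists (defect G h x), x|exact: le].
have {}E0 : E <= 0.
  move: EE; rewrite ler_pdivlMr ?addr_gt0// mulrDr mulr1 gerDl.
  by rewrite pmulr_lle0.
by apply/eqP; rewrite eq_le defect_ge0// andbT (le_trans (eE x)).
Qed.

Lemma complete_defect0 h x : 0 < h -> stochastically_complete_at_infinity G ->
  defect G h x = 0.
Proof.
move=> h0 [t t0 H]; apply: (total_mass_defect0 x h0 t0).
exact: (proj1 (completeE t0) H).
Qed.

Lemma defect0_complete h : 0 < h -> (forall x, defect G h x = 0) ->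
  stochastically_complete_at_infinity G.
Proof.
move=> h0 e0; exists 1 => //; apply: (proj2 (completeE ltr01)) => x.
exact: (defect0_total_mass x h0 ler01 e0).
Qed.

Lemma laplacianZ c f x : bounded_fun f ->
  laplacian G (fun y => c * f y) x = c * laplacian G f x.
Proof.
move=> bf; have [M fM] := bf.
have bcf : bounded_fun (fun y => c * f y).
  by exists (`|c| * M) => y; rewrite normrM ler_wpM2l.
rewrite !laplacianE// /wsum.
under [X in rsum X](_ : _ = fun y => c * (weight G x y * f y)).
  by apply/funext => y; rewrite mulrCA.
by rewrite rsumZ; [ring|exact: asum_weightM].
Qed.

(** Scaled into [0, 1], [s] competes with [defect] in [defect_max]. *)
Lemma complete_liouville h (s : X -> R) x : 0 < h ->
  stochastically_complete_at_infinity G -> bounded_fun s ->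
  (forall y, 0 <= s y) -> (forall y, s y + h * laplacian G s y <= 0) -> s x = 0.
Proof.
move=> h0 sc bs s0 sl; have [M sM] := bs.
have M0 : 0 <= M by apply: le_trans (sM x).
have M1 : 0 < M + 1 by rewrite ltr_wpDl.
have Mi : 0 < (M + 1)^-1 by rewrite invr_gt0.
have : (M + 1)^-1 * s x <= defect G h x.
  apply: (@defect_max _ _ G h h0 (fun y => (M + 1)^-1 * s y)) => y.
    rewrite mulr_ge0 ?(ltW Mi)//= mulrC ler_pdivrMr// mul1r.
    by have := ler_norm (s y); have := sM y; lra.
  by rewrite laplacianZ// mulrCA -mulrDr pmulr_rle0.
rewrite complete_defect0// pmulr_rle0// => H.
by apply/eqP; rewrite eq_le H s0.
Qed.

(** With E the supremum, [defect_max] applied to [defect / E] gives defect <= E^2 everywhere, hence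
    E <= E^2, which excludes 0 < E <= c < 1. *)
Lemma incomplete_defect_sup h c : 0 < h ->
  ~ stochastically_complete_at_infinity G -> c < 1 -> exists x, c < defect G h x.
Proof.
move=> h0 nsc c1; apply: contrapT => H.
have ec y : defect G h y <= c.
  by rewrite leNgt; apply/negP => yc; apply: H; exists y.
apply: nsc; apply: (defect0_complete h0) => x.
apply/eqP; rewrite eq_le defect_ge0// andbT leNgt; apply/negP => ex.
have c0 : 0 < c by exact: lt_le_trans ex (ec x).
have cc : c < 1 by [].
pose S := [set r | exists y, r = defect G h y].
have hS : has_sup S.
  by split; [exists (defect G h x), x|exists 1 => _ [y ->]; exact: defect_le1].
set E := sup S.
have eE y : defect G h y <= E by apply: sup_upper_bound => //; exists y.
have E0 : 0 < E by exact: lt_le_trans ex (eE x).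
have Ec : E <= c by apply: ge_sup => [|_ [y ->]]; [exists (defect G h x), x|exact: ec].
have bd := defect_bounded G h0.
have le y : defect G h y <= E ^+ 2.
  have : E^-1 * defect G h y <= defect G h y.
    apply: (@defect_max _ _ G h h0 (fun y => E^-1 * defect G h y)) => z.
      by rewrite mulr_ge0 ?invr_ge0 ?(ltW E0) ?defect_ge0//= mulrC ler_pdivrMr// mul1r.
    rewrite laplacianZ// defect_laplacian// [leLHS](_ : _ = 0)//.
    by field; rewrite !gt_eqF.
  rewrite mulrC ler_pdivrMr// => H1.
  rewrite expr2; apply: le_trans H1 _; rewrite ler_wpM2r ?(ltW E0)//.
have : E <= E ^+ 2.
  by apply: ge_sup => [|_ [y ->]]; [exists (defect G h x), x|exact: le].
rewrite expr2 ler_pMl// => E1.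
by have := le_lt_trans (le_trans E1 Ec) cc; rewrite ltxx.
Qed.

End completeness.

(** * Growth estimates and limits on the real line *)

Section dini_estimates.
Variable R : realType.
Local Notation leb := (@lebesgue_measure R).
Implicit Types (f z Q : R -> R) (a b t s e : R).

Lemma is_derive_bound f t l e : is_derive t 1 f l -> 0 < e -> exists2 d, 0 < d &
  forall s, `|s - t| < d -> `|f s - f t - (s - t) * l| <= e * `|s - t|.
Proof.
move=> [df fl] e0; have c : h^-1 *: ((f \o shift t) h - f t) @[h --> 0^'] --> l.
  rewrite -fl; have E : (fun h => h^-1 *: ((f \o shift t) (h *: 1) - f t)) =
      (fun h => h^-1 *: ((f \o shift t) h - f t)).
    by apply/funext => h; rewrite [h *: 1]mulr1.
  by move: df; rewrite /derivable /derive E.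
move: c => /cvgrPdist_le /(_ _ e0) [d /= d0 hd]; exists d => // s st.
have [->|sn] := eqVneq s t; first by rewrite !subrr mul0r subr0 normr0 mulr0.
have h0 : s - t != 0 by rewrite subr_eq0.
have := hd (s - t); rewrite /= sub0r normrN => /(_ st h0); rewrite subrK => H.
have -> : f s - f t - (s - t) * l = - ((s - t) * (l - (s - t)^-1 *: (f s - f t))).
  by rewrite mulrBr /GRing.scale /= mulVKf// opprB.
by rewrite normrN normrM mulrC ler_wpM2r.
Qed.

Lemma is_derive_continuous f t l : is_derive t 1 f l -> {for t, continuous f}.
Proof. by move=> [df _]; apply: differentiable_continuous; exact/derivable1_diffP. Qed.

Lemma continuous_for_eps f t e : {for t, continuous f} -> 0 < e ->
  exists2 d, 0 < d & forall s, `|s - t| < d -> `|f s - f t| <= e.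
Proof.
move=> /cvgrPdist_le /(_ _) H e0; have [d /= d0 hd] := H _ e0; exists d => // s st.
by rewrite distrC; apply: hd => /=; rewrite distrC.
Qed.

(** Composition with [clamp a b] extends a function continuous on [a, b] to a continuous function on
    the whole line. *)
Definition clamp a b t := Num.max a (Num.min t b).

Lemma clamp_in a b t : a <= b -> a <= clamp a b t <= b.
Proof. by move=> ab; rewrite /clamp le_max lexx/= ge_max ab ge_min lexx orbT. Qed.

Lemma clamp_id a b t : a <= t <= b -> clamp a b t = t.
Proof. by move=> /andP[at_ tb]; rewrite /clamp min_l// max_r. Qed.

Lemma clamp_mono a b t s : t <= s -> clamp a b t <= clamp a b s.
Proof.
by move=> ts; rewrite /clamp ge_max !le_max lexx /= le_min !ge_min ts lexx !orbT.
Qed.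

Lemma clamp_lipschitz a b t s : `|clamp a b t - clamp a b s| <= `|t - s|.
Proof.
have key p q : p <= q -> clamp a b q <= clamp a b p + (q - p).
  move=> pq; rewrite ge_max; apply/andP; split.
    by rewrite (@le_trans _ _ (clamp a b p)) ?lerDl ?subr_ge0// le_max lexx.
  rewrite ge_min; case: (leP p b) => pb; apply/orP; [left|right].
    by rewrite -[leLHS](subrKC p) lerD2r le_max le_min lexx pb orbT.
  by rewrite (@le_trans _ _ (clamp a b p)) ?lerDl ?subr_ge0// le_max le_min lexx (ltW pb) orbT.
case/orP: (le_total t s) => h; [rewrite distrC (distrC t)|];
  by rewrite !ger0_norm ?subr_ge0 ?clamp_mono// lerBlDl key.
Qed.

Lemma clamp_continuous a b : continuous (clamp a b).
Proof.
move=> t; apply/cvgrPdist_le => e e0; exists e => // s /= ts.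
exact: le_trans (clamp_lipschitz a b t s) (ltW ts).
Qed.

Lemma within_continuous_eps (A : set R) f g : (forall t, A t -> f t = g t) ->
  (forall t, A t -> forall e, 0 < e -> exists2 d, 0 < d &
    forall s, A s -> `|s - t| < d -> `|g s - g t| <= e) ->
  {within A, continuous f}.
Proof.
move=> fg cg; apply/subspace_continuousP => t At; apply/cvgrPdist_le => e e0.
have [d d0 hd] := cg t At e e0; exists d => // s /= st As.
have := hd s As; rewrite -(fg t At) -(fg s As) distrC (distrC (f s)); exact.
Qed.

Lemma within_clamp f a b : a <= b -> {within `[a, b], continuous f} ->
  continuous (f \o clamp a b).
Proof.
move=> ab /subspace_continuousP cf t.
have ct := clamp_in t ab; have ct' : `[a, b]%classic (clamp a b t) by rewrite /= in_itv.
apply/cvgrPdist_le => e e0.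
have /cvgrPdist_le /(_ e e0) H := cf _ ct'.
have /= := @clamp_continuous a b t _ H; rewrite /nbhs /=.
apply: (@filterS _ (nbhs t)) => s; apply.
by rewrite /= in_itv /= clamp_in.
Qed.

(** Solutions are differentiable only inside the time interval, so growth is controlled on the open
    interval and continuity reaches the two ends. *)
Lemma dini_open f a b : a < b -> (forall t, a <= t <= b -> {for t, continuous f}) ->
  (forall t, a < t < b -> forall e, 0 < e -> exists2 d, 0 < d &
     forall s, t < s < t + d -> f s <= f t + e * (s - t)) ->
  f b <= f a.
Proof.
move=> ab fc fd; apply/ler_addgt0Pr => e e0; have e2 : 0 < e / 2 by rewrite divr_gt0.
have [d d0 hd] := continuous_for_eps (fc a ltac:(rewrite lexx; lra)) e2.
have [c c0 hc] := continuous_for_eps (fc b ltac:(rewrite lexx; lra)) e2.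
pose r := Num.min (Num.min d c / 2) ((b - a) / 3).
have r0 : 0 < r by rewrite lt_min !divr_gt0 ?lt_min ?d0 ?c0//; lra.
have rd : r < d.
  rewrite gt_min; apply/orP; left; rewrite ltr_pdivrMr// gt_min; apply/orP; left; lra.
have rc : r < c.
  rewrite gt_min; apply/orP; left; rewrite ltr_pdivrMr// gt_min; apply/orP; right; lra.
have rb : r <= (b - a) / 3 by rewrite ge_min lexx orbT.
have H1 : `|f (a + r) - f a| <= e / 2 by apply: hd; rewrite addrC addKr gtr0_norm.
have H2 : `|f (b - r) - f b| <= e / 2.
  by apply: hc; rewrite addrC addKr normrN gtr0_norm.
have H3 : f (b - r) <= f (a + r).
  apply: dini_nonincreasing; first lra.
    move=> t t1 e' e'0; have [k k0 hk] := continuous_for_eps (fc t ltac:(lra)) e'0.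
    by exists k => // s _; exact: hk.
  move=> t t1 e' e'0; have [k k0 hk] := fd t ltac:(lra) _ e'0.
  by exists k => // s /andP[ts _] sk; apply: hk; rewrite ts.
move: H1 H2; rewrite !ler_norml; lra.
Qed.

(** One-sided form of |z|' <= sg(z) z'. At a zero of [z] the norm has a corner and grows at the rate
    |l|, hence the separate hypothesis. *)
Lemma norm_right_growth z t l c e : is_derive t 1 z l ->
  (z t != 0 -> Num.sg (z t) * l <= c) -> (z t = 0 -> `|l| <= c) -> 0 < e ->
  exists2 d, 0 < d & forall s, t < s < t + d -> `|z s| <= `|z t| + (c + e) * (s - t).
Proof.
move=> zl zn z0 e0; have [d d0 hd] := is_derive_bound zl e0.
have near s : t < s < t + d -> `|z s - z t - (s - t) * l| <= e * (s - t).
  move=> /andP[ts sd]; have st : 0 < s - t by rewrite subr_gt0.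
  by have := hd s; rewrite gtr0_norm// ltrBlDl => /(_ sd).
have [E|nE] := eqVneq (z t) 0.
  exists d => // s std; have := near s std; rewrite E normr0 add0r subr0 => H.
  have st : 0 < s - t by case/andP: std => ? _; rewrite subr_gt0.
  have : `|z s| <= `|z s - (s - t) * l| + `|(s - t) * l|.
    by rewrite -{1}(subrK ((s - t) * l) (z s)) ler_normD.
  rewrite normrM (gtr0_norm st); have := ler_wpM2l (ltW st) (z0 E).
  move: H; move: (`|_ - _|) (`|z s|) (`|l|) => p q r; lra.
have nz : 0 < `|z t| by rewrite normr_gt0.
have [k k0 hk] := continuous_for_eps (is_derive_continuous zl)
  (divr_gt0 nz (ltr0Sn R 1) : 0 < `|z t| / 2).
exists (Num.min d k); first by rewrite lt_min d0.
move=> s /andP[ts]; rewrite -ltrBlDl lt_min => /andP[]; rewrite !ltrBlDl => sd sk.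
have st : 0 < s - t by rewrite subr_gt0.
have H1 : `|z s - z t| <= `|z t| / 2 by apply: hk; rewrite gtr0_norm// ltrBlDl.
have H2 := near s; rewrite ts sd in H2; have {}H2 := H2 isT.
have H3 := ler_wpM2l (ltW st) (zn nE).
case: (ltrgtP (z t) 0) (nE) => // zt _.
  rewrite (ltr0_norm zt) in H1; rewrite (ltr0_sg zt) in H3.
  have zs : z s < 0 by move: H1; rewrite ler_norml; lra.
  by rewrite !ltr0_norm//; move: H2; rewrite ler_norml; lra.
rewrite (gtr0_norm zt) in H1; rewrite (gtr0_sg zt) in H3.
have zs : 0 < z s by move: H1; rewrite ler_norml; lra.
by rewrite !gtr0_norm//; move: H2; rewrite ler_norml; lra.
Qed.

(** Dini argument for [(b - t) |z t| + Q t]. Its right growth is at most the last quantity in the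
    hypothesis, and at both ends only [Q] remains, because [z a = 0] and the weight vanishes at
    [b]. *)
Lemma weighted_norm_decrease z Q (l c q : R -> R) a b : a < b -> z a = 0 ->
  (forall t, a <= t <= b -> {for t, continuous z}) ->
  (forall t, a <= t <= b -> {for t, continuous Q}) ->
  (forall t, a < t < b -> [/\ is_derive t 1 z (l t), is_derive t 1 Q (q t),
     z t != 0 -> Num.sg (z t) * l t <= c t, z t = 0 -> `|l t| <= c t &
     (b - t) * c t - `|z t| + q t <= 0]) ->
  Q b <= Q a.
Proof.
move=> ab za zc Qc H; pose f t := (b - t) * `|z t| + Q t.
have <- : f b = Q b by rewrite /f subrr mul0r add0r.
have <- : f a = Q a by rewrite /f za normr0 mulr0 add0r.
apply: dini_open => // t.
  move=> tab; apply: cvgD; last exact: Qc.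
  apply: cvgM; last by apply: cvg_norm; exact: zc.
  by apply: cvgB; [exact: cvg_cst|exact: cvg_id].
move=> tab e e0; have [zl Qq z1 z2 le0] := H t tab.
have e4 : 0 < e / 4 by rewrite divr_gt0.
have e5 : 0 < e / (4 * (b - t)) by rewrite divr_gt0// mulr_gt0//; lra.
have [d1 d10 h1] := norm_right_growth zl z1 z2 e5.
have [d2 d20 h2] := is_derive_bound Qq e4.
have [d3 d30 h3] := continuous_for_eps (is_derive_continuous zl) e4.
exists (Num.min (Num.min d1 (b - t)) (Num.min d2 d3)).
  by rewrite !lt_min d10 d20 d30 !andbT; lra.
move=> s /andP[ts]; rewrite -ltrBlDl !lt_min => /andP[/andP[sd1 sb] /andP[sd2 sd3]].
have st : 0 < s - t by rewrite subr_gt0.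
have := h1 s; rewrite ts -ltrBlDl sd1 => /(_ isT) H1.
have := h2 s; rewrite (gtr0_norm st) => /(_ sd2) H2.
have := h3 s; rewrite (gtr0_norm st) => /(_ sd3) H3.
rewrite /f.
have bt : 0 < b - t by lra.
have K1 := ler_wpM2l (ltW bt) H1.
have E : (b - t) * (e / (4 * (b - t))) = e / 4 by field; rewrite gt_eqF.
have K3 : `|z t| - `|z s| <= e / 4.
  by apply: le_trans H3; rewrite distrC; exact: lerB_dist.
have K4 := ler_wpM2l (ltW st) K3.
have K5 := ler_wpM2l (ltW st) le0.
move: H2; rewrite ler_norml => /andP[_ H2].
have K6 : (b - t) * (e / (4 * (b - t))) * (s - t) = e / 4 * (s - t) by rewrite E.
have K7 : 0 <= e * (s - t) by rewrite mulr_ge0 ?ltW.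
move: K1 K4 K5 K6 K7 H2; move: (`|z s|) (`|z t|) (Q s) (Q t) (c t) (q t) (e / (4 * _)).
move=> zs zt Qs Qt c' q' e'; lra.
Qed.

Lemma primitive_exists f : continuous f ->
  exists P, forall t, -1 < t -> is_derive t 1 P (f t).
Proof.
(* Starting at -1 makes 0 an interior point, so that the derivative there is two-sided. *)
move=> cf; pose P x := (\int[leb]_(s in `[-1, x]) f s)%R.
exists P => t t1; have tt : t < t + 1 by lra.
have I : leb.-integrable `[-1, t + 1] (EFin \o f).
  apply: continuous_compact_integrable; first exact: segment_compact.
  exact: continuous_subspaceT.
have [dP Pf] := @continuous_FTC1_closed R f (-1) t (t + 1) tt I t1 (cf t).
by apply: DeriveDef; [exact: dP|rewrite -derive1E; exact: Pf].
Qed.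

End dini_estimates.

(** * Mean value inequalities and limits along ultrafilters *)

Section derivatives_and_ultralimits.
Variable R : realType.
Implicit Types (f g : R -> R) (a b t s e : R).

Lemma is_derive_add f g t a b : is_derive t 1 f a -> is_derive t 1 g b ->
  is_derive t 1 (fun s => f s + g s) (a + b).
Proof. by move=> fa gb; exact: is_deriveD. Qed.

Lemma is_derive_scale f t a c : is_derive t 1 f a ->
  is_derive t 1 (fun s => c * f s) (c * a).
Proof. by move=> fa; exact: is_deriveZ. Qed.

Lemma is_derive_line c t : is_derive t 1 (fun s => c * s) c.
Proof.
apply: is_derive_eps => e e0; exists 1 => // y _.
have -> : c * y - c * t - (y - t) * c = 0 by ring.
by rewrite normr0 mulr_ge0 ?(ltW e0).
Qed.

Lemma is_derive_sumr (I : Type) (r : seq I) (F : I -> R -> R) (F' : I -> R) t :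
  (forall i, is_derive t 1 (F i) (F' i)) ->
  is_derive t 1 (fun s => \sum_(i <- r) F i s) (\sum_(i <- r) F' i).
Proof.
move=> dF; elim: r => [|i r ih].
  rewrite big_nil (_ : (fun s => _) = fun=> 0); first exact: is_derive_cst.
  by apply/funext => s; rewrite big_nil.
rewrite big_cons (_ : (fun s => _) = fun s => F i s + \sum_(j <- r) F j s).
  exact: is_derive_add.
by apply/funext => s; rewrite big_cons.
Qed.

Lemma is_derive_near f g t l d : 0 < d -> (forall s, `|s - t| < d -> f s = g s) ->
  is_derive t 1 f l -> is_derive t 1 g l.
Proof.
move=> d0 fg fl; apply: is_derive_eps => e e0.
have [c c0 hc] := is_derive_bound fl e0.
exists (Num.min c d); first by rewrite lt_min c0.
move=> s; rewrite lt_min => /andP[sc sd]; rewrite -!fg ?subrr ?normr0//.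
exact: hc.
Qed.

(** The case [z = 0] of [weighted_norm_decrease] is the mean value inequality. *)
Lemma derive_nonincreasing f (q : R -> R) a b : a < b ->
  (forall t, a <= t <= b -> {for t, continuous f}) ->
  (forall t, a < t < b -> is_derive t 1 f (q t) /\ q t <= 0) -> f b <= f a.
Proof.
move=> ab cf df.
apply: (@weighted_norm_decrease _ (fun=> 0) f (fun=> 0) (fun=> 0) q) => // t tab.
  exact: cst_continuous.
have [fq q0] := df t tab; split=> //; rewrite ?normr0//.
- exact: is_derive_cst.
- by rewrite eqxx.
- by rewrite mulr0 subrr add0r.
Qed.

Lemma derive_nondecreasing f (q : R -> R) a b : a < b ->
  (forall t, a <= t <= b -> {for t, continuous f}) ->
  (forall t, a < t < b -> is_derive t 1 f (q t) /\ 0 <= q t) -> f a <= f b.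
Proof.
move=> ab cf df; rewrite -lerN2.
have := @derive_nonincreasing (fun t => - f t) (fun t => - q t) a b ab.
apply=> t tab; first by apply: cvgN; exact: cf.
by have [fq q0] := df t tab; split; [exact: is_deriveN|rewrite oppr_le0].
Qed.

Lemma derive_zero_const f a b : a < b ->
  (forall t, a <= t <= b -> {for t, continuous f}) ->
  (forall t, a < t < b -> is_derive t 1 f 0) -> f b = f a.
Proof.
move=> ab cf df; apply/eqP; rewrite eq_le; apply/andP; split.
  by apply: (@derive_nonincreasing _ (fun=> 0)) => // t tab; split=> //; exact: df.
by apply: (@derive_nondecreasing _ (fun=> 0)) => // t tab; split=> //; exact: df.
Qed.

(** Along such a filter every bounded sequence converges, for all vertices and all times at once,
    which replaces the extraction of subsequences. *)
Lemma ultra_nat_exists : exists U : set_system nat,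
  UltraFilter U /\ \oo `<=` U.
Proof. exact: ultraFilterLemma. Qed.

Lemma ultra_bounded_cvg (U : set_system nat) (UU : UltraFilter U) (a : nat -> R) M :
  (forall n, `|a n| <= M) -> exists2 l : R, `|l| <= M & a n @[n --> U] --> l.
Proof.
move=> aM; have FU : ProperFilter U by exact: ultra_proper.
have Ha : (a @ U) `[- M, M]%classic.
  apply: (@filterE _ U) => n; rewrite /= in_itv /= -ler_norml; exact: aM.
have [l [lM cl]] := @segment_compact R (- M) M (a @ U) _ Ha.
exists l; first by move: lM; rewrite /= in_itv /= -ler_norml.
apply/cvgrPdist_le => e e0.
have [//|] := in_ultra_setVsetC [set n | `|l - a n| <= e] UU.
move=> H; have He : (a @ U) [set r | ~ (`|l - r| <= e)] by exact: H.
have Hl : nbhs l [set r | `|l - r| <= e].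
  by exists e => // r /= /ltW.
by have [r [/= r1 r2]] := cl _ _ He Hl.
Qed.

(** Uniform continuity in affine form, the substitute for a Lipschitz bound. If no [C = n + 1]
    worked, the witnesses would converge along an ultrafilter: equal limits contradict continuity,
    distinct ones make [(n + 1) |a - b|] unbounded. *)
Lemma continuous_modulus f (M e : R) : continuous f -> 0 < e -> exists2 C, 0 < C &
  forall a b, `|a| <= M -> `|b| <= M -> `|f a - f b| <= e + C * `|a - b|.
Proof.
move=> cf e0; apply: contrapT => H.
have /choice[ab abP] (n : nat) : exists p : R * R,
    [/\ `|p.1| <= M, `|p.2| <= M & e + n.+1%:R * `|p.1 - p.2| < `|f p.1 - f p.2|].
  apply: contrapT => Hn; apply: H; exists n.+1%:R => // a b aM bM.
  by rewrite leNgt; apply/negP => K; apply: Hn; exists (a, b).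
have [U [UU oU]] := ultra_nat_exists.
have FU : ProperFilter U by exact: ultra_proper.
have [l1 _ c1] := @ultra_bounded_cvg U UU (fun n => (ab n).1) M
  ltac:(by move=> n; have [] := abP n).
have [l2 _ c2] := @ultra_bounded_cvg U UU (fun n => (ab n).2) M
  ltac:(by move=> n; have [] := abP n).
have cd : `|(ab n).1 - (ab n).2| @[n --> U] --> `|l1 - l2|.
  by apply: cvg_norm; apply: cvgB.
have cF : `|f (ab n).1 - f (ab n).2| @[n --> U] --> `|f l1 - f l2|.
  apply: cvg_norm; apply: cvgB.
    by apply: continuous_cvg c1; exact: cf.
  by apply: continuous_cvg c2; exact: cf.
have [E|nE] := eqVneq l1 l2.
  have : e <= `|f l1 - f l2|.
    apply: cvgr_to_ge cF _; apply: nearW => n; have [_ _ /ltW] := abP n.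
    by apply: le_trans; rewrite lerDl mulr_ge0.
  by rewrite E subrr normr0 leNgt e0.
have d0 : 0 < `|l1 - l2| by rewrite normr_gt0 subr_eq0.
have n1 : \forall n \near U, `|l1 - l2| / 2 <= `|(ab n).1 - (ab n).2|.
  have d2 : 0 < `|l1 - l2| / 2 by rewrite divr_gt0.
  move/cvgrPdist_le : cd => /(_ _ d2); apply: filterS => n /=.
  rewrite ler_norml; move: (`|_|) (`|_|) => p q; lra.
have n2 : \forall n \near U, `|f (ab n).1 - f (ab n).2| <= `|f l1 - f l2| + 1.
  move/cvgrPdist_le : cF => /(_ _ ltr01); apply: filterS => n /=.
  rewrite ler_norml; move: (`|_|) (`|_|) => p q; lra.
pose K := `|f l1 - f l2| + 1.
have n3 : \forall n \near U, K / (`|l1 - l2| / 2) <= n.+1%:R.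
  apply: oU; exists (Num.bound (K / (`|l1 - l2| / 2))) => // n /= bn.
  have K0 : 0 <= K / (`|l1 - l2| / 2) by rewrite divr_ge0 ?addr_ge0// ltW// divr_gt0.
  apply: le_trans (ltW (archi_boundP K0)) _; rewrite ler_nat; exact: leqW.
have [n [[h1 h2] h3]] := @filter_ex _ U _ _ (filterI (filterI n1 n2) n3).
have [_ _] := abP n; move: h3; rewrite ler_pdivrMr ?divr_gt0// => h3.
have := ler_wpM2l (ler0n R n.+1) h1.
move: h1 h2 h3; rewrite /K; move: (`|_ - _|) (`|_ - _|) (`|f _ - f _|) => p q r; lra.
Qed.

End derivatives_and_ultralimits.

(** * Uniqueness on complete graphs *)

Section uniqueness.
Variables (R : realType) (X : countType) (G : graph R X).
Local Notation w := (weight G).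
Local Notation mu := (vmeas G).
Implicit Types (t s c k : R) (x y : X).

(** The neighbours outside [r] are negligible uniformly over functions bounded by [M], hence
    uniformly in time along a bounded family. *)
Lemma wsum_tail x M e : 0 < e -> exists2 r : seq X, uniq r & forall f,
  (forall y, `|f y| <= M) -> `|wsum G x f - \sum_(y <- r) w x y * f y| <= e.
Proof.
move=> e0; have sw : asum (fun y => w x y * `|M|).
  by apply: (asum_weightM G x); exists `|M| => y; rewrite normr_id.
have [r ur hr] := rsum_tail sw e0; exists r => // f fM.
have bf : bounded_fun f by exists M.
pose a y := if y \in r then w x y * f y else 0.
have sa : asum a by apply: (@asum_finsupp _ _ _ r) => y; rewrite /a => /negbTE ->.
have <- : rsum a = \sum_(y <- r) w x y * f y.
  rewrite (rsum_finsupp ur); last by move=> y; rewrite /a => /negbTE ->.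
  by apply: eq_big_seq => y yr; rewrite /a yr.
rewrite /wsum -rsumB//; last exact: asum_weightM.
apply: hr => y.
  rewrite /a; case: ifP => _; first by rewrite subrr normr0.
  rewrite subr0 !normrM normr_id ler_wpM2l//.
  by apply: le_trans (fM y) _; rewrite ler_norm.
by move=> yr; rewrite /a yr subrr.
Qed.

Lemma partial_le_wsum x (f : X -> R) r : bounded_fun f -> (forall y, 0 <= f y) ->
  uniq r -> \sum_(y <- r) w x y * f y <= wsum G x f.
Proof.
move=> bf f0 ur; apply: partial_le_rsum => //; first exact: asum_weightM.
by move=> y; rewrite mulr_ge0// weight_ge0.
Qed.

Lemma norm_wsum x f : bounded_fun f -> `|wsum G x f| <= wsum G x (fun y => `|f y|).
Proof.
move=> bf; apply: le_trans (ler_norm_rsum (asum_weightM G x bf)) _.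
rewrite le_eqVlt; apply/orP; left; apply/eqP; congr rsum; apply/funext => y.
by rewrite normrM ger0_norm// weight_ge0.
Qed.

(** Subtracting [c >= 0] lowers the Laplacian by c kappa / mu. Where [f > c], taking the positive
    part can only raise the neighbour sum; elsewhere the positive part is 0, its minimum, and its
    Laplacian is nonpositive. *)
Lemma sub_const_supersolution (f : X -> R) k c x : 0 < k -> 0 <= c ->
  bounded_fun f -> (forall y, f y - c + k * laplacian G f y <= 0) ->
  Num.max (f x - c) 0 + k * laplacian G (fun y => Num.max (f y - c) 0) x <= 0.
Proof.
move=> k0 c0 bf H; have bs : bounded_fun (fun y => Num.max (f y - c) 0).
  have [M fM] := bf; exists (M + c) => y; rewrite ger0_norm ?le_max ?lexx ?orbT//.
  rewrite ge_max; have := fM y; rewrite ler_norml; lra.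
have wm : wsum G x f - c * wdeg G x <= wsum G x (fun y => Num.max (f y - c) 0).
  rewrite /wdeg -rsumZ; last exact: asum_weight.
  rewrite /wsum -rsumB; [|exact: asum_weightM|exact/asumZ/asum_weight].
  apply: ler_rsum => [||y].
  - by apply: asumB; [exact: asum_weightM|exact/asumZ/asum_weight].
  - exact: asum_weightM.
  - by rewrite (mulrC c) -mulrBr ler_wpM2l ?weight_ge0// le_max lexx.
have w0 : 0 <= wsum G x (fun y => Num.max (f y - c) 0).
  by apply: wsum_ge0 => y; rewrite le_max lexx orbT.
have mi : 0 < (mu x)^-1 by rewrite invr_gt0 vmeas_gt0.
have := H x; rewrite !laplacian_degree//.
case: (leP (f x - c) 0) => fc.
  move=> _; rewrite add0r mulr0 sub0r pmulr_rle0// oppr_le0 mulr_ge0//.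
  exact: ltW.
move=> Hx; apply: le_trans Hx; rewrite lerD2l ler_pM2l//.
rewrite mulrBr; have : degree G x * c >= c * wdeg G x / mu x.
  by rewrite (mulrC _ c) -mulrA ler_wpM2l// /degree ler_pM2r// lerDl killing_ge0.
have := ler_wpM2r (ltW mi) wm; rewrite mulrBl.
move: (_ / _) (_ / _) (_ / _) (degree G x * c) (degree G x * f x) => p q r s t; lra.
Qed.

Section two_solutions.
Variables (T : R) (phi : R -> R) (u0 : X -> R) (u v : R -> X -> R).
Hypothesis T0 : 0 < T.
Hypothesis phiN : nonlinearity phi.
Hypothesis su : bounded_pointwise_solution G T phi u0 u.
Hypothesis sv : bounded_pointwise_solution G T phi u0 v.
Hypothesis scG : stochastically_complete_at_infinity G.

Lemma bounded_comp (u' : R -> X -> R) : bounded_pointwise_solution G T phi u0 u' ->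
  exists B, forall t x, 0 <= t <= T -> `|phi (u' t x)| <= B.
Proof.
have [cphi _ _ phi0] := phiN; move=> [_ [M uM]].
have [C C0 hC] := continuous_modulus M cphi ltr01.
exists (1 + C * M) => t x tT; have M0 : 0 <= M by apply: le_trans (uM t x tT).
have := hC (u' t x) 0 (uM t x tT); rewrite normr0 => /(_ M0).
rewrite phi0 !subr0 => /le_trans; apply.
by rewrite lerD2l ler_wpM2l ?(ltW C0)// uM.
Qed.

Lemma solution_is_derive (u' : R -> X -> R) t x :
  bounded_pointwise_solution G T phi u0 u' -> 0 < t < T ->
  is_derive t 1 (u' ^~ x) (- laplacian G (phi \o u' t) x).
Proof.
move=> [[_ r e _] _] tT; have [_ d _] := r x.
apply: DeriveDef; first exact: d.
by rewrite -derive1E; apply/eqP; rewrite -addr_eq0 e.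
Qed.

Lemma solution_clamp (u' : R -> X -> R) x :
  bounded_pointwise_solution G T phi u0 u' ->
  continuous (fun t => u' (clamp 0 T t) x).
Proof.
move=> [[_ r _ _] _]; have [c _ _] := r x.
exact: (within_clamp (ltW T0) c).
Qed.

Let z x t := u (clamp 0 T t) x - v (clamp 0 T t) x.
Let D t x := phi (u t x) - phi (v t x).
Let Phi x t := `|D (clamp 0 T t) x|.

Lemma solution_gap_continuous x : continuous (z x).
Proof. by move=> t; apply: cvgB; exact: solution_clamp. Qed.

Lemma flux_gap_continuous x : continuous (Phi x).
Proof.
have [cphi _ _ _] := phiN; move=> t.
have cu := @solution_clamp u x su t; have cv := @solution_clamp v x sv t.
apply: cvg_norm; apply: cvgB.
  by apply: continuous_cvg cu; exact: cphi.
by apply: continuous_cvg cv; exact: cphi.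
Qed.

Lemma flux_gap_bounded : exists2 B, 0 <= B & forall x t, 0 <= Phi x t <= B.
Proof.
have [B1 h1] := bounded_comp su; have [B2 h2] := bounded_comp sv.
exists (`|B1| + `|B2|); first by rewrite addr_ge0.
move=> x t; rewrite normr_ge0/=; have tT := clamp_in t (ltW T0).
apply: le_trans (ler_normB _ _) _; apply: lerD.
  by apply: le_trans (h1 _ x tT) (ler_norm _).
by apply: le_trans (h2 _ x tT) (ler_norm _).
Qed.

Lemma flux_bounded t : 0 <= t <= T -> bounded_fun (D t).
Proof.
move=> tT; have [B _ hB] := flux_gap_bounded; exists B => x.
by have := hB x t; rewrite /Phi clamp_id// => /andP[].
Qed.

Lemma gap_is_derive x t : 0 < t < T -> is_derive t 1 (z x) (- laplacian G (D t) x).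
Proof.
move=> tT; have tT' : 0 <= t <= T by lra.
pose d := Num.min t (T - t); have d0 : 0 < d by rewrite lt_min; lra.
apply: (is_derive_near (f := fun s => u s x - v s x) d0).
  move=> s; rewrite /d lt_min => /andP[]; rewrite !ltr_norml => s1 s2.
  by rewrite /z clamp_id//; lra.
have [B1 h1] := bounded_comp su; have [B2 h2] := bounded_comp sv.
have b1 : bounded_fun (phi \o u t) by exists B1 => y; exact: h1.
have b2 : bounded_fun (phi \o v t) by exists B2 => y; exact: h2.
have -> : laplacian G (D t) x =
    laplacian G (phi \o u t) x - laplacian G (phi \o v t) x.
  rewrite !laplacianE//; last exact: flux_bounded.
  rewrite (_ : wsum G x (D t) = wsum G x (phi \o u t) - wsum G x (phi \o v t)).
    by rewrite /D /=; ring.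
  rewrite /wsum -rsumB; [|exact: asum_weightM|exact: asum_weightM].
  by congr rsum; apply/funext => y; rewrite /D mulrBr.
rewrite opprB addrC; apply: is_derive_add; first exact: solution_is_derive.
by rewrite -[X in is_derive _ _ _ X]opprK; apply: is_deriveN; exact: solution_is_derive.
Qed.

(** Monotonicity of [phi] enters here: the sign of the gap times the Laplacian of the flux gap is at
    least the Laplacian of its absolute value, since the diagonal term is exactly |D|. *)
Lemma flux_sign t x : Num.sg (u t x - v t x) * D t x = `|D t x|.
Proof.
have [_ mphi _ _] := phiN; rewrite /D; case: (ltrgtP (u t x) (v t x)) => h.
- by rewrite ltr0_sg ?subr_lt0// mulN1r ler0_norm// subr_le0 mphi.
- by rewrite gtr0_sg ?subr_gt0// mul1r ger0_norm// subr_ge0 mphi.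
- by rewrite h !subrr mulr0 normr0.
Qed.

Let primitives : exists P : X -> R -> R, forall x (t : R), -1 < t ->
  is_derive t 1 (P x) ((T - t) * Phi x t).
Proof.
have /choice[P hP] : forall x, exists p : R -> R, forall t : R, -1 < t ->
    is_derive t 1 p ((T - t) * Phi x t).
  move=> x; apply: (@primitive_exists _ (fun t => (T - t) * Phi x t)) => t.
  apply: cvgM; last exact: flux_gap_continuous.
  by apply: cvgB; [exact: cvg_cst|exact: cvg_id].
by exists P.
Qed.

Section primitive.
Variable P : X -> R -> R.
Hypothesis Pd : forall x (t : R), -1 < t -> is_derive t 1 (P x) ((T - t) * Phi x t).
Let g x := P x T - P x 0.

Let P_continuous x t : 0 <= t <= T -> {for t, continuous (P x)}.
Proof. by move=> tT; apply: (is_derive_continuous (Pd x _)); lra. Qed.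

Lemma primitive_mono x s t : 0 <= s -> s <= t -> t <= T -> P x s <= P x t.
Proof.
move=> s0 st tT; have [->//|nst] := eqVneq s t.
have {}st : s < t by rewrite lt_neqAle nst.
apply: (@derive_nondecreasing _ (P x) (fun r => (T - r) * Phi x r)) => // r rst.
  by apply: P_continuous; lra.
split; first by apply: Pd; lra.
by apply: mulr_ge0; [lra|exact: normr_ge0].
Qed.

Lemma primitive_gap_ge0 x : 0 <= g x.
Proof. by rewrite subr_ge0 primitive_mono// ltW. Qed.

Lemma primitive_gap_bounded : bounded_fun g.
Proof.
have [B B0 hB] := flux_gap_bounded; exists (T * B * T) => x.
rewrite ger0_norm ?primitive_gap_ge0//.
suff : P x T + (- (T * B) * T) <= P x 0 + (- (T * B) * 0) by rewrite /g; lra.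
apply: (@derive_nonincreasing _ (fun t => P x t + - (T * B) * t)
  (fun t => (T - t) * Phi x t + - (T * B))) => // t tT.
  apply: cvgD; first exact: P_continuous.
  by apply: cvgM; [exact: cvg_cst|exact: cvg_id].
split.
  apply: is_derive_add; first by apply: Pd; lra.
  exact: is_derive_line.
have /andP[p0 pB] := hB x t.
have t1 : 0 <= T - t <= T by lra.
move: t1 => /andP[t1 t2]; rewrite subr_le0; exact: ler_pM.
Qed.

(* For finite sets [r] of neighbours exhausting the sum in [D], the function
   [(T - t) |z|] plus the primitive of its loss rate decreases in time. *)
Lemma primitive_gap_laplacian x e C : 0 < e -> 0 < C ->
  (forall t, 0 <= t <= T -> `|D t x| <= e + C * `|u t x - v t x|) ->
  g x - e * T ^+ 2 + C * T * laplacian G g x <= 0.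
Proof.
move=> e0 C0 hC.
have [B B0 hB] := flux_gap_bounded.
have CT : 0 < C * T by rewrite mulr_gt0.
suff : (g x - e * T ^+ 2) / (C * T) + laplacian G g x <= 0.
  have := ler_pM2l CT ((g x - e * T ^+ 2) / (C * T) + laplacian G g x) 0.
  by rewrite mulr0 mulrDr mulrCA divff ?mulr1 ?gt_eqF// => ->.
apply/ler_addgt0Pr => d0 d00; rewrite add0r.
pose d := d0 / T ^+ 2; have T2 : 0 < T ^+ 2 by rewrite exprn_gt0.
have dp : 0 < d by rewrite divr_gt0.
have -> : d0 = d * T ^+ 2 by rewrite /d divfK// gt_eqF.
have m0 := vmeas_gt0 G x; have mi : 0 < (mu x)^-1 by rewrite invr_gt0.
have [r ur hr] := wsum_tail x B (mulr_gt0 dp m0).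
have bg := primitive_gap_bounded.
have := partial_le_wsum x bg primitive_gap_ge0 ur.
move=> /(ler_wpM2r (ltW mi)); rewrite laplacian_degree//.
(* [Q T - Q 0] is [(g x - e T^2) / (C T)] plus the Laplacian of [g] with neighbours cut to [r],
   minus [d T^2]. Omitting neighbours, where [g >= 0], only raises the Laplacian, so [Q T <= Q 0] is
   enough. *)
pose Q t := (C * T)^-1 * (P x t + - (e * T) * t) + (degree G x * P x t +
  (- (mu x)^-1 * (\sum_(y <- r) w x y * P y t) + - (d * T) * t)).
pose S t := \sum_(y <- r) w x y * Phi y t.
pose q t := (C * T)^-1 * ((T - t) * Phi x t + - (e * T)) +
  (degree G x * ((T - t) * Phi x t) +
  (- (mu x)^-1 * (\sum_(y <- r) w x y * ((T - t) * Phi y t)) + - (d * T))).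
pose c t := - degree G x * Phi x t + S t / mu x + d.
have Qd (t : R) : -1 < t -> is_derive t 1 Q (q t).
  move=> t1; apply: is_derive_add.
    apply: is_derive_scale; apply: is_derive_add; first exact: Pd.
    exact: is_derive_line.
  apply: is_derive_add; first by apply: is_derive_scale; exact: Pd.
  apply: is_derive_add; last first.
    exact: is_derive_line.
  apply: is_derive_scale; apply: is_derive_sumr => y.
  by apply: is_derive_scale; exact: Pd.
have : Q T <= Q 0.
  apply: (@weighted_norm_decrease _ (z x) Q (fun t => - laplacian G (D t) x) c q) => //.
  - rewrite /z clamp_id ?lexx ?(ltW T0)//; move: su sv => [[_ _ _ i1] _] [[_ _ _ i2] _].
    by rewrite i1 i2 subrr.
  - by move=> t _; exact: solution_gap_continuous.
  - by move=> t tT; apply: (is_derive_continuous (Qd _ _)); lra.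
  move=> t tT; have tT' : 0 <= t <= T by lra.
  have bD := flux_bounded tT'.
  have PhiE y : Phi y t = `|D t y| by rewrite /Phi clamp_id.
  have zE : z x t = u t x - v t x by rewrite /z clamp_id.
  have wS : wsum G x (fun y => `|D t y|) / mu x <= S t / mu x + d.
    have := hr (fun y => `|D t y|).
    have -> : \sum_(y <- r) w x y * `|D t y| = S t.
      by apply: eq_bigr => y _; rewrite PhiE.
    have bP y : `| `|D t y| | <= B.
      by rewrite normr_id -PhiE; have /andP[] := hB y t.
    move=> /(_ bP) H.
    rewrite ler_pdivrMr// mulrDl divfK ?gt_eqF//.
    by have := le_trans (ler_norm _) H; lra.
  have nw : `|wsum G x (D t)| / mu x <= S t / mu x + d.
    by apply: le_trans wS; rewrite ler_pM2r// norm_wsum.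
  rewrite laplacian_degree//; split; first by rewrite -laplacian_degree//; exact: gap_is_derive.
  - by apply: Qd; lra.
  - move=> zn; have sg1 : `|Num.sg (z x t)| <= 1 by rewrite normr_sg zn.
    have -> : Num.sg (z x t) * - (degree G x * D t x - wsum G x (D t) / mu x) =
        - degree G x * (Num.sg (z x t) * D t x) +
        Num.sg (z x t) * wsum G x (D t) / mu x by ring.
    rewrite {1}zE flux_sign -PhiE /c -addrA lerD2l.
    apply: le_trans nw; rewrite ler_pM2r//; apply: le_trans (ler_norm _) _.
    by rewrite normrM ler_piMl.
  - rewrite zE => /eqP; rewrite subr_eq0 => /eqP E.
    have D0 : D t x = 0 by rewrite /D E subrr.
    rewrite D0 /c PhiE D0 normr0 !mulr0 sub0r opprK add0r normrM.
    by rewrite (gtr0_norm mi).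
  rewrite /q /c; have := hC t tT'; rewrite -PhiE -zE => H.
  have -> : \sum_(y <- r) w x y * ((T - t) * Phi y t) = (T - t) * S t.
    by rewrite mulr_sumr; apply: eq_bigr => y _; rewrite mulrCA.
  (* [(T - t) Phi <= (T - t) (e + C |z|) <= e T + C T |z|], which explains the factor [(C T)^-1] and
     the shift [e T] in [Q]. *)
  have K1 : (C * T)^-1 * ((T - t) * Phi x t + - (e * T)) <= `|z x t|.
    rewrite mulrC ler_pdivrMr//.
    have := ler_wpM2l (ltac:(lra) : 0 <= T - t) H.
    have : 0 <= t * (e + C * `|z x t|).
      by rewrite mulr_ge0 ?addr_ge0 ?mulr_ge0 ?(ltW e0) ?(ltW C0)//; lra.
    move: (Phi x t) (`|z x t|) => p n; lra.
  have K2 : 0 <= t * d by rewrite mulr_ge0 ?(ltW dp)//; lra.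
  set k := (X in _ + (X + _)); have {}K1 : k <= `|z x t| by [].
  move: K1 K2; move: k (`|z x t|) (Phi x t) (S t) (mu x)^-1.
  by move=> k n p s' m K1 K2; lra.
have sE : \sum_(y <- r) w x y * g y =
    \sum_(y <- r) w x y * P y T - \sum_(y <- r) w x y * P y 0.
  by rewrite -sumrB; apply: eq_bigr => y _; rewrite mulrBr.
rewrite sE /Q /g mulrBl.
move: (\sum_(y <- r) _) (\sum_(y <- r) _) (wsum _ _ _ / _) => s1 s2 W.
rewrite expr2; lra.
Qed.

Lemma primitive_gap_eq0 x : g x = 0.
Proof.
have [cphi _ _ _] := phiN; have [_ [M1 uM]] := su; have [_ [M2 vM]] := sv.
apply/eqP; rewrite eq_le primitive_gap_ge0 andbT.
have T2 : 0 < T ^+ 2 by rewrite exprn_gt0.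
apply/ler_addgt0Pr => e0 e00; rewrite add0r.
pose e := e0 / T ^+ 2; have ep : 0 < e by rewrite divr_gt0.
have -> : e0 = e * T ^+ 2 by rewrite /e divfK// gt_eqF.
have [C C0 hC] := continuous_modulus (Num.max M1 M2) cphi ep.
have H y : g y - e * T ^+ 2 + C * T * laplacian G g y <= 0.
  apply: primitive_gap_laplacian => // t tT; apply: hC.
    by apply: le_trans (uM t y tT) _; rewrite le_max lexx.
  by apply: le_trans (vM t y tT) _; rewrite le_max lexx orbT.
have c0 : 0 <= e * T ^+ 2 by rewrite mulr_ge0 ?(ltW ep) ?(ltW T2).
have CT : 0 < C * T by rewrite mulr_gt0.
have bg := primitive_gap_bounded.
have : Num.max (g x - e * T ^+ 2) 0 = 0.
  apply: (@complete_liouville _ _ G (C * T)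
    (fun y => Num.max (g y - e * T ^+ 2) 0) x CT scG) => [|y|y].
  - have [M gM] := bg; exists (M + e * T ^+ 2) => y.
    rewrite ger0_norm ?le_max ?lexx ?orbT// ge_max.
    by have := gM y; rewrite ler_norml; lra.
  - by rewrite le_max lexx orbT.
  - exact: sub_const_supersolution.
by case: (leP (g x - e * T ^+ 2) 0) => // h; lra.
Qed.

Lemma flux_eq0 t x : 0 < t < T -> D t x = 0.
Proof.
move=> tT; have Pc s : 0 <= s <= T -> P x s = P x 0.
  move=> /andP[s0 sT]; apply/eqP; rewrite eq_le.
  have := primitive_gap_eq0 x; rewrite /g => /eqP; rewrite subr_eq0 => /eqP E.
  by rewrite -{1}E !primitive_mono.
have t1 : -1 < t by lra.
have [_ d1] := Pd x t1.
have d0 : 0 < Num.min t (T - t) by rewrite lt_min; lra.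
have nr s : `|s - t| < Num.min t (T - t) -> P x 0 = P x s.
  rewrite lt_min => /andP[]; rewrite !ltr_norml => s1 s2.
  by rewrite Pc//; lra.
have [_ d2] := @is_derive_near _ (fun=> P x 0) (P x) t 0 _ d0 nr (is_derive_cst _ _ _).
move: d1; rewrite d2 => /esym/eqP; rewrite mulf_eq0 gt_eqF ?subr_gt0 /=; last lra.
rewrite normr_eq0 clamp_id; last lra.
by move/eqP.
Qed.

Lemma gap_eq0 t x : 0 <= t <= T -> z x t = 0.
Proof.
move=> tT; have z0 : z x 0 = 0.
  rewrite /z clamp_id ?lexx ?(ltW T0)//; move: su sv => [[_ _ _ i1] _] [[_ _ _ i2] _].
  by rewrite i1 i2 subrr.
have [->//|tn] := eqVneq t 0; rewrite -z0; apply: derive_zero_const.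
- by rewrite lt_neqAle eq_sym tn; case/andP: tT.
- by move=> s _; exact: solution_gap_continuous.
move=> s st; have sT : 0 < s < T by lra.
have := gap_is_derive x sT; rewrite (_ : D s = fun=> 0).
  rewrite laplacian_degree; last by exists 0 => y; rewrite normr0.
  by rewrite mulr0 /wsum (_ : (fun _ => _) = fun=> 0) ?rsum0 ?mul0r ?subr0 ?oppr0//;
    apply/funext => y; rewrite mulr0.
by apply/funext => y; exact: flux_eq0.
Qed.

End primitive.

Lemma solutions_agree t x : 0 <= t <= T -> u t x = v t x.
Proof.
move=> tT; have [P Pd] := primitives.
by have /eqP := gap_eq0 Pd x tT; rewrite /z clamp_id// subr_eq0 => /eqP.
Qed.

End two_solutions.

End uniqueness.

(** * Distinct solutions on incomplete graphs *)

Section regularization.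
Variables (R : realType) (psi : R -> R) (K : R).
Hypothesis psi_mono : forall a b, a <= b -> psi a <= psi b.
Hypothesis psi0 : psi 0 = 0.
Hypothesis psiK : forall s, `|psi s| <= K.
Hypothesis psi_modulus : forall e : R, 0 < e ->
  exists2 C, 0 < C & forall a b, `|psi a - psi b| <= e + C * `|a - b|.
Implicit Types (s r e : R) (n : nat).

(** The Lipschitz (Pasch-Hausdorff) envelope: the largest function below [psi] with Lipschitz
    constant [n]. *)
Definition inf_conv n s := inf [set y | exists r, y = psi r + n%:R * `|s - r|].

Lemma inf_conv_has_inf n s : has_inf [set y | exists r, y = psi r + n%:R * `|s - r|].
Proof.
split; first by exists (psi s + n%:R * `|s - s|), s.
exists (- K) => _ [r ->]; have : 0 <= n%:R * `|s - r| by rewrite mulr_ge0.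
by have := psiK r; rewrite ler_norml => /andP[+ _]; lra.
Qed.

Lemma inf_conv_le n s r : inf_conv n s <= psi r + n%:R * `|s - r|.
Proof. by apply: ge_inf; [have [] := inf_conv_has_inf n s|exists r]. Qed.

Lemma inf_conv_ge n s y : (forall r, y <= psi r + n%:R * `|s - r|) -> y <= inf_conv n s.
Proof.
move=> H; apply: lb_le_inf; first by have [] := inf_conv_has_inf n s.
by move=> _ [r ->].
Qed.

Lemma inf_conv_le_id n s : inf_conv n s <= psi s.
Proof. by have := inf_conv_le n s s; rewrite subrr normr0 mulr0 addr0. Qed.

Lemma inf_conv_mono n s s' : s <= s' -> inf_conv n s <= inf_conv n s'.
Proof.
move=> ss; apply: inf_conv_ge => r; apply: le_trans (inf_conv_le n s (r - (s' - s))) _.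
rewrite (_ : s - (r - (s' - s)) = s' - r); last by ring.
by rewrite lerD2r psi_mono// lerBlDr lerDl subr_ge0.
Qed.

Lemma inf_conv_lipschitz n s s' : `|inf_conv n s - inf_conv n s'| <= n%:R * `|s - s'|.
Proof.
have key a b : inf_conv n a - n%:R * `|a - b| <= inf_conv n b.
  apply: inf_conv_ge => r; rewrite lerBlDr; apply: le_trans (inf_conv_le n a r) _.
  rewrite -addrA lerD2l -mulrDr ler_wpM2l//.
  by have := ler_normD (a - b) (b - r); rewrite addrA subrK (addrC `|a - b|).
have := key s s'; have := key s' s; rewrite (distrC s' s) ler_norml.
move: (n%:R * _) => q; lra.
Qed.

(** Once [n >= C], the slope [n] outweighs the modulus of [psi], so that moving from [s] to another
    point lowers the value by at most [e], uniformly in [s]. *)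
Lemma inf_conv_ge_id e : 0 < e -> exists N, forall n s, (N <= n)%N ->
  psi s - e <= inf_conv n s.
Proof.
move=> e0; have [C C0 hC] := psi_modulus e0.
exists (Num.bound C) => n s Nn; apply: inf_conv_ge => r.
have Cn : C <= n%:R.
  by apply: le_trans (ltW (archi_boundP (ltW C0))) _; rewrite ler_nat.
have := hC s r; rewrite ler_norml => /andP[_].
have := ler_wpM2r (normr_ge0 (s - r)) Cn; move: (`|s - r|) => q; lra.
Qed.

Lemma lipschitz_regularization : exists f : nat -> R -> R,
  [/\ forall n a b, a <= b -> f n a <= f n b,
      forall n, f n 0 = 0,
      forall n a b, `|f n a - f n b| <= n%:R * `|a - b|,
      forall n s, `|f n s| <= K *+ 2 &
      forall e, 0 < e -> exists N, forall n s, (N <= n)%N -> `|f n s - psi s| <= e].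
Proof.
have bd n s : - K <= inf_conv n s <= K.
  apply/andP; split; last first.
    by apply: le_trans (inf_conv_le_id n s) _; have := psiK s; rewrite ler_norml => /andP[].
  apply: inf_conv_ge => r; have : 0 <= n%:R * `|s - r| by rewrite mulr_ge0.
  by have := psiK r; rewrite ler_norml => /andP[+ _]; lra.
(* Normalising the value at 0 doubles the bound [K]. Both envelope errors lie in [- e, 0], so their
   difference is still at most [e] in absolute value. *)
exists (fun n s => inf_conv n s - inf_conv n 0); split.
- by move=> n a b ab; rewrite lerD2r inf_conv_mono.
- by move=> n; rewrite subrr.
- move=> n a b; rewrite opprB addrA subrK; exact: inf_conv_lipschitz.
- move=> n s; have := bd n s; have := bd n 0; rewrite ler_norml mulr2n; lra.
- move=> e e0; have [N hN] := inf_conv_ge_id e0; exists N => n s Nn.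
  have := hN n s Nn; have := hN n 0 Nn; have := inf_conv_le_id n s.
  have := inf_conv_le_id n 0; rewrite psi0 ler_norml; lra.
Qed.

End regularization.

Section laplacian_linear.
Variables (R : realType) (X : countType) (G : graph R X).
Local Notation w := (weight G).
Local Notation mu := (vmeas G).
Implicit Types (f g : X -> R) (x y : X).

Lemma bounded_funB f g : bounded_fun f -> bounded_fun g ->
  bounded_fun (fun y => f y - g y).
Proof.
move=> [M fM] [N gN]; exists (M + N) => y.
by apply: le_trans (ler_normB _ _) (lerD (fM y) (gN y)).
Qed.

Lemma laplacianB f g x : bounded_fun f -> bounded_fun g ->
  laplacian G (fun y => f y - g y) x = laplacian G f x - laplacian G g x.
Proof.
move=> bf bg; rewrite !laplacian_degree//; last exact: bounded_funB.
rewrite (_ : wsum G x (fun y => f y - g y) = wsum G x f - wsum G x g); first by ring.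
rewrite /wsum -rsumB; [|exact: asum_weightM|exact: asum_weightM].
by congr rsum; apply/funext => y; rewrite mulrBr.
Qed.

Lemma wsum_cst x (c : R) : wsum G x (fun=> c) = c * wdeg G x.
Proof.
rewrite /wdeg -rsumZ; last exact: asum_weight.
by congr rsum; apply/funext => y; rewrite mulrC.
Qed.

Lemma bounded_cst (c : R) : bounded_fun (fun _ : X => c).
Proof. by exists `|c|. Qed.

Lemma laplacian_cst (c : R) x : laplacian G (fun=> c) x = killing G x / mu x * c.
Proof.
rewrite laplacianE; last exact: bounded_cst.
by rewrite wsum_cst; ring.
Qed.

Lemma laplacian_bound f (K : R) x : (forall y, `|f y| <= K) ->
  `|laplacian G f x| <= degree G x * K *+ 2.
Proof.
move=> fK; have K0 : 0 <= K by apply: le_trans (fK x).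
have bf : bounded_fun f by exists K.
have mi : 0 < (mu x)^-1 by rewrite invr_gt0 vmeas_gt0.
rewrite laplacian_degree//; apply: le_trans (ler_normB _ _) _; rewrite mulr2n.
apply: lerD; first by rewrite normrM ger0_norm ?degree_ge0// ler_wpM2l ?degree_ge0.
rewrite normrM (gtr0_norm mi) /degree mulrAC ler_pM2r//.
apply: le_trans (@norm_wsum _ _ G x f bf) _.
apply: (@le_trans _ _ (wsum G x (fun=> K))).
  apply: le_wsum => //; first by apply: asum_weightM; exists K => y; rewrite normr_id.
  exact/asum_weightM/bounded_cst.
by rewrite wsum_cst mulrC ler_wpM2r// lerDl killing_ge0.
Qed.

End laplacian_linear.

(** * The monotone explicit Euler scheme on a finite set *)

Section scheme.
Variables (R : realType) (X : countType) (G : graph R X).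
Variables (f : R -> R) (L K M d : R) (m : nat).
Local Notation w := (weight G).
Local Notation mu := (vmeas G).
Hypothesis f_mono : forall a b, a <= b -> f a <= f b.
Hypothesis f0 : f 0 = 0.
Hypothesis f_lip : forall a b, `|f a - f b| <= L * `|a - b|.
Hypothesis fK : forall s, `|f s| <= K.
Hypothesis M0 : 0 <= M.
Hypothesis d0 : 0 < d.
Hypothesis cfl : forall x, (pickle x < m)%N -> d * degree G x * L <= 1.
Implicit Types (u v : X -> R) (x y : X) (c : R) (k : nat).

Definition euler_step c u x : R :=
  if (pickle x < m)%N then u x - d * laplacian G (f \o u) x else c.

Definition euler_init c u x : R := if (pickle x < m)%N then u x else c.

Definition euler c u k : X -> R := iter k (euler_step c) (euler_init c u).

Lemma flux_bounded_fun u : bounded_fun (f \o u).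
Proof. by exists K => y; exact: fK. Qed.

(** By [cfl] the diagonal part [u x - d * degree * f (u x)] is nondecreasing in [u x], and the
    neighbours enter with a positive sign. This is what the Lipschitz constant [L] is for. *)
Lemma euler_step_mono c c' u v x : c <= c' -> (forall y, u y <= v y) ->
  euler_step c u x <= euler_step c' v x.
Proof.
move=> cc uv; rewrite /euler_step; case: ifPn => // xm.
have bu := flux_bounded_fun u; have bv := flux_bounded_fun v.
have mi : 0 < (mu x)^-1 by rewrite invr_gt0 vmeas_gt0.
have W : wsum G x (f \o u) <= wsum G x (f \o v).
  apply: le_wsum; [exact: asum_weightM|exact: asum_weightM|].
  by move=> y; exact: f_mono.
rewrite !laplacian_degree//=.
have W' : d * (wsum G x (f \o u) / mu x) <= d * (wsum G x (f \o v) / mu x).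
  by rewrite ler_pM2l// ler_pM2r.
have : d * degree G x * (f (v x) - f (u x)) <= v x - u x.
  have uvx : 0 <= v x - u x by rewrite subr_ge0.
  apply: le_trans (_ : d * degree G x * (L * (v x - u x)) <= _).
    apply: ler_wpM2l; first by rewrite mulr_ge0 ?(ltW d0) ?degree_ge0.
    by have := f_lip (v x) (u x); rewrite (ger0_norm uvx); apply: le_trans; exact: ler_norm.
  by rewrite mulrA ler_piMl// cfl.
move: W'; move: (_ / mu x) (_ / mu x) (f (v x)) (f (u x)) (degree G x) => p q r s t.
lra.
Qed.

(** Comparison with the constants [- M] and [M]: killing pulls them towards 0, because [f] is
    monotone and vanishes at 0. *)
Lemma euler_step_bound c u x : `|c| <= M -> (forall y, `|u y| <= M) ->
  `|euler_step c u x| <= M.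
Proof.
rewrite ler_norml => /andP[c1 c2] uM; rewrite ler_norml; apply/andP; split.
  apply: le_trans (_ : euler_step (- M) (fun=> - M) x <= _); last first.
    by apply: euler_step_mono => // y; have := uM y; rewrite ler_norml => /andP[].
  rewrite /euler_step; case: ifP => // _; rewrite (laplacian_cst G (f (- M))) lerBrDr gerDl.
  rewrite pmulr_rle0// mulr_ge0_le0 ?divr_ge0 ?killing_ge0 ?mu_ge0//.
  by rewrite -f0 f_mono// oppr_le0.
apply: le_trans (_ : euler_step M (fun=> M) x <= _).
  by apply: euler_step_mono => // y; have := uM y; rewrite ler_norml => /andP[].
rewrite /euler_step; case: ifP => // _; rewrite (laplacian_cst G (f M)) gerBl.
rewrite mulr_ge0 ?(ltW d0)// mulr_ge0 ?divr_ge0 ?killing_ge0 ?mu_ge0//.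
by rewrite -f0 f_mono.
Qed.

Lemma euler_bound c u k x : `|c| <= M -> (forall y, `|u y| <= M) ->
  `|euler c u k x| <= M.
Proof.
move=> cM uM; elim: k x => [|k ih] x; last exact: euler_step_bound.
by rewrite /euler /= /euler_init; case: ifP.
Qed.

Lemma euler_mono c c' u k x : c <= c' -> euler c u k x <= euler c' u k x.
Proof.
move=> cc; elim: k x => [|k ih] x; last exact: euler_step_mono.
by rewrite /euler /= /euler_init; case: ifP.
Qed.

Lemma eulerS c u k x : (pickle x < m)%N ->
  euler c u k.+1 x = euler c u k x - d * laplacian G (f \o euler c u k) x.
Proof. by move=> xm; rewrite {1}/euler /= /euler_step xm. Qed.

Lemma euler_boundary c u k x : ~~ (pickle x < m)%N -> euler c u k x = c.
Proof.
move=> /negbTE xm; case: k => [|k]; first by rewrite /euler /= /euler_init xm.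
by rewrite /euler /= /euler_step xm.
Qed.

(** Per unit of time the bound depends neither on [d] nor on [L] or [m], so the schemes are
    equicontinuous in time at each vertex. *)
Lemma euler_increment c u k x :
  `|euler c u k.+1 x - euler c u k x| <= d * (degree G x * K *+ 2).
Proof.
have K0 : 0 <= K by apply: le_trans (fK 0).
case: (boolP (pickle x < m)%N) => xm; last first.
  rewrite !euler_boundary// subrr normr0 mulr_ge0 ?(ltW d0)// mulrn_wge0//.
  by rewrite mulr_ge0 ?degree_ge0.
rewrite eulerS// addrAC subrr sub0r normrN normrM (gtr0_norm d0) ler_pM2l//.
by apply: laplacian_bound => y; exact: fK.
Qed.

Lemma euler_lipschitz c u k l x : (k <= l)%N ->
  `|euler c u l x - euler c u k x| <= (l%:R - k%:R) * d * (degree G x * K *+ 2).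
Proof.
move=> /subnKC <-; elim: (l - k)%N => [|p ih].
  by rewrite addn0 !subrr normr0 mul0r mul0r.
rewrite addnS -[(k + p).+1%:R]natr1.
have := euler_increment c u (k + p) x.
have := ler_normD (euler c u (k + p).+1 x - euler c u (k + p) x)
                  (euler c u (k + p) x - euler c u k x).
rewrite addrA subrK; move: ih.
move: (degree G x * K *+ 2) (`|_|) (`|_|) (`|_|) ((k + p)%:R) (k%:R) => D a b e q r.
lra.
Qed.

Section two_boundaries.
Variables (u0 : X -> R) (N : nat).
Hypothesis u0M : forall y, `|u0 y| <= M.
Let u k := euler M u0 k.
Let v k := euler (- M) u0 k.
Let NM : `|M| <= M. Proof. by rewrite ger0_norm. Qed.
Let NM' : `|- M| <= M. Proof. by rewrite normrN. Qed.

Definition flux_gap_sum x := \sum_(k < N) d * (f (u k x) - f (v k x)).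

Let vu k x : v k x <= u k x.
Proof. by apply: euler_mono; rewrite (le_trans (ler_norm _)) // normrN. Qed.

Lemma flux_gap_sum_ge0 x : 0 <= flux_gap_sum x.
Proof.
apply: sumr_ge0 => k _; rewrite mulr_ge0 ?(ltW d0)// subr_ge0; exact: f_mono.
Qed.

Lemma flux_gap_sum_bounded : bounded_fun flux_gap_sum.
Proof.
exists (\sum_(k < N) d * (K *+ 2)) => x; apply: le_trans (ler_norm_sum _ _ _) _.
apply: ler_sum => k _; rewrite normrM (gtr0_norm d0) ler_pM2l// mulr2n.
by apply: le_trans (ler_normB _ _) _; apply: lerD.
Qed.

Lemma flux_gap_sum_boundary x : ~~ (pickle x < m)%N ->
  flux_gap_sum x = N%:R * d * (f M - f (- M)).
Proof.
move=> xm; rewrite /flux_gap_sum (eq_bigr (fun=> d * (f M - f (- M)))).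
  by rewrite sumr_const card_ord -mulrA mulr_natl.
by move=> k _; rewrite /u /v !euler_boundary.
Qed.

End two_boundaries.

(** Summing the scheme over time telescopes, and the initial values cancel since both runs start
    from [u0] on the first [m] vertices. *)
Lemma flux_gap_sum_laplacian u0 N x : (pickle x < m)%N ->
  laplacian G (flux_gap_sum u0 N) x = euler (- M) u0 N x - euler M u0 N x.
Proof.
move=> xm; elim: N => [|N ih].
  rewrite (_ : flux_gap_sum u0 0 = fun=> 0); last first.
    by apply/funext => y; rewrite /flux_gap_sum big_ord0.
  by rewrite laplacian_cst mulr0 /euler /= /euler_init xm subrr.
have bU := flux_gap_sum_bounded u0 N.
pose g y := - d * ((f \o euler M u0 N) y - (f \o euler (- M) u0 N) y).
have bd : bounded_fun (fun y => (f \o euler M u0 N) y - (f \o euler (- M) u0 N) y).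
  by apply: bounded_funB; exact: flux_bounded_fun.
have bg : bounded_fun g.
  by have [B hB] := bd; exists (d * B) => y; rewrite normrM normrN (gtr0_norm d0) ler_pM2l.
rewrite (_ : flux_gap_sum u0 N.+1 = fun y => flux_gap_sum u0 N y - g y); last first.
  by apply/funext => y; rewrite /flux_gap_sum big_ord_recr /= /g mulNr opprK.
rewrite laplacianB// ih /g laplacianZ// laplacianB ?eulerS//; try exact: flux_bounded_fun.
ring.
Qed.

Lemma seq_argmin (r : seq X) (g : X -> R) x : x \in r ->
  exists2 z, z \in r & forall y, y \in r -> g z <= g y.
Proof.
elim: r x => // a r ih x _; case: r ih => [_|b r ih].
  by exists a; rewrite ?mem_head// => y; rewrite inE => /eqP ->.
have [z zr hz] := ih b (mem_head _ _).
case: (leP (g a) (g z)) => az.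
  exists a; first exact: mem_head.
  move=> y; rewrite inE => /orP[/eqP -> //|yr].
  by apply: le_trans az _; exact: hz.
exists z; first by rewrite inE zr orbT.
by move=> y; rewrite inE => /orP[/eqP ->|/hz//]; exact: ltW.
Qed.

Lemma laplacian_min_le0 g x : bounded_fun g -> (forall y, g x <= g y) -> g x <= 0 ->
  laplacian G g x <= 0.
Proof.
move=> bg gx g0; rewrite laplacianE//; apply: mulr_ge0_le0.
  by rewrite invr_ge0 mu_ge0.
have : g x * wdeg G x <= wsum G x g.
  rewrite -wsum_cst; apply: le_wsum => //; last exact: asum_weightM.
  exact/asum_weightM/bounded_cst.
have := mulr_ge0_le0 (killing_ge0 G x) g0; rewrite (mulrC (g x)); lra.
Qed.

(* Minimum principle for the difference of both sides, which is nonnegative outside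
   the first [m] vertices. *)
Lemma flux_gap_lower u0 N h x : 0 < h -> (forall y, `|u0 y| <= M) ->
  2 * M < N%:R * d * (f M - f (- M)) / h ->
  N%:R * d * (f M - f (- M)) * (2 * defect G h x - 1) <= flux_gap_sum u0 N x.
Proof.
move=> h0 u0M; set C := N%:R * d * (f M - f (- M)) => hC.
have C0 : 0 < C.
  have : 0 < C / h by apply: le_lt_trans hC; rewrite mulr_ge0.
  by rewrite pmulr_lgt0// invr_gt0.
pose e := defect G h; have be : bounded_fun e by exact: defect_bounded.
(* At most [C] because [e <= 1], so it stays below the gap sum outside the finite set; positive only
   where [e > 1/2], where the equation of [e] makes its Laplacian strongly negative. *)
pose W y := C * (2 * e y - 1).
have e1 y : 0 <= e y <= 1 by rewrite /e defect_ge0// defect_le1.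
have bW : bounded_fun W.
  exists C => y; rewrite normrM (gtr0_norm C0) ler_piMr ?(ltW C0)// ler_norml.
  have := e1 y; lra.
have bU := flux_gap_sum_bounded u0 N.
pose g y := flux_gap_sum u0 N y - W y.
have bg : bounded_fun g by exact: bounded_funB.
suff : 0 <= g x by rewrite subr_ge0.
rewrite leNgt; apply/negP => gx.
have out y : ~~ (pickle y < m)%N -> 0 <= g y.
  move=> ym; rewrite /g flux_gap_sum_boundary// -/C /W subr_ge0 ler_piMr ?(ltW C0)//.
  by have := e1 y; lra.
have xm : x \in first_vertices m.
  by rewrite mem_first_vertices; apply/negPn/negP => /out; rewrite leNgt gx.
have [z zm hz] := seq_argmin g xm.
have gz : g z < 0 by apply: le_lt_trans gx; exact: hz.
have gmin y : g z <= g y.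
  case: (boolP (pickle y < m)%N) => ym; first by apply: hz; rewrite mem_first_vertices.
  by apply: le_trans (ltW gz) _; exact: out.
have := laplacian_min_le0 bg gmin (ltW gz).
rewrite mem_first_vertices in zm.
have LW : laplacian G W z = C * (2 * (- h^-1 * e z) - killing G z / mu z).
  have b2 : bounded_fun (fun y => 2 * e y).
    by have [B hB] := be; exists (2 * B) => y; rewrite normrM ger0_norm// ler_pM2l.
  rewrite /W laplacianZ; last by apply: bounded_funB => //; exact: bounded_cst.
  rewrite (laplacianB G z b2 (bounded_cst X 1)) laplacianZ// laplacian_cst mulr1.
  by rewrite /e defect_laplacian.
rewrite (laplacianB G z bU bW) flux_gap_sum_laplacian// LW.
have U0 := flux_gap_sum_ge0 u0 N z.
(* At a negative minimum [W z > 0], since the gap sum is nonnegative. The Laplacian of [W] is then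
   at most [- C / h] and that of the gap sum at least [- 2 M], so by [hC] the Laplacian of [g] is
   positive at its minimum, a contradiction. *)
have ez : 1 / 2 < e z.
  have : 0 < W z by move: gz U0; rewrite /g; lra.
  rewrite /W pmulr_rgt0//; lra.
have kz : 0 <= killing G z / mu z by rewrite divr_ge0 ?killing_ge0 ?mu_ge0.
have cM : `|M| <= M by rewrite ger0_norm.
have cM' : `|- M| <= M by rewrite normrN.
have := euler_bound N z cM u0M; have := euler_bound N z cM' u0M.
rewrite !ler_norml.
have hi : 0 < C / h by rewrite divr_gt0.
have E : C * (2 * (- h^-1 * e z) - killing G z / mu z) =
  - (C / h * (2 * e z)) - C * (killing G z / mu z) by ring.
rewrite E; have : 0 <= C * (killing G z / mu z) by rewrite mulr_ge0 ?(ltW C0).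
have : C / h * 1 <= C / h * (2 * e z) by rewrite ler_pM2l//; lra.
move: hC; move: (C / h * (2 * e z)) (C / h) (C * (_ / _)) (euler _ _ _ _) (euler _ _ _ _).
by move=> p q r a b; lra.
Qed.

(** [3 / 4] makes [2 e - 1] exceed 1/2, so the gap sum exceeds half of its boundary value and some
    step must carry at least half of the boundary gap. *)
Lemma flux_gap_exists u0 N h x : 0 < h -> (forall y, `|u0 y| <= M) ->
  2 * M < N%:R * d * (f M - f (- M)) / h -> 3 / 4 < defect G h x ->
  exists2 k, (k < N)%N &
    (f M - f (- M)) / 2 <= f (euler M u0 k x) - f (euler (- M) u0 k x).
Proof.
move=> h0 u0M hC ex; have := flux_gap_lower x h0 u0M hC.
apply: contraPP => H.
have C0 : 0 < N%:R * d * (f M - f (- M)).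
  have : 0 < N%:R * d * (f M - f (- M)) / h by apply: le_lt_trans hC; rewrite mulr_ge0.
  by rewrite pmulr_lgt0// invr_gt0.
apply/negP; rewrite -ltNge.
apply: (@le_lt_trans _ _ (\sum_(k < N) d * ((f M - f (- M)) / 2))).
  apply: ler_sum => k _; rewrite ler_pM2l// ltW// ltNge; apply/negP => le.
  by apply: H; exists (nat_of_ord k) => //; exact: ltn_ord.
rewrite sumr_const card_ord -[ltLHS]mulr_natl 2!mulrA ltr_pM2l//; lra.
Qed.

End scheme.

(** * Ultralimits of the Euler scheme are solutions *)

Section ultralimit.
Variables (R : realType) (U : set_system nat).
Hypothesis UU : UltraFilter U.
Hypothesis oU : \oo `<=` U.
Variable dn : nat -> R.
Hypothesis dn_gt0 : forall n, 0 < dn n.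
Hypothesis dn_cvg0 : forall e, 0 < e -> \forall n \near U, dn n < e.
Implicit Types (q : nat -> nat -> R) (r s t l e d : R) (n k : nat).

Let FU : ProperFilter U. Proof. exact: ultra_proper. Qed.

(* [q n k] is a value at time [k * dn n]. *)
Definition time_cvg q r l := forall e, 0 < e -> exists2 d, 0 < d &
  \forall n \near U, forall k, `|k%:R * dn n - r| < d -> `|q n k - l| <= e.

Definition time_index n t : nat := Num.truncn (t / dn n).

Lemma time_indexP n t : 0 <= t ->
  (time_index n t)%:R * dn n <= t < (time_index n t)%:R * dn n + dn n.
Proof.
move=> t0; have := truncn_itv (divr_ge0 t0 (ltW (dn_gt0 n))).
by rewrite ler_pdivlMr// ltr_pdivrMr// -natr1 mulrDl mul1r.
Qed.

Lemma time_index_near d t : 0 < d -> 0 <= t ->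
  \forall n \near U, `|(time_index n t)%:R * dn n - t| < d.
Proof.
move=> d0 t0; apply: filterS (dn_cvg0 d0) => n nd.
have := time_indexP n t0; rewrite ltr_norml; lra.
Qed.

Lemma time_index_cvg t : 0 <= t -> (time_index n t)%:R * dn n @[n --> U] --> t.
Proof.
move=> t0; apply/cvgrPdist_le => e e0; apply: filterS (time_index_near e0 t0) => n.
by rewrite distrC => /ltW.
Qed.

Lemma time_index_mono n s t : 0 <= s -> s <= t -> (time_index n s <= time_index n t)%N.
Proof.
move=> s0 st; have di : 0 <= (dn n)^-1 by rewrite invr_ge0 ltW.
rewrite /time_index truncn_ge_nat; last by rewrite mulr_ge0// (le_trans s0).
apply: le_trans (_ : s / dn n <= _); last exact: ler_wpM2r.
by rewrite truncn_le mulr_ge0.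
Qed.

Lemma time_cvg_along q r l (k : nat -> nat) : time_cvg q r l ->
  (k n)%:R * dn n @[n --> U] --> r -> q n (k n) @[n --> U] --> l.
Proof.
move=> ql kr; apply/cvgrPdist_le => e e0; have [d d0 H] := ql e e0.
move/cvgrPdist_lt : kr => /(_ d d0) H'; apply: filterS2 H H' => n h1 h2.
by rewrite distrC; apply: h1; rewrite distrC.
Qed.

(** [time_cvg] at [r] controls all steps near [r], hence the limits at nearby times; continuity of
    the limit comes for free. *)
Lemma time_cvg_continuous q (l : R -> R) : (forall r, 0 <= r -> time_cvg q r (l r)) ->
  forall r, 0 <= r -> forall e, 0 < e -> exists2 d, 0 < d &
    forall s, 0 <= s -> `|s - r| < d -> `|l s - l r| <= e.
Proof.
move=> H r r0 e e0; have [d d0 Hd] := H r r0 e e0.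
exists (d / 2); first by rewrite divr_gt0.
move=> s s0 sr; have c := time_cvg_along (H s s0) (time_index_cvg s0).
have d2 : 0 < d / 2 by rewrite divr_gt0.
apply: (@cvgr_to_le _ U _ _ (fun n => `|q n (time_index n s) - l r|)).
  by apply: cvg_norm; apply: cvgB c _; exact: cvg_cst.
apply: filterS2 Hd (time_index_near d2 s0) => n h1 h2; apply: h1.
move: sr h2; rewrite !ltr_norml; lra.
Qed.

Lemma time_cvg_seq (I : eqType) (z : seq I) (Q : I -> nat -> nat -> R) r (l : I -> R) e :
  (forall i, time_cvg (Q i) r (l i)) -> 0 < e -> exists2 d, 0 < d &
  \forall n \near U, forall k, `|k%:R * dn n - r| < d ->
    forall i, i \in z -> `|Q i n k - l i| <= e.
Proof.
move=> H e0; elim: z => [|a z [d1 d10 h1]].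
  by exists 1 => //; apply: nearW.
have [d2 d20 h2] := H a e e0; exists (Num.min d1 d2); first by rewrite lt_min d10.
apply: filterS2 h1 h2 => n h1 h2 k; rewrite lt_min => /andP[k1 k2] i.
by rewrite inE => /orP[/eqP ->|iz]; [exact: h2|exact: h1].
Qed.

Section limit_solution.
Variables (X : countType) (G : graph R X) (psi : R -> R) (f : nat -> R -> R).
Variables (K M c : R) (u0 : X -> R).
Local Notation w := (weight G).
Local Notation mu := (vmeas G).
Hypothesis f_mono : forall n a b, a <= b -> f n a <= f n b.
Hypothesis f0 : forall n, f n 0 = 0.
Hypothesis f_lip : forall n a b, `|f n a - f n b| <= n%:R * `|a - b|.
Hypothesis fK : forall n s, `|f n s| <= K.
Hypothesis psiK : forall s, `|psi s| <= K.
Hypothesis f_psi : forall e, 0 < e -> exists N, forall n s, (N <= n)%N ->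
  `|f n s - psi s| <= e.
Hypothesis psi_modulus : forall e : R, 0 < e ->
  exists2 C, 0 < C & forall a b, `|psi a - psi b| <= e + C * `|a - b|.
Hypothesis cfl : forall n x, (pickle x < n)%N -> dn n * degree G x * n%:R <= 1.
Hypothesis M0 : 0 <= M.
Hypothesis cM : `|c| <= M.
Hypothesis u0M : forall x, `|u0 x| <= M.
Implicit Types (x y : X).

Definition euler_at x n k := euler G (f n) (dn n) n c u0 k x.

Lemma euler_at_bound x n k : `|euler_at x n k| <= M.
Proof.
exact: (euler_bound (f_mono n) (f0 n) (f_lip n) (fK n) M0 (dn_gt0 n)
  (@cfl n) k x cM u0M).
Qed.

Definition speed x := degree G x * K *+ 2.

Lemma speed_ge0 x : 0 <= speed x.
Proof.
by rewrite /speed mulrn_wge0// mulr_ge0 ?degree_ge0// (le_trans _ (psiK 0)).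
Qed.

Lemma euler_at_lipschitz x n k j :
  `|euler_at x n k - euler_at x n j| <= `|k%:R * dn n - j%:R * dn n| * speed x.
Proof.
wlog jk : k j / (j <= k)%N.
  by move=> H; case/orP: (leq_total j k) => /H//; rewrite distrC (distrC (k%:R * _)).
apply: le_trans (@euler_lipschitz _ _ G (f n) K (dn n) n (fK n) (dn_gt0 n) c u0 _ _ x jk) _.
by rewrite -mulrBl ger0_norm// mulr_ge0 ?(ltW (dn_gt0 n))// subr_ge0 ler_nat.
Qed.

Definition ulim t x : R := lim (euler_at x n (time_index n t) @[n --> U]).

Lemma ulim_cvg t x : euler_at x n (time_index n t) @[n --> U] --> ulim t x.
Proof.
have [l _ cl] := @ultra_bounded_cvg _ U UU (fun n => euler_at x n (time_index n t)) M
  (fun n => euler_at_bound x n _).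
by apply/cvg_ex; exists l.
Qed.

Lemma ulim_bound t x : `|ulim t x| <= M.
Proof.
apply: (@cvgr_to_le _ U _ _ (fun n => `|euler_at x n (time_index n t)|)).
  by apply: cvg_norm; exact: ulim_cvg.
by apply: nearW => n; exact: euler_at_bound.
Qed.

Lemma ulim0 x : ulim 0 x = u0 x.
Proof.
apply: cvg_lim => //; apply/cvgrPdist_le => e e0.
have H1 : \forall n \near U, (pickle x < n)%N by apply: oU; exists (pickle x).+1.
apply: filterS H1 => n xn; rewrite /time_index mul0r truncn0.
by rewrite /euler_at /euler /= /euler_init xn subrr normr0 ltW.
Qed.

(** [ulim] is a limit along one step per time; the uniform speed bound carries it over to all steps
    near [r]. *)
Lemma euler_at_time_cvg x r : 0 <= r -> time_cvg (euler_at x) r (ulim r x).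
Proof.
move=> r0 e e0; have B1 : 0 < 4 * (speed x + 1).
  by rewrite mulr_gt0// ltr_wpDl ?speed_ge0.
pose d := e / (4 * (speed x + 1)); have d0 : 0 < d by rewrite divr_gt0.
exists d => //; have e2 : 0 < e / 2 by rewrite divr_gt0.
have /cvgrPdist_le /(_ _ e2) H := @ulim_cvg r x.
apply: filterS2 H (time_index_near d0 r0) => n h1 h2 k kd.
have h3 := euler_at_lipschitz x n k (time_index n r).
have h4 : `|k%:R * dn n - (time_index n r)%:R * dn n| <= 2 * d.
  by move: kd h2; rewrite !ltr_norml ler_norml; lra.
have h5 := le_trans h3 (ler_wpM2r (speed_ge0 x) h4).
have h6 : 2 * d * (speed x + 1) = e / 2.
  have : speed x + 1 != 0 by rewrite gt_eqF// ltr_wpDl ?speed_ge0.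
  by rewrite /d; move: (speed x + 1) => B B0; field.
have := ler_distD (euler_at x n (time_index n r)) (euler_at x n k) (ulim r x).
rewrite (distrC (euler_at x n (time_index n r)) (ulim r x)).
move: h1 h5 h6; move: (`|_ - _|) (`|_ - _|) (`|_ - _|) (speed x) => p q' z B.
lra.
Qed.

Lemma flux_time_cvg x r : 0 <= r ->
  time_cvg (fun n k => f n (euler_at x n k)) r (psi (ulim r x)).
Proof.
move=> r0 e e0; have e3 : 0 < e / 3 by rewrite divr_gt0.
have [N hN] := f_psi e3; have [C C0 hC] := psi_modulus e3.
have [d d0 hd] := euler_at_time_cvg x r0 (divr_gt0 e3 C0); exists d => //.
have hN' : \forall n \near U, (N <= n)%N by apply: oU; exists N.
apply: filterS2 hd hN' => n h1 h2 k kd.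
have := h1 k kd; rewrite ler_pdivlMr//; have := hC (euler_at x n k) (ulim r x).
have := hN n (euler_at x n k) h2.
have := ler_distD (psi (euler_at x n k)) (f n (euler_at x n k)) (psi (ulim r x)).
move: (`|_ - _|) (`|_ - _|) (`|_ - _|) (`|_ - _|) => p q' z B; lra.
Qed.

(** The fluxes at [x] and at finitely many neighbours converge at a common rate by [time_cvg_seq];
    the other neighbours contribute at most [e / 2] by [wsum_tail], as flux differences are bounded
    by [K + K]. *)
Lemma laplacian_time_cvg x r : 0 <= r ->
  time_cvg (fun n k => laplacian G (f n \o euler_at^~ n ^~ k) x) r
    (laplacian G (psi \o ulim r) x).
Proof.
move=> r0 e e0; have m0 := vmeas_gt0 G x; have mi : 0 < (mu x)^-1 by rewrite invr_gt0.
have e1 : 0 < e / 2 * mu x by rewrite mulr_gt0// divr_gt0.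
have dg := degree_ge0 G x; have dp : 0 < 4 * (degree G x + 1).
  by rewrite mulr_gt0// ltr_wpDl.
have e2 : 0 < e / (4 * (degree G x + 1)) by rewrite divr_gt0.
have [z uz hz] := wsum_tail G x (K + K) e1.
have [d d0 hd] := time_cvg_seq (x :: z) (fun y => flux_time_cvg y r0) e2.
exists d => //; apply: filterS hd => n h1 k kd; have {}h1 := h1 k kd.
set F := f n \o _; set H := psi \o _.
have bF : bounded_fun F by exists K => y; exact: fK.
have bH : bounded_fun H by exists K => y; exact: psiK.
rewrite -laplacianB// laplacian_degree; last exact: bounded_funB.
pose D y := F y - H y; rewrite -/D.
have DK y : `|D y| <= K + K.
  by apply: le_trans (ler_normB _ _) (lerD _ _); [exact: fK|exact: psiK].
have Dz : `|\sum_(y <- z) w x y * D y| <= wdeg G x * (e / (4 * (degree G x + 1))).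
  apply: le_trans (ler_norm_sum _ _ _) _.
  apply: (@le_trans _ _ ((\sum_(y <- z) w x y) * (e / (4 * (degree G x + 1))))).
    rewrite mulr_suml big_seq [leRHS]big_seq; apply: ler_sum => y yz.
    rewrite normrM ger0_norm ?weight_ge0// ler_wpM2l ?weight_ge0//.
    by apply: h1; rewrite inE yz orbT.
  rewrite ler_wpM2r ?(ltW e2)//; apply: partial_le_rsum => //; first exact: asum_weight.
  by move=> y; exact: weight_ge0.
have Wz := hz D DK.
have Dx : `|D x| <= e / (4 * (degree G x + 1)) by apply: h1; rewrite mem_head.
have W : `|wsum G x D| <= wdeg G x * (e / (4 * (degree G x + 1))) + e / 2 * mu x.
  rewrite -[wsum G x D](subrK (\sum_(y <- z) w x y * D y)) addrC.
  by apply: le_trans (ler_normD _ _) (lerD _ _).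
apply: le_trans (ler_normB _ _) _; rewrite -/(D x).
rewrite (normrM (degree G x)) (normrM (wsum _ _ _)) (ger0_norm dg) (gtr0_norm mi).
have W' : `|wsum G x D| / mu x <= degree G x * (e / (4 * (degree G x + 1))) + e / 2.
  rewrite ler_pdivrMr// mulrDl; apply: le_trans W _; rewrite lerD2r.
  rewrite [leRHS]mulrAC ler_wpM2r ?(ltW e2)// /degree divfK ?gt_eqF//.
  by rewrite lerDl killing_ge0.
have W2 := ler_wpM2l dg Dx.
have E : (degree G x + 1) * (e / (4 * (degree G x + 1))) = e / 4.
  have : degree G x + 1 != 0 by rewrite gt_eqF// ltr_wpDl.
  by move: (degree G x + 1) => B B0; field.
move: W' W2 E e2; move: (_ * _^-1) (degree G x * `|_|) (e / (4 * _)) => p q' a.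
rewrite mulrDl; lra.
Qed.

Lemma euler_at_increment x n j k l e : (pickle x < n)%N -> (j <= k)%N ->
  (forall i, (j <= i < k)%N ->
    `|laplacian G (f n \o euler_at^~ n ^~ i) x - l| <= e) ->
  `|euler_at x n k - euler_at x n j + (k%:R * dn n - j%:R * dn n) * l| <=
  e * (k%:R * dn n - j%:R * dn n).
Proof.
move=> xn /subnKC <-; elim: (k - j)%N => [|p ih] H.
  by rewrite addn0 !subrr mul0r mulr0 addr0 normr0.
have h := H (j + p)%N; rewrite leq_addr addnS ltnSn in h; have {}h := h isT.
have {}ih : `|euler_at x n (j + p) - euler_at x n j +
    ((j + p)%:R * dn n - j%:R * dn n) * l| <= e * ((j + p)%:R * dn n - j%:R * dn n).
  apply: ih => i /andP[ji ip]; apply: H.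
  by rewrite ji addnS ltnS ltnW.
rewrite addnS -[(j + p).+1%:R]natr1 /euler_at (eulerS _ _ _ _ _ _ xn) -/(euler_at x n (j + p)).
have := ler_wpM2l (ltW (dn_gt0 n)) h.
rewrite -{1}(gtr0_norm (dn_gt0 n)) -normrM.
move: ih; rewrite /euler_at; set A := euler _ _ _ _ _ _ _ _; set B := euler _ _ _ _ _ _ _ _.
set Lp := laplacian _ _ _.
have -> : A - dn n * Lp - B + (((j + p)%:R + 1) * dn n - j%:R * dn n) * l =
  (A - B + ((j + p)%:R * dn n - j%:R * dn n) * l) - dn n * (Lp - l) by ring.
have := ler_normB (A - B + ((j + p)%:R * dn n - j%:R * dn n) * l) (dn n * (Lp - l)).
move: (`|_|) (`|_|) (`|_|) => a b c'; lra.
Qed.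

(** Between [s] and [t] the discrete Laplacians stay within [e] of their limit at [r], so the summed
    scheme is affine up to [e (t - s)]. Both endpoints are free, which covers left and right
    derivatives together. *)
Lemma ulim_increment x r e : 0 <= r -> 0 < e -> exists2 d, 0 < d &
  forall s t, 0 <= s -> s <= t -> `|s - r| < d -> `|t - r| < d ->
  `|ulim t x - ulim s x + (t - s) * laplacian G (psi \o ulim r) x| <= e * (t - s).
Proof.
move=> r0 e0; have [d d0 hd] := laplacian_time_cvg x r0 e0.
have d2 : 0 < d / 2 by rewrite divr_gt0.
exists (d / 2) => // s t s0 st sr tr; have t0 := le_trans s0 st.
set l := laplacian _ _ _.
have H1 : \forall n \near U, (pickle x < n)%N by apply: oU; exists (pickle x).+1.
rewrite -subr_le0.
pose a n := `|euler_at x n (time_index n t) - euler_at x n (time_index n s) +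
   ((time_index n t)%:R * dn n - (time_index n s)%:R * dn n) * l| -
   e * ((time_index n t)%:R * dn n - (time_index n s)%:R * dn n).
apply: (@cvgr_to_le _ U _ _ a).
  have cd : (time_index n t)%:R * dn n - (time_index n s)%:R * dn n @[n --> U] --> t - s.
    by apply: cvgB; exact: time_index_cvg.
  apply: cvgB; last by apply: cvgM => //; exact: cvg_cst.
  apply: cvg_norm; apply: cvgD; first by apply: cvgB; exact: ulim_cvg.
  by apply: cvgM => //; exact: cvg_cst.
apply: filterS3 H1 hd (dn_cvg0 d2) => n xn hn nd; rewrite /a subr_le0.
apply: euler_at_increment => //; first exact: (time_index_mono n s0 st).
move=> i /andP[si it]; apply: hn.
have := time_indexP n s0; have := time_indexP n t0.
have : (time_index n s)%:R * dn n <= i%:R * dn n by rewrite ler_pM2r// ler_nat.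
have : i%:R * dn n <= (time_index n t)%:R * dn n by rewrite ler_pM2r// ler_nat ltnW.
by move: sr tr; rewrite !ltr_norml; lra.
Qed.

Lemma ulim_is_derive x t : 0 < t ->
  is_derive t 1 (ulim^~ x) (- laplacian G (psi \o ulim t) x).
Proof.
move=> t0; apply: is_derive_eps => e e0.
have [d d0 hd] := ulim_increment x (ltW t0) e0.
exists (Num.min d t); first by rewrite lt_min d0.
move=> y; rewrite lt_min => /andP[yd yt].
have y0 : 0 <= y by move: yt; rewrite ltr_norml; lra.
have td : `|t - t| < d by rewrite subrr normr0.
case/orP: (le_total t y) => ty.
  rewrite (ger0_norm (_ : 0 <= y - t)) ?subr_ge0// mulrN opprK.
  exact: (hd t y (ltW t0) ty td yd).
rewrite (distrC y t) (ger0_norm (_ : 0 <= t - y)) ?subr_ge0//.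
have := hd y t y0 ty yd td; rewrite -normrN; congr (`|_| <= _); ring.
Qed.

(** The limit takes values in [- M, M], where [psi] and [phi] agree. Continuity of the time
    derivative comes from [time_cvg] of the Laplacians. *)
Lemma ulim_solution T phi : (forall s, `|s| <= M -> psi s = phi s) ->
  bounded_pointwise_solution G T phi u0 ulim.
Proof.
move=> psi_phi; have E t : phi \o ulim t = psi \o ulim t.
  by apply/funext => x; rewrite /= psi_phi ?ulim_bound.
have D t x : 0 < t -> derive1 (ulim ^~ x) t = - laplacian G (psi \o ulim t) x.
  by move=> t0; rewrite derive1E; have [_ ->] := ulim_is_derive x t0.
split; last by exists M => t x _; exact: ulim_bound.
split=> [t _ x|x|t x /andP[t0 _]|x]; last exact: ulim0.
- have bp : bounded_fun (psi \o ulim t) by exists K => y; exact: psiK.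
  rewrite E; have := asum_weightM G x bp; rewrite /asum; congr (_ < _)%E.
  by apply: eq_esum => y _; rewrite normrM ger0_norm ?weight_ge0.
- split.
  + apply: (@within_continuous_eps _ _ _ (ulim ^~ x)) => // t.
    rewrite /= in_itv /= => /andP[t0 _] e e0.
    have [d d0 hd] := @time_cvg_continuous (euler_at x) (ulim^~ x)
      (fun r (r0 : 0 <= r) => euler_at_time_cvg x r0) t t0 e e0.
    by exists d => // s; rewrite /= in_itv /= => /andP[s0 _]; exact: hd.
  + by move=> t /andP[t0 _]; have [] := ulim_is_derive x t0.
  + apply: (@within_continuous_eps _ _ _ (fun t => - laplacian G (psi \o ulim t) x)) => t.
      by rewrite /= in_itv /= => /andP[t0 _]; exact: D.
    rewrite /= in_itv /= => /andP[t0 _] e e0.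
    have [d d0 hd] := @time_cvg_continuous _ (fun t => laplacian G (psi \o ulim t) x)
      (fun r (r0 : 0 <= r) => laplacian_time_cvg x r0) t (ltW t0) e e0.
    exists d => // s; rewrite /= in_itv /= => /andP[s0 _] st.
    by rewrite -opprD normrN; exact: hd (ltW s0) st.
- by rewrite D// E addNr.
Qed.

End limit_solution.
End ultralimit.

(** * Two distinct limits *)

Section nonuniqueness.
Variables (R : realType) (X : countType) (G : graph R X).

(** [N n] is taken above [T (D + 1) (n + 1)], with [D] the sum of the degrees of the first [n]
    vertices. This yields both a step of at most [1 / (n + 1)] and the stability condition for
    Lipschitz constant [n]. *)
Lemma euler_steps_exist (T : R) : 0 < T -> exists N : nat -> nat, forall n,
  [/\ (0 < N n)%N, T / (N n)%:R * n.+1%:R <= 1 &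
   forall x, (pickle x < n)%N -> T / (N n)%:R * degree G x * n%:R <= 1].
Proof.
move=> T0; suff /choice[N hN] : forall n, exists N : nat,
    [/\ (0 < N)%N, T / N%:R * n.+1%:R <= 1 &
     forall x, (pickle x < n)%N -> T / N%:R * degree G x * n%:R <= 1] by exists N.
move=> n.
pose D := \sum_(y <- first_vertices n) degree G y.
have D0 : 0 <= D by apply: sumr_ge0 => y _; exact: degree_ge0.
have Dx x : (pickle x < n)%N -> degree G x <= D.
  rewrite -mem_first_vertices => xn; rewrite /D (big_rem _ xn) /= lerDl.
  by apply: sumr_ge0 => y _; exact: degree_ge0.
pose Q := T * ((D + 1) * n.+1%:R); have Q0 : 0 < Q by rewrite !mulr_gt0// ltr_wpDl.
have QN : Q < (Num.bound Q)%:R by apply: archi_boundP; exact: ltW.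
have N0 : 0 < (Num.bound Q)%:R :> R by exact: lt_trans Q0 QN.
have key z : z <= (D + 1) * n.+1%:R -> T / (Num.bound Q)%:R * z <= 1.
  move=> zQ; rewrite mulrAC ler_pdivrMr// mul1r; apply: le_trans (ltW QN).
  by rewrite /Q ler_pM2l.
exists (Num.bound Q); split; first by rewrite -(ltr0n R).
- by apply: key; rewrite ler_peMl// lerDr.
move=> x xn; rewrite -mulrA; apply: key; apply: ler_pM; rewrite ?degree_ge0//.
- by apply: le_trans (Dx x xn) _; rewrite lerDl.
- by rewrite ler_nat.
Qed.

Lemma incomplete_not_unique (T : R) (phi : R -> R) (u0 : X -> R) : 0 < T ->
  ~ stochastically_complete_at_infinity G -> nonlinearity phi -> ell_infty u0 ->
  ~ unique_bounded_solution G T phi u0.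
Proof.
move=> T0 nsc [cphi mphi [s1 [s2 ns]] phi0] [B u0B] uniq_sol.
(* Large enough to bound [u0] and to force [phi (- M) < phi M], as [s1] and [s2] lie in [- M, M]. *)
pose M := `|B| + `|s1| + `|s2|.
have M0 : 0 <= M by rewrite !addr_ge0.
have u0M x : `|u0 x| <= M.
  apply: le_trans (u0B x) _; apply: le_trans (ler_norm B) _.
  by rewrite /M -addrA lerDl addr_ge0.
have mphi' a b : a <= b -> phi a <= phi b.
  by rewrite le_eqVlt => /predU1P[->//|]; exact: mphi.
have MM : - M <= M by rewrite (le_trans _ M0)// oppr_le0.
pose g := phi M - phi (- M).
have g0 : 0 < g.
  have sM s : `|s| <= M -> phi (- M) <= phi s <= phi M.
    by rewrite ler_norml => /andP[? ?]; rewrite !mphi'.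
  have M1 : `|s1| <= M by rewrite /M -addrA addrCA lerDl addr_ge0.
  have M2 : `|s2| <= M by rewrite /M lerDr addr_ge0.
  have /andP[a1 a2] := sM s1 M1; have /andP[b1 b2] := sM s2 M2.
  rewrite subr_gt0 ltNge; apply/negP => le; apply: ns.
  apply/eqP; rewrite eq_le (le_trans a2 (le_trans le b1)).
  by rewrite (le_trans b2 (le_trans le a1)).
(* Freezing [phi] outside [- M, M] makes it bounded with a global modulus; the scheme never leaves
   that interval. *)
pose psi s := phi (clamp (- M) M s); pose K := `|phi M| + `|phi (- M)|.
have psi_mono a b : a <= b -> psi a <= psi b by move=> ab; apply/mphi'/clamp_mono.
have psi_phi s : `|s| <= M -> psi s = phi s.
  by rewrite ler_norml => sM; rewrite /psi clamp_id.
have psi0 : psi 0 = 0 by rewrite psi_phi ?normr0.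
have psiK s : `|psi s| <= K.
  have /andP[c1 c2] := clamp_in s MM; have := mphi' _ _ c1; have := mphi' _ _ c2.
  rewrite /psi /K ler_norml; have := ler_norm (phi M); have := ler_norm (- phi (- M)).
  have := normr_ge0 (phi M); have := normr_ge0 (phi (- M)); rewrite normrN.
  by move: (`|phi M|) (`|phi (- M)|) (phi _) => p q r; lra.
have psi_modulus (e : R) : 0 < e ->
    exists2 C, 0 < C & forall a b, `|psi a - psi b| <= e + C * `|a - b|.
  move=> e0; have [C C0 hC] := continuous_modulus M cphi e0; exists C => // a b.
  have cM s : `|clamp (- M) M s| <= M by rewrite ler_norml clamp_in.
  apply: le_trans (hC _ _ (cM a) (cM b)) _; rewrite lerD2l ler_wpM2l ?(ltW C0)//.
  exact: clamp_lipschitz.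
have [f [f_mono f0 f_lip fK f_psi]] :=
  lipschitz_regularization psi_mono psi0 psiK psi_modulus.
have K0 : 0 <= K by rewrite addr_ge0.
have psiK2 s : `|psi s| <= K *+ 2 by apply: le_trans (psiK s) _; rewrite mulr2n lerDl.
have [N hN] := euler_steps_exist T0; pose dn n := T / (N n)%:R.
have N0 n : 0 < (N n)%:R :> R by have [+ _ _] := hN n; rewrite ltr0n.
have dn0 n : 0 < dn n by rewrite divr_gt0.
have [U [UU oU]] := ultra_nat_exists.
have FU : ProperFilter U by exact: ultra_proper.
have dnU e : 0 < e -> \forall n \near U, dn n < e.
  move=> e0; have ei : 0 <= e^-1 by rewrite invr_ge0 ltW.
  apply: oU; exists (Num.bound e^-1) => // n /= bn.
  have [_ h1 _] := hN n; rewrite -ler_pdivlMr// div1r in h1.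
  apply: le_lt_trans h1 _; rewrite invf_plt ?posrE//.
  by apply: lt_le_trans (archi_boundP ei) _; rewrite ler_nat leqW.
have cfl n x : (pickle x < n)%N -> dn n * degree G x * n%:R <= 1.
  by have [_ _] := hN n; exact.
have cM : `|M| <= M by rewrite ger0_norm.
have cM' : `|- M| <= M by rewrite normrN.
have su := ulim_solution UU oU dn0 dnU f_mono f0 f_lip fK psiK2 f_psi psi_modulus
  cfl M0 cM u0M T psi_phi.
have sv := ulim_solution UU oU dn0 dnU f_mono f0 f_lip fK psiK2 f_psi psi_modulus
  cfl M0 cM' u0M T psi_phi.
have eq_uv := uniq_sol _ _ su sv.
(* For large [n] the boundary gap of [f n] is at least [g / 2], and [T (g / 2) / h = 2 M + 2]
   exceeds the threshold [2 M] of [flux_gap_exists]. *)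
pose h := T * g / (4 * M + 4).
have Tg : 0 < T * g by rewrite mulr_gt0.
have M4 : 0 < 4 * M + 4 by rewrite ltr_wpDl// mulr_ge0.
have h0 : 0 < h by rewrite divr_gt0.
have [x ex] := incomplete_defect_sup h0 nsc (ltac:(lra) : 3 / 4 < 1 :> R).
have g4 : 0 < g / 4 by rewrite divr_gt0.
have [m hm] := f_psi _ g4.
have gap n : (m <= n)%N -> g / 2 <= f n M - f n (- M).
  move=> mn; have := hm n M mn; have := hm n (- M) mn; rewrite !psi_phi//.
  by rewrite !ler_norml /g; lra.
(* For [n < m] the gap is not yet controlled and [k n] is the dummy value 0; the ultrafilter ignores
   these indices. *)
have /choice[k hk] n : exists k : nat, (k <= N n)%N /\ ((m <= n)%N -> g / 4 <=
    f n (euler G (f n) (dn n) n M u0 k x) - f n (euler G (f n) (dn n) n (- M) u0 k x)).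
  case: (leqP m n) => [mn|_]; last by exists 0.
  have big : 2 * M < (N n)%:R * dn n * (f n M - f n (- M)) / h.
    have -> : (N n)%:R * dn n = T by rewrite /dn mulrC divfK// gt_eqF.
    rewrite ltr_pdivlMr// /h mulrA ltr_pdivrMr//.
    have gq := ler_wpM2l (ltW T0) (gap n mn); have := ler_wpM2l M0 gq.
    by move: Tg gq; move: (f n M - f n (- M)) (M) (g) => q a b; lra.
  have [j jN hj] := flux_gap_exists (f_mono n) (f0 n) (f_lip n) (fK n) M0 (dn0 n)
    (@cfl n) h0 u0M big ex.
  exists j; split=> [|_]; first exact: ltnW.
  by apply: le_trans hj; have := gap n mn; lra.
have kT n : 0 <= (k n)%:R * dn n <= T.
  rewrite mulr_ge0 ?(ltW (dn0 n))//= /dn mulrA ler_pdivrMr// mulrC ler_pM2l//.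
  by rewrite ler_nat; have [] := hk n.
(* The steps [k n] move with [n], but their times converge to some [t] in [0, T]; [time_cvg]
   evaluates both limits along them, so a flux gap of [g / 4] survives at time [t]. *)
have [t _ ct] := @ultra_bounded_cvg _ U UU (fun n => (k n)%:R * dn n) T
  ltac:(by move=> n; have /andP[a b] := kT n; rewrite ger0_norm).
have tT : 0 <= t <= T.
  apply/andP; split.
    by apply: (cvgr_to_ge ct); apply: nearW => n; have /andP[] := kT n.
  by apply: (cvgr_to_le ct); apply: nearW => n; have /andP[] := kT n.
have [t0 _] := andP tT.
have cu := time_cvg_along UU (flux_time_cvg UU oU dn0 dnU f_mono f0 f_lip fK psiK2 f_psi
  psi_modulus cfl M0 cM u0M x t0) ct.
have cv := time_cvg_along UU (flux_time_cvg UU oU dn0 dnU f_mono f0 f_lip fK psiK2 f_psi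
  psi_modulus cfl M0 cM' u0M x t0) ct.
have H := @cvgr_to_ge _ U _ _ _ _ (g / 4) (cvgB cu cv).
have : g / 4 <= 0.
  rewrite -(subrr (psi (ulim U dn G f M u0 t x))) {2}(eq_uv t x tT); apply: H.
  apply: oU; exists m => // n mn; have [_] := hk n; exact.
by rewrite leNgt g4.
Qed.

End nonuniqueness.

Theorem theorem1 (R : realType) (X : countType) (G : graph R X) (T : R)
    (hT : 0 < T) :
  (stochastically_complete_at_infinity G <->
     (exists phi : R -> R, exists u0 : X -> R,
        nonlinearity phi /\ ell_infty u0 /\ unique_bounded_solution G T phi u0))
  /\
  (stochastically_complete_at_infinity G <->
     (forall (phi : R -> R) (u0 : X -> R),
        nonlinearity phi -> ell_infty u0 -> unique_bounded_solution G T phi u0)).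
Proof.
have ac : stochastically_complete_at_infinity G -> forall (phi : R -> R) (u0 : X -> R),
    nonlinearity phi -> ell_infty u0 -> unique_bounded_solution G T phi u0.
  by move=> sc phi u0 phiN _ u v su sv t x; exact: (solutions_agree hT phiN su sv sc).
have cb : (forall (phi : R -> R) (u0 : X -> R), nonlinearity phi -> ell_infty u0 ->
      unique_bounded_solution G T phi u0) ->
    exists phi : R -> R, exists u0 : X -> R,
      nonlinearity phi /\ ell_infty u0 /\ unique_bounded_solution G T phi u0.
  move=> H; exists id, (fun=> 0).
  have idN : nonlinearity (id : R -> R).
    split=> //; [by move=> ?; exact: cvg_id|by move=> s1 s2 /ltW|].
    by exists 0, 1; apply/eqP; rewrite eq_sym oner_eq0.
  have z0 : ell_infty (fun _ : X => 0 : R) by exists 0 => x; rewrite normr0.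
  by split=> //; split=> //; exact: H.
have ba : (exists phi : R -> R, exists u0 : X -> R,
      nonlinearity phi /\ ell_infty u0 /\ unique_bounded_solution G T phi u0) ->
    stochastically_complete_at_infinity G.
  move=> [phi [u0 [phiN [u0b u0u]]]]; apply: contrapT => nsc.
  exact: (incomplete_not_unique hT nsc phiN u0b u0u).
by split; split=> [sc|]; [exact/cb/ac|exact: ba|exact: ac|move=> /cb /ba].
Qed.
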